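(* (i) Let $p,q$ be positive integers. The real Clifford superalgebra $\mathbb{R}_{p,q}$ is graded Morita equivalent to a superalgebra $B$; under the corresponding equivalence $\mathrm{Gr}\,\mathbb{R}_{p,q}\simeq\mathrm{Gr}\,B$ the set $\mathrm{Irr}_{p,q}$ corresponds to a set $I$ of irreducible graded $B$-modules (a complete irredundant list up to isomorphism in $\mathrm{Gr}\,B$); and $B$, $I$, the cardinality $v_{p,q}$ of $\mathrm{Irr}_{p,q}$ and the Grothendieck group $K_{p,q}$ are as follows, according to $p-q \pmod 8$: - $p-q\equiv0$: $B=\mathbb{R}$, $I=\{\mathbb{R},\sigma(\mathbb{R})\}$, $v_{p,q}=2$, $K_{p,q}\cong\mathbb{Z}\oplus\mathbb{Z}$; - $p-q\equiv1$: $B=\mathbb{R}_{1,0}$, $I=\{\mathbb{R}_{1,0}\}$, $v_{p,q}=1$, $K_{p,q}\cong\mathbb{Z}$; - $p-q\equiv2$: $B=\mathbb{R}_{2,0}$, $I=\{\mathbb{R}_{2,0}\}$, $v_{p,q}=1$, $K_{p,q}\cong\mathbb{Z}$; - $p-q\equiv3$: $B=\mathbb{R}_{3,0}$, $I=\{\mathbb{R}_{3,0}\}$, $v_{p,q}=1$, $K_{p,q}\cong\mathbb{Z}$; - $p-q\equiv4$: $B=\mathbb{H}$, $I=\{\mathbb{H},\sigma(\mathbb{H})\}$, $v_{p,q}=2$, $K_{p,q}\cong\mathbb{Z}\oplus\mathbb{Z}$; - $p-q\equiv5$: $B=\mathbb{R}_{0,1}$, $I=\{\mathbb{R}_{0,1}\}$,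 $v_{p,q}=1$, $K_{p,q}\cong\mathbb{Z}$; - $p-q\equiv6$: $B=\mathbb{R}_{0,2}$, $I=\{\mathbb{R}_{0,2}\}$, $v_{p,q}=1$, $K_{p,q}\cong\mathbb{Z}$; - $p-q\equiv7$: $B=\mathbb{R}_{0,3}$, $I=\{\mathbb{R}_{0,3}\}$, $v_{p,q}=1$, $K_{p,q}\cong\mathbb{Z}$. (ii) Let $p$ be a positive integer. The complex Clifford superalgebra $\mathbb{C}_{p,0}$ is graded Morita equivalent to a superalgebra $B$; under the corresponding equivalence $\mathrm{Gr}\,\mathbb{C}_{p,0}\simeq\mathrm{Gr}\,B$ the set $\mathrm{Irr}_p^{\mathbb{C}}$ corresponds to a set $I$ of irreducible graded $B$-modules (a complete irredundant list up to isomorphism in $\mathrm{Gr}\,B$); and $B$, $I$, the cardinality $v_p^{\mathbb{C}}$ of $\mathrm{Irr}_p^{\mathbb{C}}$ and the Grothendieck group $K_p^{\mathbb{C}}$ are: - $p$ even: $B=\mathbb{C}$, $I=\{\mathbb{C},\sigma(\mathbb{C})\}$, $v_p^{\mathbb{C}}=2$, $K_p^{\mathbb{C}}\cong\mathbb{Z}\oplus\mathbb{Z}$; - $p$ odd: $B=\mathbb{C}_{1,0}$, $I=\{\mathbb{C}_{1,0}\}$, $v_p^{\mathbb{C}}=1$, $K_p^{\mathbb{C}}\cong\mathbb{Z}$.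
   Context: Superalgebras. A superalgebra over a field $K$ is a $\mathbb{Z}_2$-graded unital associative $K$-algebra $A=A_0\oplus A_1$ with $A_iA_j\subseteq A_{i+j}$. Homomorphisms (hence isomorphisms $\cong$) of superalgebras are even (degree-preserving) algebra homomorphisms. $\mathbb{R},\mathbb{C},\mathbb{H}$ (real numbers, complex numbers, quaternions) are regarded as superalgebras concentrated in degree zero. Modules. ''$A$-module'' means $\mathbb{Z}_2$-graded left $A$-module. $\mathrm{Gr}\,A$ is the category of $A$-modules with even (degree-preserving) $A$-linear maps. The suspension functor $\sigma:\mathrm{Gr}\,A\to\mathrm{Gr}\,A$ is $\sigma(M)_i=M_{i+1}$, with $a\,\sigma(m)=\sigma(am)$, keeping underlying linear maps of morphisms. $\mathrm{End}^\sigma_A(M)=\mathrm{Hom}_{\mathrm{Gr}A}(M,M)\oplus\mathrm{Hom}_{\mathrm{Gr}A}(\sigma(M),M)$ (degrees $0$ and $1$) is a superalgebra whose multiplication is composition of underlying linear maps, with maps written on the right, so that $\mathrm{End}^\sigma_A(Af)=fAf$ for a degree-zero idempotent $f$. Equivalence. Finite dimensional superalgebras $A,B$ over $K$ are graded Morita equivalent if $\mathrm{Gr}\,A$ and $\mathrm{Gr}\,B$ are equivalent and $B\cong\mathrm{End}^\sigma_A(P)$ for some finitely generated projective $A$-module $P$. Clifford superalgebras. $\mathbb{R}_{p,q}$ (for non-negative integers $p,q$) is the real unital superalgebra generated by odd $e_1,\dots,e_{p+q}$ with $e_ie_j+e_je_i=0$ for $i\ne j$, $e_i^2=1$ for $1\le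 i\le p$, $e_{p+j}^2=-1$ for $1\le j\le q$. $\mathbb{C}_{p,0}$ is the complex unital superalgebra generated by odd $e_1,\dots,e_p$ with $e_ie_j+e_je_i=0$ for $i\ne j$ and $e_i^2=1$. A superalgebra listed as a module is regarded as the graded left regular module over itself. Irreducibles and Grothendieck groups. $\mathrm{Irr}_{p,q}$ (resp. $\mathrm{Irr}_p^{\mathbb{C}}$) is the set of isomorphism classes of irreducible graded modules in $\mathrm{Gr}\,\mathbb{R}_{p,q}$ (resp. $\mathrm{Gr}\,\mathbb{C}_{p,0}$). $K_{p,q}$ (resp. $K_p^{\mathbb{C}}$) is the Grothendieck group of the category of finite dimensional graded real representations of $\mathbb{R}_{p,q}$ (resp. finite dimensional graded complex representations of $\mathbb{C}_{p,0}$).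
   Formalization: The entries for B and I in rows p-q≡5 and p-q≡7 are interchanged (R_{0,3} for 5, R_{0,1} for 7), since the printed ones are false: e.g. irreducibles of R_{1,4} have endomorphism ring H, but those of R_{0,1} have R. *)

(* Defs.v *)
From HB Require Import structures.
From mathcomp Require Import all_boot all_order all_algebra.
From mathcomp Require Import generic_quotient ring.
From mathcomp Require Import boolp classical_sets.
From mathcomp Require Import reals complex.

Set Implicit Arguments.
Unset Strict Implicit.
Unset Printing Implicit Defensive.

Import GRing.Theory.
Local Open Scope quotient_scope.
Local Open Scope classical_set_scope.
Local Open Scope ring_scope.

(** Z/2Z is represented by [bool]: addition is [addb], and [~~ i] is [i + 1]. *)

Definition Z2grading (V : zmodType) (G : bool -> set V) : Prop :=
  [/\ forall i, G i 0,
      forall i x y, G i x -> G i y -> G i (x - y) &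
      forall x, exists! u : V * V, [/\ G false u.1, G true u.2 & x = u.1 + u.2]].

Section Gradings.
Variables (V : zmodType) (G : bool -> set V).
Hypothesis GP : Z2grading G.

Lemma Z2gr0 i : G i 0. Proof. by case: GP. Qed.

Lemma Z2grB i x y : G i x -> G i y -> G i (x - y).
Proof. by case: GP => _ h _; apply: h. Qed.

Lemma Z2grN i x : G i x -> G i (- x).
Proof. by move=> h; rewrite -sub0r; apply: Z2grB (Z2gr0 i) h. Qed.

Lemma Z2grD i x y : G i x -> G i y -> G i (x + y).
Proof. by move=> hx hy; rewrite -[y]opprK; apply: Z2grB hx (Z2grN hy). Qed.

Lemma Z2gr_uniq a b c d : G false a -> G true b -> G false c -> G true d ->
  a + b = c + d -> a = c /\ b = d.
Proof.
move=> ha hb hc hd E; case: GP => _ _ /(_ (a + b)) [u [_ uniq]].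
have h1 : u = (a, b) by apply: uniq.
have h2 : u = (c, d) by apply: uniq.
by move: h2; rewrite h1 => -[-> ->].
Qed.

Lemma Z2gradingN : Z2grading (fun i => G (~~ i)).
Proof.
case: GP => G0 GB Gdec; split=> [i|i x y|x]; [exact: G0 | exact: GB |].
have [[u0 u1] [[/= h0 h1 xE] uniq]] := Gdec x.
exists (u1, u0); split=> [|[w0 w1] [/= k0 k1 xE']].
  by split=> //=; rewrite addrC.
have /uniq [-> ->] // : [/\ G false (w1, w0).1, G true (w1, w0).2 &
  x = (w1, w0).1 + (w1, w0).2].
by split=> //=; rewrite addrC.
Qed.

End Gradings.

(** A K-algebra is given as a ring with a ring morphism from K to its centre.
    Unlike [algType], this includes the zero ring, which is [endS P] for P = 0. *)
Record superalgebra (K : fieldType) := Superalgebra {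
  sa_ring :> pzRingType;
  sa_scalar : {rmorphism K -> sa_ring};
  sa_scalarC : forall k a, sa_scalar k * a = a * sa_scalar k;
  sa_gr : bool -> set sa_ring;
  sa_grP : Z2grading sa_gr;
  sa_grZ : forall k i a, sa_gr i a -> sa_gr i (sa_scalar k * a);
  sa_grM : forall i j a b, sa_gr i a -> sa_gr j b -> sa_gr (i (+) j) (a * b)
}.
Arguments sa_scalar {K} A : rename.
Arguments sa_gr {K} A i _ : rename.

Lemma sa_gr1 (K : fieldType) (A : superalgebra K) : sa_gr A false 1.
Proof.
have gP := sa_grP A; case: (gP) => _ _ /(_ 1) [[u0 u1] [[/= h0 h1 E] _]].
have [|||||_ u01] := Z2gr_uniq gP (a := u0 * u0) (b := u0 * u1) (c := u0) (d := 0).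
- exact: (sa_grM h0 h0).
- exact: (sa_grM h0 h1).
- by [].
- exact: Z2gr0.
- by rewrite -mulrDr -E mulr1 addr0.
have [|||||_ u1E] := Z2gr_uniq gP (a := u1 * u1) (b := u0 * u1) (c := 0) (d := u1).
- exact: (sa_grM h1 h1).
- exact: (sa_grM h0 h1).
- exact: Z2gr0.
- by [].
- by rewrite addrC -mulrDl -E mul1r add0r.
by rewrite E -u1E u01 addr0.
Qed.

Definition superalg_iso (K : fieldType) (A B : superalgebra K) : Prop :=
  exists f : {rmorphism A -> B},
    [/\ bijective f,
        forall k, f (sa_scalar A k) = sa_scalar B k &
        forall i a, sa_gr A i a -> sa_gr B i (f a)].

Definition sa_fin_dim (K : fieldType) (A : superalgebra K) : Prop :=
  exists s : seq A, forall a, exists c : nat -> K,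
    a = \sum_(i < size s) sa_scalar A (c i) * s`_i.

Record grmod (K : fieldType) (A : superalgebra K) := GrMod {
  gm_mod :> lmodType A;
  gm_gr : bool -> set gm_mod;
  gm_grP : Z2grading gm_gr;
  gm_grM : forall i j a m, sa_gr A i a -> gm_gr j m -> gm_gr (i (+) j) (a *: m)
}.
Arguments gm_gr {K A} M i _ : rename.

Record grhom (K : fieldType) (A : superalgebra K) (M N : grmod A) := GrHom {
  gh_fun :> M -> N;
  gh_lin : linear gh_fun;
  gh_even : forall i m, gm_gr M i m -> gm_gr N i (gh_fun m)
}.

Section Modules.
Variables (K : fieldType) (A : superalgebra K).
Implicit Types M N P : grmod A.

Definition regular : grmod A :=
  @GrMod K A (A : pzRingType)^o (sa_gr A) (sa_grP A) (@sa_grM K A).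

Lemma shift_subproof M i j a m :
  sa_gr A i a -> gm_gr M (~~ j) m -> gm_gr M (~~ (i (+) j)) (a *: m).
Proof. by move=> ia jm; rewrite -addbN; apply: gm_grM. Qed.

Definition shift M : grmod A :=
  @GrMod K A M (fun i => gm_gr M (~~ i)) (Z2gradingN (gm_grP M))
    (@shift_subproof M).

Lemma gh_eq M N (f g : grhom M N) : f =1 g -> f = g.
Proof.
case: f g => [f fl fe] [g gl ge] /= /funext fg; subst g.
by rewrite (Prop_irrelevance fl gl) (Prop_irrelevance fe ge).
Qed.

Lemma gh0 M N (f : grhom M N) : f 0 = 0.
Proof.
have := gh_lin f 1 0 0; rewrite !scale1r addr0 => h.
by apply: (addrI (f 0)); rewrite -h addr0.
Qed.

Lemma ghD M N (f : grhom M N) x y : f (x + y) = f x + f y.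
Proof. by have := gh_lin f 1 x y; rewrite !scale1r. Qed.

Lemma ghZ M N (f : grhom M N) a x : f (a *: x) = a *: f x.
Proof. by have := gh_lin f a x 0; rewrite !addr0 gh0 addr0. Qed.

Lemma ghN M N (f : grhom M N) x : f (- x) = - f x.
Proof. by apply: (addrI (f x)); rewrite -ghD !subrr gh0. Qed.

Lemma gr_id_lin M : linear (@id M). Proof. by []. Qed.

Definition gr_id M : grhom M M := GrHom (@gr_id_lin M) (fun i m h => h).

Lemma gr_comp_lin M N P (g : grhom N P) (f : grhom M N) : linear (g \o f).
Proof. by move=> a x y /=; rewrite !gh_lin. Qed.

Definition gr_comp M N P (g : grhom N P) (f : grhom M N) : grhom M P :=
  GrHom (gr_comp_lin g f) (fun i m h => gh_even g (gh_even f h)).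

End Modules.

(** [EndS f0 f1] stands for the linear map [f0 + f1 : P -> P]. *)
Record endS (K : fieldType) (A : superalgebra K) (P : grmod A) := EndS {
  end0 : grhom P P;
  end1 : grhom (shift P) P
}.

Section EndS.
Variables (K : fieldType) (A : superalgebra K) (P : grmod A).
Local Notation E := (endS P).
Implicit Types f g h : E.

HB.instance Definition _ := gen_eqMixin E.
HB.instance Definition _ := gen_choiceMixin E.

Lemma endS_eq f g : end0 f =1 end0 g -> end1 f =1 end1 g -> f = g.
Proof.
by case: f g => [a b] [c d] /= h0 h1; rewrite (gh_eq h0) (gh_eq (M := shift P) h1).
Qed.

Lemma zero_lin (M N : grmod A) : linear (fun _ : M => 0 : N).
Proof. by move=> a x y; rewrite scaler0 addr0. Qed.

Definition zeroh (M N : grmod A) : grhom M N :=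
  GrHom (@zero_lin M N) (fun i _ _ => Z2gr0 (gm_grP N) i).

Lemma opp_lin (M N : grmod A) (f : grhom M N) : linear (fun m => - f m).
Proof. by move=> a x y; rewrite gh_lin opprD scalerN. Qed.

Definition opph (M N : grmod A) (f : grhom M N) : grhom M N :=
  GrHom (opp_lin f) (fun i m mi => Z2grN (gm_grP N) (gh_even f mi)).

Lemma add_lin (M N : grmod A) (f g : grhom M N) : linear (fun m => f m + g m).
Proof. by move=> a x y; rewrite !gh_lin scalerDr addrACA. Qed.

Definition addh (M N : grmod A) (f g : grhom M N) : grhom M N :=
  GrHom (add_lin f g)
    (fun i m mi => Z2grD (gm_grP N) (gh_even f mi) (gh_even g mi)).

Definition endS_zero : E := EndS (zeroh P P) (zeroh (shift P) P).
Definition endS_opp f : E := EndS (opph (end0 f)) (opph (end1 f)).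
Definition endS_add f g : E :=
  EndS (addh (end0 f) (end0 g)) (addh (end1 f) (end1 g)).

Lemma endS_addA : associative endS_add.
Proof. by move=> f g h; apply: endS_eq => x /=; rewrite addrA. Qed.
Lemma endS_addC : commutative endS_add.
Proof. by move=> f g; apply: endS_eq => x /=; rewrite addrC. Qed.
Lemma endS_add0 : left_id endS_zero endS_add.
Proof. by move=> f; apply: endS_eq => x /=; rewrite add0r. Qed.
Lemma endS_addN : left_inverse endS_zero endS_opp endS_add.
Proof. by move=> f; apply: endS_eq => x /=; rewrite addNr. Qed.

HB.instance Definition _ :=
  GRing.isZmodule.Build E endS_addA endS_addC endS_add0 endS_addN.

Lemma end1_even f i m : gm_gr P i m -> gm_gr P (~~ i) (end1 f m).
Proof. by move=> h; apply: gh_even; rewrite /= negbK. Qed.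

Lemma mul0_lin f g : linear (fun m : P => end0 g (end0 f m) + end1 g (end1 f m)).
Proof. by move=> a x y; rewrite !gh_lin scalerDr addrACA. Qed.
Lemma mul0_even f g i (m : P) : gm_gr P i m ->
  gm_gr P i (end0 g (end0 f m) + end1 g (end1 f m)).
Proof.
move=> h; apply: (Z2grD (gm_grP P)); first by do 2 apply: gh_even.
by rewrite -(negbK i); do 2 apply: end1_even.
Qed.

Lemma mul1_lin f g :
  linear (fun m : shift P => end1 g (end0 f m) + end0 g (end1 f m) : P).
Proof. by move=> a x y; rewrite !gh_lin scalerDr addrACA. Qed.
Lemma mul1_even f g i (m : shift P) : gm_gr (shift P) i m ->
  gm_gr P i (end1 g (end0 f m) + end0 g (end1 f m)).
Proof.
move=> h; rewrite -(negbK i); apply: (Z2grD (gm_grP P)).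
  by apply: end1_even; apply: gh_even.
by apply: gh_even; apply: end1_even.
Qed.

(** Maps are written on the right: [f * g] is "first [f], then [g]". *)
Definition endS_mul f g : E :=
  EndS (GrHom (mul0_lin f g) (@mul0_even f g))
       (GrHom (mul1_lin f g) (@mul1_even f g)).

Definition endS_one : E := EndS (gr_id P) (zeroh (shift P) P).

Lemma endS_mulA : associative endS_mul.
Proof.
move=> f g h; apply: endS_eq => x /=; rewrite !ghD -!addrA; congr (_ + _).
  by rewrite addrA addrC.
by rewrite addrA addrC.
Qed.
Lemma endS_mul1l : left_id endS_one endS_mul.
Proof. by move=> f; apply: endS_eq => x /=; rewrite gh0 addr0. Qed.
Lemma endS_mul1r : right_id endS_one endS_mul.
Proof. by move=> f; apply: endS_eq => x /=; rewrite ?addr0 ?add0r. Qed.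
Lemma endS_mulDl : left_distributive endS_mul +%R.
Proof. by move=> f g h; apply: endS_eq => x /=; rewrite !ghD addrACA. Qed.
Lemma endS_mulDr : right_distributive endS_mul +%R.
Proof. by move=> f g h; apply: endS_eq => x /=; rewrite addrACA. Qed.

HB.instance Definition _ := GRing.Zmodule_isPzRing.Build E
  endS_mulA endS_mul1l endS_mul1r endS_mulDl endS_mulDr.

Lemma scalar_lin k : linear (fun m : P => sa_scalar A k *: m).
Proof. by move=> a x y; rewrite scalerDr !scalerA sa_scalarC. Qed.
Lemma scalar_even k i (m : P) :
  gm_gr P i m -> gm_gr P i (sa_scalar A k *: m).
Proof.
apply: (@gm_grM _ _ _ false).
by rewrite -[sa_scalar A k]mulr1; apply: sa_grZ; apply: sa_gr1.
Qed.

Definition endS_scalar k : E :=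
  EndS (GrHom (scalar_lin k) (@scalar_even k)) (zeroh (shift P) P).

Lemma endS_scalar_zmod : zmod_morphism endS_scalar.
Proof.
move=> a b; apply: endS_eq => x /=; last by rewrite subr0.
by rewrite rmorphB scalerBl.
Qed.
Lemma endS_scalar_monoid : monoid_morphism endS_scalar.
Proof.
split=> [|a b]; apply: endS_eq => x /=; rewrite ?rmorph1 ?scale1r //.
  by rewrite addr0 mulrC rmorphM scalerA.
by rewrite scaler0 addr0.
Qed.

HB.instance Definition _ :=
  GRing.isZmodMorphism.Build K E endS_scalar endS_scalar_zmod.
HB.instance Definition _ :=
  GRing.isMonoidMorphism.Build K E endS_scalar endS_scalar_monoid.

Lemma endS_scalarC k f : endS_scalar k * f = f * endS_scalar k.
Proof.
by apply: endS_eq => x /=; rewrite ?gh0 ?scaler0 !ghZ ?addr0 ?add0r.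
Qed.

Definition endS_gr (i : bool) : set E :=
  [set f | if i then end0 f = zeroh P P else end1 f = zeroh (shift P) P].

Lemma endS_grP : Z2grading endS_gr.
Proof.
split=> [[]//|[] f g|f] /=.
- by move=> fE gE; apply: gh_eq => x /=; rewrite fE gE subr0.
- by move=> fE gE; apply: gh_eq => x /=; rewrite fE gE subr0.
exists (EndS (end0 f) (zeroh _ _), EndS (zeroh _ _) (end1 f)); split.
  by split=> //=; apply: endS_eq => x /=; rewrite ?addr0 ?add0r.
move=> [[u0 u1] [v0 v1]] [/= -> -> ->] /=.
by congr (EndS _ _, EndS _ _); apply: gh_eq => x /=; rewrite ?addr0 ?add0r.
Qed.

Lemma endS_grM i j f g :
  endS_gr i f -> endS_gr j g -> endS_gr (i (+) j) (f * g).
Proof.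
by case: i; case: j => /= fE gE; apply: gh_eq => x /=;
  rewrite fE gE /= ?gh0 ?addr0 ?add0r.
Qed.

Lemma endS_grZ k i f : endS_gr i f -> endS_gr i (endS_scalar k * f).
Proof. by apply: (@endS_grM false). Qed.

Definition EndSigma : superalgebra K :=
  Superalgebra endS_scalarC endS_grP endS_grZ endS_grM.

End EndS.

Section DegreeZero.
Variables (K : fieldType) (A : pzRingType) (s : {rmorphism K -> A}).
Hypothesis sC : forall k a, s k * a = a * s k.

Definition degree0_gr (i : bool) : set A := if i then [set 0] else setT.

Lemma degree0_grP : Z2grading degree0_gr.
Proof.
split=> [[]//|[] x y //= -> ->|x]; first by rewrite /= subr0.
exists (x, 0); split=> /=; first by rewrite addr0.
by move=> [u v] [/= _ -> ->]; rewrite addr0.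
Qed.

Lemma degree0_grM i j a b :
  degree0_gr i a -> degree0_gr j b -> degree0_gr (i (+) j) (a * b).
Proof.
case: i; case: j => //=.
- by move=> -> _; rewrite mul0r.
- by move=> _ ->; rewrite mulr0.
Qed.

Lemma degree0_grZ k i a : degree0_gr i a -> degree0_gr i (s k * a).
Proof. by apply: (@degree0_grM false). Qed.

Definition degree0 : superalgebra K :=
  Superalgebra sC degree0_grP degree0_grZ degree0_grM.

End DegreeZero.

Definition ground (K : fieldType) : superalgebra K :=
  @degree0 K K idfun (@mulrC K).

Record quaternion (K : Type) := Quat { qr : K; qi : K; qj : K; qk : K }.

Section Quaternions.
Variable K : fieldType.
Local Notation H := (quaternion K).
Implicit Types x y z : H.

HB.instance Definition _ := gen_eqMixin H.
HB.instance Definition _ := gen_choiceMixin H.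

Definition quat_add x y : H :=
  Quat (qr x + qr y) (qi x + qi y) (qj x + qj y) (qk x + qk y).
Definition quat_opp x : H := Quat (- qr x) (- qi x) (- qj x) (- qk x).
Definition quat_mul x y : H :=
  Quat (qr x * qr y - qi x * qi y - qj x * qj y - qk x * qk y)
       (qr x * qi y + qi x * qr y + qj x * qk y - qk x * qj y)
       (qr x * qj y - qi x * qk y + qj x * qr y + qk x * qi y)
       (qr x * qk y + qi x * qj y - qj x * qi y + qk x * qr y).
Definition quat_scalar (k : K) : H := Quat k 0 0 0.

Lemma quat_addA : associative quat_add.
Proof. by move=> x y z; congr Quat; rewrite /= addrA. Qed.
Lemma quat_addC : commutative quat_add.
Proof. by move=> x y; congr Quat; rewrite /= addrC. Qed.
Lemma quat_add0 : left_id (quat_scalar 0) quat_add.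
Proof. by case=> a b c d; congr Quat; rewrite /= add0r. Qed.
Lemma quat_addN : left_inverse (quat_scalar 0) quat_opp quat_add.
Proof. by case=> a b c d; congr Quat; rewrite /= addNr. Qed.

HB.instance Definition _ :=
  GRing.isZmodule.Build H quat_addA quat_addC quat_add0 quat_addN.

Lemma quat_mulA : associative quat_mul.
Proof. by move=> x y z; congr Quat => /=; ring. Qed.
Lemma quat_mul1l : left_id (quat_scalar 1) quat_mul.
Proof. by case=> a b c d; congr Quat => /=; ring. Qed.
Lemma quat_mul1r : right_id (quat_scalar 1) quat_mul.
Proof. by case=> a b c d; congr Quat => /=; ring. Qed.
Lemma quat_mulDl : left_distributive quat_mul +%R.
Proof. by move=> x y z; congr Quat => /=; ring. Qed.
Lemma quat_mulDr : right_distributive quat_mul +%R.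
Proof. by move=> x y z; congr Quat => /=; ring. Qed.

HB.instance Definition _ := GRing.Zmodule_isPzRing.Build H
  quat_mulA quat_mul1l quat_mul1r quat_mulDl quat_mulDr.

Lemma quat_scalar_zmod : zmod_morphism quat_scalar.
Proof. by move=> a b; congr Quat; rewrite /= subr0. Qed.
Lemma quat_scalar_monoid : monoid_morphism quat_scalar.
Proof. by split=> // a b; congr Quat => /=; ring. Qed.

HB.instance Definition _ :=
  GRing.isZmodMorphism.Build K H quat_scalar quat_scalar_zmod.
HB.instance Definition _ :=
  GRing.isMonoidMorphism.Build K H quat_scalar quat_scalar_monoid.

Lemma quat_scalarC k x : quat_scalar k * x = x * quat_scalar k.
Proof. by congr Quat => /=; ring. Qed.

Definition quaternions : superalgebra K := degree0 quat_scalarC.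

End Quaternions.

(** The algebra presented by generators and relations: noncommutative
    polynomial expressions in [n] letters, modulo the smallest congruence
    [cliff_eq p] that contains the axioms of unital associative K-algebras and
    the Clifford relations, the first [p] generators having square 1 and the
    remaining ones square -1. *)
Inductive cterm (K : Type) (n : nat) :=
| CGen of 'I_n
| CConst of K
| CAdd of cterm K n & cterm K n
| CMul of cterm K n & cterm K n.
Arguments CGen {K n}.
Arguments CConst {K n}.

Section Clifford.
Variables (K : fieldType) (n p : nat).
Local Notation term := (cterm K n).

Inductive cliff_eq : term -> term -> Prop :=
| ceq_refl s : cliff_eq s s
| ceq_sym s t : cliff_eq s t -> cliff_eq t s
| ceq_trans s t u : cliff_eq s t -> cliff_eq t u -> cliff_eq s u
| ceq_add s s' t t' :
    cliff_eq s s' -> cliff_eq t t' -> cliff_eq (CAdd s t) (CAdd s' t')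
| ceq_mul s s' t t' :
    cliff_eq s s' -> cliff_eq t t' -> cliff_eq (CMul s t) (CMul s' t')
| ceq_addA s t u : cliff_eq (CAdd s (CAdd t u)) (CAdd (CAdd s t) u)
| ceq_addC s t : cliff_eq (CAdd s t) (CAdd t s)
| ceq_add0 s : cliff_eq (CAdd (CConst 0) s) s
| ceq_addN s : cliff_eq (CAdd (CMul (CConst (-1)) s) s) (CConst 0)
| ceq_mulA s t u : cliff_eq (CMul s (CMul t u)) (CMul (CMul s t) u)
| ceq_mul1l s : cliff_eq (CMul (CConst 1) s) s
| ceq_mul1r s : cliff_eq (CMul s (CConst 1)) s
| ceq_mulDl s t u :
    cliff_eq (CMul (CAdd s t) u) (CAdd (CMul s u) (CMul t u))
| ceq_mulDr s t u :
    cliff_eq (CMul s (CAdd t u)) (CAdd (CMul s t) (CMul s u))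
| ceq_constD k l : cliff_eq (CConst (k + l)) (CAdd (CConst k) (CConst l))
| ceq_constM k l : cliff_eq (CConst (k * l)) (CMul (CConst k) (CConst l))
| ceq_constC k s : cliff_eq (CMul (CConst k) s) (CMul s (CConst k))
| ceq_anticomm i j : i != j ->
    cliff_eq (CAdd (CMul (CGen i) (CGen j)) (CMul (CGen j) (CGen i))) (CConst 0)
| ceq_square i :
    cliff_eq (CMul (CGen i) (CGen i)) (CConst (if (i < p)%N then 1 else -1)).

HB.instance Definition _ := gen_eqMixin term.
HB.instance Definition _ := gen_choiceMixin term.

Definition cliff_eqb : rel term := fun s t => `[< cliff_eq s t >].

Lemma cliff_eqb_refl : reflexive cliff_eqb.
Proof. by move=> s; apply/asboolP/ceq_refl. Qed.
Lemma cliff_eqb_sym : symmetric cliff_eqb.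
Proof. by move=> s t; apply/asboolP/asboolP; apply: ceq_sym. Qed.
Lemma cliff_eqb_trans : transitive cliff_eqb.
Proof.
by move=> t s u /asboolP st /asboolP tu; apply/asboolP/(ceq_trans st tu).
Qed.

Canonical cliff_equiv :=
  EquivRel cliff_eqb cliff_eqb_refl cliff_eqb_sym cliff_eqb_trans.

Definition clifford_ring := {eq_quot cliff_equiv}.
Local Notation C := clifford_ring.

HB.instance Definition _ := Choice.on C.
HB.instance Definition _ := EqQuotient.on C.

Definition cliff_pi (t : term) : C := \pi_C t.

Lemma cliff_piP s t : cliff_pi s = cliff_pi t <-> cliff_eq s t.
Proof.
split=> [/eqP|st]; first by rewrite eqmodE => /asboolP.
by apply/eqP; rewrite eqmodE; apply/asboolP.
Qed.

Lemma cliff_repr t : cliff_eq (repr (cliff_pi t)) t.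
Proof. by apply/cliff_piP; rewrite /cliff_pi reprK. Qed.

Lemma cliff_ind (P : C -> Prop) : (forall t, P (cliff_pi t)) -> forall x, P x.
Proof. by move=> h x; rewrite -[x]reprK; apply: h. Qed.

Definition cliff_add (x y : C) : C := cliff_pi (CAdd (repr x) (repr y)).
Definition cliff_mul (x y : C) : C := cliff_pi (CMul (repr x) (repr y)).
Definition cliff_const (k : K) : C := cliff_pi (CConst k).
Definition cliff_gen (i : 'I_n) : C := cliff_pi (CGen i).
Definition cliff_opp (x : C) : C := cliff_mul (cliff_const (-1)) x.

Lemma cliff_piD s t : cliff_add (cliff_pi s) (cliff_pi t) = cliff_pi (CAdd s t).
Proof. by apply/cliff_piP/ceq_add; apply: cliff_repr. Qed.
Lemma cliff_piM s t : cliff_mul (cliff_pi s) (cliff_pi t) = cliff_pi (CMul s t).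
Proof. by apply/cliff_piP/ceq_mul; apply: cliff_repr. Qed.

Lemma cliff_addA : associative cliff_add.
Proof.
elim/cliff_ind=> s; elim/cliff_ind=> t; elim/cliff_ind=> u.
by rewrite !cliff_piD; apply/cliff_piP/ceq_addA.
Qed.
Lemma cliff_addC : commutative cliff_add.
Proof.
elim/cliff_ind=> s; elim/cliff_ind=> t.
by rewrite !cliff_piD; apply/cliff_piP/ceq_addC.
Qed.
Lemma cliff_add0 : left_id (cliff_const 0) cliff_add.
Proof. by elim/cliff_ind=> s; rewrite cliff_piD; apply/cliff_piP/ceq_add0. Qed.
Lemma cliff_addN : left_inverse (cliff_const 0) cliff_opp cliff_add.
Proof.
by elim/cliff_ind=> s; rewrite /cliff_opp cliff_piM cliff_piD;
  apply/cliff_piP/ceq_addN.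
Qed.

HB.instance Definition _ :=
  GRing.isZmodule.Build C cliff_addA cliff_addC cliff_add0 cliff_addN.

Lemma cliff_mulA : associative cliff_mul.
Proof.
elim/cliff_ind=> s; elim/cliff_ind=> t; elim/cliff_ind=> u.
by rewrite !cliff_piM; apply/cliff_piP/ceq_mulA.
Qed.
Lemma cliff_mul1l : left_id (cliff_const 1) cliff_mul.
Proof. by elim/cliff_ind=> s; rewrite cliff_piM; apply/cliff_piP/ceq_mul1l. Qed.
Lemma cliff_mul1r : right_id (cliff_const 1) cliff_mul.
Proof. by elim/cliff_ind=> s; rewrite cliff_piM; apply/cliff_piP/ceq_mul1r. Qed.
Lemma cliff_mulDl : left_distributive cliff_mul cliff_add.
Proof.
elim/cliff_ind=> s; elim/cliff_ind=> t; elim/cliff_ind=> u.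
by rewrite !(cliff_piM, cliff_piD); apply/cliff_piP/ceq_mulDl.
Qed.
Lemma cliff_mulDr : right_distributive cliff_mul cliff_add.
Proof.
elim/cliff_ind=> s; elim/cliff_ind=> t; elim/cliff_ind=> u.
by rewrite !(cliff_piM, cliff_piD); apply/cliff_piP/ceq_mulDr.
Qed.

HB.instance Definition _ := GRing.Zmodule_isPzRing.Build C
  cliff_mulA cliff_mul1l cliff_mul1r cliff_mulDl cliff_mulDr.

Lemma cliff_piDr s t : cliff_pi (CAdd s t) = cliff_pi s + cliff_pi t.
Proof. by rewrite -cliff_piD. Qed.
Lemma cliff_piMr s t : cliff_pi (CMul s t) = cliff_pi s * cliff_pi t.
Proof. by rewrite -cliff_piM. Qed.

Lemma cliff_constD k l : cliff_const (k + l) = cliff_const k + cliff_const l.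
Proof. by rewrite -cliff_piDr; apply/cliff_piP/ceq_constD. Qed.
Lemma cliff_constM k l : cliff_const (k * l) = cliff_const k * cliff_const l.
Proof. by rewrite -cliff_piMr; apply/cliff_piP/ceq_constM. Qed.

Lemma cliff_const_zmod : zmod_morphism cliff_const.
Proof.
by move=> k l; apply: (addIr (cliff_const l)); rewrite -cliff_constD !subrK.
Qed.
Lemma cliff_const_monoid : monoid_morphism cliff_const.
Proof. by split=> // k l; apply: cliff_constM. Qed.

HB.instance Definition _ :=
  GRing.isZmodMorphism.Build K C cliff_const cliff_const_zmod.
HB.instance Definition _ :=
  GRing.isMonoidMorphism.Build K C cliff_const cliff_const_monoid.

Lemma cliff_constC k (x : C) : cliff_const k * x = x * cliff_const k.
Proof.
by elim/cliff_ind: x => s; rewrite -!cliff_piMr; apply/cliff_piP/ceq_constC.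
Qed.

Lemma cliff_anticomm i j :
  i != j -> cliff_gen i * cliff_gen j + cliff_gen j * cliff_gen i = 0.
Proof.
by move=> ij; rewrite -!cliff_piMr -cliff_piDr; apply/cliff_piP/ceq_anticomm.
Qed.
Lemma cliff_square i :
  cliff_gen i * cliff_gen i = cliff_const (if (i < p)%N then 1 else -1).
Proof. by rewrite -cliff_piMr; apply/cliff_piP/ceq_square. Qed.

(** The grading for which the generators are odd. *)
Inductive cliff_gr : bool -> C -> Prop :=
| cgr_gen i : cliff_gr true (cliff_gen i)
| cgr_const k : cliff_gr false (cliff_const k)
| cgr_0 i : cliff_gr i 0
| cgr_add i x y : cliff_gr i x -> cliff_gr i y -> cliff_gr i (x + y)
| cgr_mul i j x y : cliff_gr i x -> cliff_gr j y -> cliff_gr (i (+) j) (x * y).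

Fixpoint cliff_part (i : bool) (t : term) : C :=
  match t with
  | CGen j => if i then cliff_gen j else 0
  | CConst k => if i then 0 else cliff_const k
  | CAdd s t => cliff_part i s + cliff_part i t
  | CMul s t => cliff_part false s * cliff_part i t +
                cliff_part true s * cliff_part (~~ i) t
  end.

Lemma cliff_part_gr i t : cliff_gr i (cliff_part i t).
Proof.
elim: t i => [j|k|s IHs t IHt|s IHs t IHt] i /=.
- by case: i; constructor.
- by case: i; constructor.
- by constructor.
- have h0 := cgr_mul (IHs false) (IHt i).
  have h1 := cgr_mul (IHs true) (IHt (~~ i)).
  by apply: cgr_add; [exact: h0 | move: h1; rewrite /= negbK].
Qed.

Lemma cliff_part_sum t : cliff_part false t + cliff_part true t = cliff_pi t.
Proof.
elim: t => [j|k|s IHs t IHt|s IHs t IHt] /=.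
- by rewrite add0r.
- by rewrite addr0.
- by rewrite addrACA IHs IHt -cliff_piDr.
- rewrite cliff_piMr -IHs -IHt mulrDl !mulrDr -!addrA.
  by congr (_ + _); rewrite addrC -!addrA.
Qed.

Lemma cliff_part_eq s t : cliff_eq s t -> forall i, cliff_part i s = cliff_part i t.
Proof.
elim=> {s t} /=.
- by [].
- by move=> s t _ IH i; rewrite IH.
- by move=> s t u _ IH _ IH' i; rewrite IH.
- by move=> s s' t t' _ IH _ IH' i; rewrite IH IH'.
- by move=> s s' t t' _ IH _ IH' i; rewrite !IH !IH'.
- by move=> s t u i; rewrite addrA.
- by move=> s t i; rewrite addrC.
- by move=> s []; rewrite add0r.
- move=> s i; rewrite mul0r addr0 rmorphN rmorph1 mulN1r addNr.
  by case: i; rewrite ?rmorph0.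
- move=> s t u i; rewrite !mulrDr !mulrDl !mulrA negbK -!addrA; congr (_ + _).
  by rewrite addrA addrC.
- by move=> s i; rewrite mul0r addr0 rmorph1 mul1r.
- by move=> s []; rewrite /= ?rmorph1 ?mulr1 ?mulr0 ?addr0 ?add0r.
- by move=> s t u i; rewrite !mulrDl addrACA.
- by move=> s t u i; rewrite !mulrDr addrACA.
- by move=> k l []; rewrite ?addr0 ?rmorphD.
- by move=> k l []; rewrite /= ?mulr0 ?mul0r ?addr0 ?rmorphM.
- by move=> k s []; rewrite /= ?mulr0 ?mul0r ?addr0 ?add0r cliff_constC.
- by move=> i j ij []; rewrite /= ?mulr0 ?mul0r ?addr0 ?add0r ?cliff_anticomm.
- by move=> i []; rewrite /= ?mulr0 ?mul0r ?addr0 ?add0r ?cliff_square.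
Qed.

Lemma cliff_gr_part i x : cliff_gr i x ->
  forall t, x = cliff_pi t -> forall j, cliff_part j t = if i == j then x else 0.
Proof.
elim=> {i x} [l|k|i|i x y _ IHx _ IHy|i i' x y _ IHx _ IHy] t.
- by move=> /cliff_piP/cliff_part_eq h [] /=; rewrite -h.
- by move=> /cliff_piP/cliff_part_eq h [] /=; rewrite -h.
- rewrite -(rmorph0 cliff_const) => /cliff_piP/cliff_part_eq h j.
  by rewrite -h /= rmorph0; case: ifP => _; case: ifP.
- move: IHx IHy; elim/cliff_ind: x => s; elim/cliff_ind: y => u IHs IHu.
  rewrite -cliff_piDr => /cliff_piP/cliff_part_eq h j.
  rewrite -h /= (IHs s) // (IHu u) //.
  by case: ifP => _; rewrite ?addr0 ?cliff_piDr.
- move: IHx IHy; elim/cliff_ind: x => s; elim/cliff_ind: y => u IHs IHu.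
  rewrite -cliff_piMr => /cliff_piP/cliff_part_eq h j.
  rewrite -h /= !(IHs s) // !(IHu u) // cliff_piMr.
  by case: i {IHs}; case: i' {IHu}; case: j;
    rewrite /= ?mulr0 ?mul0r ?addr0 ?add0r.
Qed.

Lemma cliff_grB i x y : cliff_gr i x -> cliff_gr i y -> cliff_gr i (x - y).
Proof.
move=> xi yi; apply: cgr_add => //; rewrite -mulN1r -(rmorphN1 cliff_const).
by rewrite -(addFb i); apply: cgr_mul => //; constructor.
Qed.

Lemma cliff_grP : Z2grading cliff_gr.
Proof.
split; [exact: cgr_0 | exact: cliff_grB | elim/cliff_ind=> t].
exists (cliff_part false t, cliff_part true t); split=> /=.
  by split; rewrite ?cliff_part_sum //; apply: cliff_part_gr.
move=> [u v] [/=]; elim/cliff_ind: u => s; elim/cliff_ind: v => r hs hr.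
rewrite -cliff_piDr => /cliff_piP/cliff_part_eq h.
rewrite !h /= !(cliff_gr_part hs erefl) !(cliff_gr_part hr erefl) /=.
by rewrite addr0 add0r.
Qed.

Lemma cliff_grZ k i a : cliff_gr i a -> cliff_gr i (cliff_const k * a).
Proof. by move=> h; rewrite -(addFb i); apply: cgr_mul => //; constructor. Qed.

Definition clifford_n : superalgebra K :=
  Superalgebra cliff_constC cliff_grP cliff_grZ cgr_mul.

End Clifford.

(** [clifford R p q] is R_{p,q}, and [clifford R[i] p 0] is C_{p,0}. *)
Definition clifford (K : fieldType) (p q : nat) : superalgebra K :=
  clifford_n K (p + q) p.

Record category := Category {
  ob :> Type;
  hom : ob -> ob -> Type;
  idm : forall x, hom x x;
  compm : forall x y z, hom y z -> hom x y -> hom x z;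
  compm1 : forall x y (f : hom x y), compm f (idm x) = f;
  comp1m : forall x y (f : hom x y), compm (idm y) f = f;
  compmA : forall x y z t (f : hom z t) (g : hom y z) (h : hom x y),
    compm f (compm g h) = compm (compm f g) h
}.
Arguments idm {c} x.

Definition isomorphic (C : category) (x y : C) : Prop :=
  exists (f : hom x y) (g : hom y x), compm g f = idm x /\ compm f g = idm y.

Record functor (C D : category) := Functor {
  fob :> C -> D;
  fhom : forall x y, hom x y -> hom (fob x) (fob y);
  fhom1 : forall x, fhom (idm x) = idm (fob x);
  fhomM : forall x y z (f : hom y z) (g : hom x y),
    fhom (compm f g) = compm (fhom f) (fhom g)
}.
Arguments fhom {C D} F {x y} f : rename.

Definition functor_id (C : category) : functor C C :=
  @Functor C C id (fun x y f => f) (fun x => erefl) (fun x y z f g => erefl).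

Section FunctorComp.
Variables (C D E : category) (G : functor D E) (F : functor C D).

Lemma functor_comp1 (x : C) : fhom G (fhom F (idm x)) = idm (G (F x)).
Proof. by rewrite !fhom1. Qed.
Lemma functor_compM (x y z : C) (f : hom y z) (g : hom x y) :
  fhom G (fhom F (compm f g)) = compm (fhom G (fhom F f)) (fhom G (fhom F g)).
Proof. by rewrite !fhomM. Qed.

Definition functor_comp : functor C E :=
  @Functor C E (fun x => G (F x)) (fun x y f => fhom G (fhom F f))
    functor_comp1 functor_compM.

End FunctorComp.

Record natiso (C D : category) (F G : functor C D) := NatIso {
  ni_hom : forall x, hom (F x) (G x);
  ni_inv : forall x, hom (G x) (F x);
  ni_homK : forall x, compm (ni_inv x) (ni_hom x) = idm (F x);
  ni_invK : forall x, compm (ni_hom x) (ni_inv x) = idm (G x);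
  ni_nat : forall x y (f : hom x y),
    compm (ni_hom y) (fhom F f) = compm (fhom G f) (ni_hom x)
}.

Record equivalence (C D : category) := Equivalence {
  eqv :> functor C D;
  eqv_inv : functor D C;
  eqv_unit : natiso (functor_id C) (functor_comp eqv_inv eqv);
  eqv_counit : natiso (functor_comp eqv eqv_inv) (functor_id D)
}.

Section Gr.
Variables (K : fieldType) (A : superalgebra K).

Lemma gr_compm1 (M N : grmod A) (f : grhom M N) : gr_comp f (gr_id M) = f.
Proof. exact: gh_eq. Qed.
Lemma gr_comp1m (M N : grmod A) (f : grhom M N) : gr_comp (gr_id N) f = f.
Proof. exact: gh_eq. Qed.
Lemma gr_compmA (M N P Q : grmod A) (f : grhom P Q) (g : grhom N P)
  (h : grhom M N) : gr_comp f (gr_comp g h) = gr_comp (gr_comp f g) h.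
Proof. exact: gh_eq. Qed.

Definition Gr : category := Category gr_compm1 gr_comp1m gr_compmA.

End Gr.

Section Morita.
Variables (K : fieldType) (A : superalgebra K).

Definition finitely_generated (P : grmod A) : Prop :=
  exists s : seq P, forall m, exists c : nat -> A,
    m = \sum_(i < size s) c i *: s`_i.

Definition projective (P : grmod A) : Prop :=
  forall (M N : grmod A) (g : grhom M N) (f : grhom P N),
    (forall y, exists x, g x = y) -> exists h : grhom P M, gr_comp g h = f.

End Morita.

Record graded_morita (K : fieldType) (A B : superalgebra K) := GradedMorita {
  gm_finl : sa_fin_dim A;
  gm_finr : sa_fin_dim B;
  gm_equiv :> equivalence (Gr A) (Gr B);
  gm_gen : grmod A;
  gm_gen_fg : finitely_generated gm_gen;
  gm_gen_proj : projective gm_gen;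
  gm_gen_end : superalg_iso B (EndSigma gm_gen)
}.

Section Irreducible.
Variables (K : fieldType) (A : superalgebra K).

Definition graded_submodule (M : grmod A) (N : set M) : Prop :=
  [/\ N 0,
      forall x y, N x -> N y -> N (x + y),
      forall a x, N x -> N (a *: x) &
      forall x0 x1, gm_gr M false x0 -> gm_gr M true x1 ->
        N (x0 + x1) -> N x0 /\ N x1].

Definition irreducible (M : grmod A) : Prop :=
  (exists x : M, x <> 0) /\
  forall N : set M, graded_submodule N -> N = [set 0] \/ N = setT.

(** Classes of modules are predicates: [grmod A] is too large for [set]. *)
Definition iso_class (M : grmod A) : grmod A -> Prop :=
  fun N => @isomorphic (Gr A) M N.

Definition Irr (C : grmod A -> Prop) : Prop :=
  exists M, irreducible M /\ C = iso_class M.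

Definition irredundant_irr_list (I : seq (grmod A)) : Prop :=
  [/\ List.Forall irreducible I,
      List.ForallOrdPairs (fun N N' => ~ iso_class N N') I &
      forall M, irreducible M -> List.Exists (iso_class M) I].

End Irreducible.
Arguments Irr {K} A C.

Definition has_card (T : Type) (S : T -> Prop) (n : nat) : Prop :=
  exists f : 'I_n -> T,
    (forall i j, f i = f j -> i = j) /\ (forall x, S x <-> exists i, f i = x).

(** The image of [Irr A] under [F] consists of the classes of the members of
    [I]. *)
Definition irr_corresponds (K : fieldType) (A B : superalgebra K)
    (F : functor (Gr A) (Gr B)) (I : seq (grmod B)) : Prop :=
  forall D : grmod B -> Prop,
    (exists M, irreducible M /\ D = iso_class (F M)) <->
    (exists N, List.In N I /\ D = iso_class N).

Record fd_grmod (K : fieldType) (A : superalgebra K) := FdGrMod {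
  fd_mod :> grmod A;
  fd_modP : exists s : seq fd_mod, forall m, exists c : nat -> K,
    m = \sum_(i < size s) sa_scalar A (c i) *: s`_i
}.

Definition short_exact (K : fieldType) (A : superalgebra K)
    (M' M M'' : grmod A) : Prop :=
  exists (f : grhom M' M) (g : grhom M M''),
    [/\ injective f, forall z, exists y, g y = z &
        forall y, g y = 0 <-> exists x, f x = y].

(** The Grothendieck group consists of formal expressions in the classes of
    modules, modulo the smallest congruence that contains the axioms of abelian
    groups and [M] = [M'] + [M''] for each short exact sequence.  The modules
    form a type too large to carry a [zmodType], so that "being isomorphic to
    the Grothendieck group" is stated of a [zmodType] V by means of a surjective
    additive map from expressions to V whose kernel is that congruence. *)
Inductive kterm (T : Type) :=
| KClass of T
| KZero
| KAdd of kterm T & kterm T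
| KOpp of kterm T.
Arguments KZero {T}.

Inductive k_eq (K : fieldType) (A : superalgebra K) :
    kterm (fd_grmod A) -> kterm (fd_grmod A) -> Prop :=
| keq_refl s : k_eq s s
| keq_sym s t : k_eq s t -> k_eq t s
| keq_trans s t u : k_eq s t -> k_eq t u -> k_eq s u
| keq_add s s' t t' : k_eq s s' -> k_eq t t' -> k_eq (KAdd s t) (KAdd s' t')
| keq_opp s s' : k_eq s s' -> k_eq (KOpp s) (KOpp s')
| keq_addA s t u : k_eq (KAdd s (KAdd t u)) (KAdd (KAdd s t) u)
| keq_addC s t : k_eq (KAdd s t) (KAdd t s)
| keq_add0 s : k_eq (KAdd KZero s) s
| keq_addN s : k_eq (KAdd (KOpp s) s) KZero
| keq_exact (M' M M'' : fd_grmod A) : short_exact M' M M'' ->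
    k_eq (KClass M) (KAdd (KClass M') (KClass M'')).

Definition grothendieck_iso (K : fieldType) (A : superalgebra K)
    (V : zmodType) : Prop :=
  exists phi : kterm (fd_grmod A) -> V,
    [/\ forall s t, phi (KAdd s t) = phi s + phi t,
        forall s t, phi s = phi t <-> k_eq s t &
        forall v, exists s, phi s = v].

Definition classified (K : fieldType) (A B : superalgebra K) (I : seq (grmod B))
    (v : nat) (V : zmodType) : Prop :=
  [/\ exists E : graded_morita A B, irr_corresponds E I,
      irredundant_irr_list I,
      has_card (Irr A) v &
      grothendieck_iso A V].
Arguments classified {K} A B I v V.

(* Main.v *)
(** A degree-zero idempotent [f] of a superalgebra [A] such that
    [e f e = 1 - f] for an odd [e] with [e^2 = 1] makes [M |-> f M] an equivalence
    from [Gr A] to [Gr f A f], with inverse [N |-> N + sigma N]; equivalences and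
    corners compose separately, so that no fullness of the composite idempotent
    has to be checked.  For [f = (1 + e e') / 2], where [e^2 = 1] and [e'^2 = -1],
    the corner of R_{p+1,q+1} is R_{p,q}.  Multiplying four generators [g] of
    square 1 by their product gives four generators of square -1, so that
    R_{p+4,q} = R_{p,q+4}; and for [f = (1 + e1 e2 e3 e4) / 2] the corner of
    R_{4,0} consists of the quaternions.  By induction on [p + q] this reduces
    R_{p,q} to the algebra in the list.  Over the complex numbers the signs of the
    squares do not matter.

    Each algebra [B] in the list is a graded division algebra.  Hence every graded
    module has a homogeneous basis and the irreducible ones are [B] and [sigma B],
    which are isomorphic if and only if [B] has an odd unit.  The classes in the
    Grothendieck group are then determined by the numbers of even and odd basis
    elements, respectively by the number of even basis elements of a basis
    without odd ones. *)

Require Import Defs.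
From Stdlib Require Import Setoid Morphisms.
From mathcomp Require Import all_boot all_order all_algebra reals complex.
From HB Require Import structures.
From mathcomp Require Import boolp classical_sets ring zify.

Set Implicit Arguments.
Unset Strict Implicit.
Unset Printing Implicit Defensive.

Import GRing.Theory Defs.
Local Open Scope ring_scope.

(** * Homogeneous components *)

(** Nothing is known beforehand about a presented algebra: neither [1 <> 0] nor a basis or the
    dimension. Clifford algebras are therefore handled through induction on generators and the
    universal property, which also permits a change of generators inside one algebra. Injectivity of
    the map from [B] to [f A f] comes from matrices over [B] or, for the quaternions, from inverses;
    surjectivity from following all four blocks of an element with respect to [f] and [1 - f],
    because the block [f a f] alone is not multiplicative. Finite dimension is visible only at the
    end of a chain of steps and is carried back along it.

    The field enters twice: 2 is inverted in the idempotents, and over the reals a sum of four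
    squares vanishes only trivially, which makes the quaternions and the definite algebras with two
    or three generators divisible.

    Four generators are flipped at a time because 4 is the least positive length for which the
    product of anticommuting generators, all of square 1 or all of square -1, has square 1 and
    anticommutes with each factor. *)

Section Parts.
Variables (V : zmodType) (G : bool -> set V) (GP : Z2grading G).

Lemma part_ex x : exists u : V * V, [/\ G false u.1, G true u.2 & x = u.1 + u.2].
Proof. by case: GP => _ _ /(_ x) [u [h _]]; exists u. Qed.

Definition part (i : bool) (x : V) : V :=
  let u := projT1 (cid (part_ex x)) in if i then u.2 else u.1.

Lemma partP i x : G i (part i x).
Proof. by rewrite /part; case: cid => -[u v] [/= ? ? _]; case: i. Qed.

Lemma part_sum x : part false x + part true x = x.
Proof. by rewrite /part; case: cid => -[u v] [/= _ _ ->]. Qed.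

Lemma part_sumb i x : part i x + part (~~ i) x = x.
Proof. by case: i => /=; [rewrite addrC|]; exact: part_sum. Qed.

Lemma part_uniq x a b : G false a -> G true b -> x = a + b ->
  part false x = a /\ part true x = b.
Proof.
move=> ha hb xE; apply: (Z2gr_uniq GP (partP false x) (partP true x) ha hb).
by rewrite part_sum.
Qed.

Lemma part_homog i j x : G i x -> part j x = if i == j then x else 0.
Proof.
move=> xi; have [] := @part_uniq x (if i then 0 else x) (if i then x else 0).
- by case: i xi => // _; exact: (Z2gr0 GP).
- by case: i xi => // _; exact: (Z2gr0 GP).
- by case: i {xi}; rewrite ?add0r ?addr0.
by case: i {xi}; case: j.
Qed.

Lemma part_id i x : G i x -> part i x = x.
Proof. by move/part_homog->; rewrite eqxx. Qed.

Lemma partD i x y : part i (x + y) = part i x + part i y.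
Proof.
have [] := @part_uniq (x + y) (part false x + part false y)
  (part true x + part true y).
- by apply: (Z2grD GP); exact: partP.
- by apply: (Z2grD GP); exact: partP.
- by rewrite addrACA !part_sum.
by case: i.
Qed.

Lemma partB i x y : part i (x - y) = part i x - part i y.
Proof. by apply/eqP; rewrite eq_sym subr_eq -partD subrK. Qed.

Lemma part0 i : part i 0 = 0.
Proof. by rewrite (part_id (Z2gr0 GP i)). Qed.

Lemma part_bigsum i (I : Type) (r : seq I) (P : pred I) (F : I -> V) :
  part i (\sum_(k <- r | P k) F k) = \sum_(k <- r | P k) part i (F k).
Proof.
by elim/big_rec2: _ => [|k a b _ <-]; [exact: part0 | rewrite partD].
Qed.

Lemma Z2gr_sum i (I : Type) (r : seq I) (P : pred I) (F : I -> V) :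
  (forall k, P k -> G i (F k)) -> G i (\sum_(k <- r | P k) F k).
Proof.
move=> h; elim/big_rec: _ => [|k x Pk hx]; first exact: (Z2gr0 GP).
by apply: (Z2grD GP) => //; exact: h.
Qed.

Lemma gr_disj i x : G i x -> G (~~ i) x -> x = 0.
Proof.
by move=> h h'; rewrite -[LHS](part_id h) (part_homog _ h'); case: i {h h'}.
Qed.

Lemma nonzero_part x : x <> 0 -> exists i, part i x <> 0.
Proof.
move=> x0; apply: contrapT => h; apply: x0; rewrite -(part_sum x).
have -> : part false x = 0 by apply: contrapT => ?; apply: h; exists false.
have -> : part true x = 0 by apply: contrapT => ?; apply: h; exists true.
by rewrite addr0.
Qed.

End Parts.
Arguments part : simpl never.
(** Two decompositions of an element differ by an element of both components, so uniqueness reduces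
    to a trivial intersection. The gradings of submodules, doubles and direct sums are obtained in
    this way from explicit projections. *)
Lemma Z2grading_of_parts (V : zmodType) (G : bool -> set V) (p : bool -> V -> V) :
  (forall i, G i 0) -> (forall i x y, G i x -> G i y -> G i (x - y)) ->
  (forall i x, G i (p i x)) -> (forall x, p false x + p true x = x) ->
  (forall x, G false x -> G true x -> x = 0) -> Z2grading G.
Proof.
move=> G0 GB pG ps dis; split=> // x.
exists (p false x, p true x); split=> [|[a b] [/= ha hb xE]].
  by split=> /=; rewrite ?ps.
have E : p false x - a = b - p true x.
  by apply/eqP; rewrite subr_eq addrAC eq_sym subr_eq addrC -xE ps.
have z : p false x - a = 0.
  by apply: dis; [|rewrite E]; apply: GB.
congr (_, _); first by apply/eqP; rewrite -subr_eq0 z.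
by apply/eqP; rewrite eq_sym -subr_eq0 -E z.
Qed.

Section AlgParts.
Variables (K : fieldType) (A : superalgebra K).

Definition apart i a := part (sa_grP A) i a.
Arguments apart : simpl never.

Lemma apartM i x y :
  apart i (x * y) = apart false x * apart i y + apart true x * apart (~~ i) y.
Proof.
have P j z : sa_gr A j (apart j z) by exact: partP.
have [] := @part_uniq _ _ (sa_grP A) (x * y)
  (apart false x * apart false y + apart true x * apart true y)
  (apart false x * apart true y + apart true x * apart false y).
- by apply: (Z2grD (sa_grP A)); [exact: (sa_grM (P false x) (P false y))
   | exact: (sa_grM (P true x) (P true y))].
- by apply: (Z2grD (sa_grP A)); [exact: (sa_grM (P false x) (P true y))
   | exact: (sa_grM (P true x) (P false y))].
- rewrite -{1}(part_sum (sa_grP A) x) -{1}(part_sum (sa_grP A) y) mulrDl !mulrDr.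
  by rewrite [X in _ + _ + X = _]addrC addrACA.
by case: i.
Qed.

Lemma sa_scalar_gr (k : K) : sa_gr A false (sa_scalar A k).
Proof. by rewrite -[sa_scalar A k]mulr1; apply: sa_grZ; exact: sa_gr1. Qed.

Lemma sa_grMl i j k a b : sa_gr A i a -> sa_gr A j b -> k = i (+) j ->
  sa_gr A k (a * b).
Proof. by move=> ? ? ->; exact: sa_grM. Qed.

End AlgParts.

Section ModParts.
Variables (K : fieldType) (A : superalgebra K).
Implicit Types M N : grmod A.

Definition mpart M i m := part (gm_grP M) i m.
Arguments mpart : simpl never.

Lemma mpartZ M i j a (m : M) : sa_gr A i a ->
  mpart j (a *: m) = a *: mpart (i (+) j) m.
Proof.
move=> ai; rewrite -{1}(part_sumb (gm_grP M) (i (+) j) m) scalerDr /mpart partD.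
rewrite !(part_homog _ _ (gm_grM ai (partP (gm_grP M) _ _))).
by case: i {ai}; case: j => /=; rewrite ?addr0.
Qed.

Lemma gh_part M N (f : grhom M N) i m : f (mpart i m) = mpart i (f m).
Proof.
rewrite -{2}(part_sumb (gm_grP M) i m) ghD /mpart partD.
rewrite !(part_homog _ _ (gh_even f (partP (gm_grP M) _ _))) eqxx.
by case: i; rewrite addr0.
Qed.

Lemma gh_sum M N (f : grhom M N) (I : Type) (r : seq I) (P : pred I)
    (F : I -> M) :
  f (\sum_(k <- r | P k) F k) = \sum_(k <- r | P k) f (F k).
Proof.
by elim/big_rec2: _ => [|k a b _ <-]; [exact: gh0 | rewrite ghD].
Qed.

Lemma gh_inj0 M N (f : grhom M N) : (forall x, f x = 0 -> x = 0) -> injective f.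
Proof.
move=> h x y E; apply/eqP; rewrite -subr_eq0; apply/eqP/h.
by rewrite ghD ghN E subrr.
Qed.

(** Replacing [m] by its component of degree [i] does not change the image. This is what makes the
    inverse of a bijective morphism even. *)
Lemma gh_inj_gr M N (f : grhom M N) : injective f ->
  forall i m, gm_gr N i (f m) -> gm_gr M i m.
Proof.
move=> fi i m h; have -> : m = mpart i m; last exact: partP.
by apply: fi; rewrite gh_part /mpart (part_id (gm_grP N) h).
Qed.

Lemma gh_inv M N (f : grhom M N) (g : N -> M) : cancel f g -> cancel g f ->
  exists h : grhom N M, h =1 g.
Proof.
move=> fK gK.
have gl : linear g by move=> a x y; apply: (can_inj fK); rewrite gh_lin !gK.
have ge i n : gm_gr N i n -> gm_gr M i (g n).
  by move=> ni; apply: (gh_inj_gr (can_inj fK)); rewrite gK.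
by exists (GrHom gl ge).
Qed.

Lemma bij_isomorphic M N (f : grhom M N) : bijective f -> @isomorphic (Gr A) M N.
Proof.
move=> [g fK gK]; have [h hE] := gh_inv fK gK.
by exists f, h; split; apply: gh_eq => x /=; rewrite hE ?fK ?gK.
Qed.

Lemma isomorphic_bij M N : @isomorphic (Gr A) M N ->
  exists f : grhom M N, bijective f.
Proof.
move=> [f [g [gf fg]]]; exists f; exists g => x.
  by move/(congr1 (fun h : grhom M M => h x)): gf.
by move/(congr1 (fun h : grhom N N => h x)): fg.
Qed.

Lemma inj_surj_bij (S T : Type) (f : S -> T) : injective f ->
  (forall y, exists x, f x = y) -> bijective f.
Proof.
move=> fi fs; pose g y := projT1 (cid (fs y)).
have gK y : f (g y) = y by rewrite /g; case: cid.
by exists g => // x; apply: fi; rewrite gK.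
Qed.

(** * Irreducible modules *)

(** The multiples of a homogeneous [x] form a graded submodule; conversely a graded submodule
    contains the components of its elements, so a nonzero one contains a nonzero homogeneous
    vector. *)
Lemma gr_irreducibleP M : irreducible M <-> (exists x : M, x <> 0) /\
  forall i (x : M), gm_gr M i x -> x <> 0 -> forall y, exists a : A, y = a *: x.
Proof.
split=> -[[x0 hx0] h]; split; try by exists x0.
  move=> i x xi nx y.
  have sub : graded_submodule [set y | exists a : A, y = a *: x]%classic.
    split=> /=.
    - by exists 0; rewrite scale0r.
    - by move=> _ _ [a ->] [b ->]; exists (a + b); rewrite scalerDl.
    - by move=> a _ [b ->]; exists (a * b); rewrite scalerA.
    move=> u0 u1 h0 h1 [a aE].
    (* The components of [a *: x] are those of [a] applied to [x], with degrees displaced by the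
       degree of [x]. *)
    have E j : mpart j (a *: x) = apart (i (+) j) a *: x.
      rewrite -{1}(part_sumb (sa_grP A) (i (+) j) a) scalerDl /mpart partD.
      rewrite -!/(apart _ _) -!/(mpart _ _).
      rewrite !(mpartZ _ _ (partP (sa_grP A) _ _)) /mpart.
      rewrite !(part_homog _ _ xi).
      by case: i {xi}; case: j; rewrite /= ?scaler0 ?addr0.
    have [p0 p1] := part_uniq (gm_grP M) h0 h1 (esym aE).
    split; [exists (apart (i (+) false) a)|exists (apart (i (+) true) a)].
      by rewrite -E -p0.
    by rewrite -E -p1.
  have [hN|hN] := h _ sub.
    case: nx; suff: [set 0]%classic x by [].
    by rewrite -hN; exists 1; rewrite scale1r.
  by suff: [set: M]%classic y by rewrite -hN.
move=> N [N0 ND NZ Ngr].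
have [E|E] := pselect (forall x, N x -> x = 0).
  left; apply/seteqP; split=> x /=; first exact: E.
  by move=> ->.
right; apply/seteqP; split=> y //= _.
have [x [Nx nx]] : exists x, N x /\ x <> 0.
  apply: contrapT => H; apply: E => x Nx; apply: contrapT => nx.
  by apply: H; exists x.
have [i ni] := nonzero_part (gm_grP M) nx.
have Np : N (mpart i x).
  have := Ngr _ _ (partP (gm_grP M) false x) (partP (gm_grP M) true x).
  by rewrite part_sum => /(_ Nx) [? ?]; case: i {ni}.
have [a ->] := h i _ (partP (gm_grP M) i x) ni y.
exact: NZ.
Qed.

End ModParts.

(** * Equivalences *)

Section Isomorphic.
Variable C : category.
Implicit Types x y z : C.

Lemma isomorphic_refl x : isomorphic x x.
Proof. by exists (idm x), (idm x); rewrite compm1. Qed.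

Lemma isomorphic_sym x y : isomorphic x y -> isomorphic y x.
Proof. by move=> [f [g [h k]]]; exists g, f. Qed.

Lemma isomorphic_trans x y z : isomorphic x y -> isomorphic y z -> isomorphic x z.
Proof.
move=> [f [g [gf fg]]] [h [k [kh hk]]]; exists (compm h f), (compm g k); split.
  by rewrite compmA -(compmA g) kh compm1.
by rewrite compmA -(compmA h) fg compm1.
Qed.

Lemma functor_isomorphic (D : category) (F : functor C D) x y :
  isomorphic x y -> isomorphic (F x) (F y).
Proof.
move=> [f [g [gf fg]]]; exists (fhom F f), (fhom F g).
by rewrite -!fhomM gf fg !fhom1.
Qed.

Lemma natiso_isomorphic (D : category) (F G : functor C D) (e : natiso F G) x :
  isomorphic (F x) (G x).
Proof. by exists (ni_hom e x), (ni_inv e x); rewrite ni_homK ni_invK. Qed.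

End Isomorphic.

Section EquivalenceComp.
Variables (C D E : category) (F1 : equivalence C D) (F2 : equivalence D E).
Let G1 := eqv_inv F1.
Let G2 := eqv_inv F2.
Let u1 := eqv_unit F1.
Let u2 := eqv_unit F2.
Let c1 := eqv_counit F1.
Let c2 := eqv_counit F2.
Let F := functor_comp F2 F1.
Let G := functor_comp G1 G2.

Let unit_hom (x : C) : hom x (G (F x)) :=
  compm (fhom G1 (ni_hom u2 (F1 x))) (ni_hom u1 x).
Let unit_inv (x : C) : hom (G (F x)) x :=
  compm (ni_inv u1 x) (fhom G1 (ni_inv u2 (F1 x))).

Let unit_homK x : compm (unit_inv x) (unit_hom x) = idm x.
Proof.
rewrite /unit_inv /unit_hom compmA -(compmA (ni_inv u1 x)) -fhomM.
by rewrite (ni_homK u2) fhom1 compm1 (ni_homK u1).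
Qed.

Let unit_invK x : compm (unit_hom x) (unit_inv x) = idm (G (F x)).
Proof.
rewrite /unit_inv /unit_hom compmA.
rewrite -(compmA (fhom G1 (ni_hom u2 (F1 x)))) (ni_invK u1) compm1.
apply: etrans (esym (fhomM G1 (ni_hom u2 (F1 x)) (ni_inv u2 (F1 x)))) _.
by rewrite (ni_invK u2) fhom1.
Qed.

Let unit_nat x y (f : hom x y) :
  compm (unit_hom y) f = compm (fhom G (fhom F f)) (unit_hom x).
Proof.
have e1 := ni_nat u1 f; have e2 := ni_nat u2 (fhom F1 f).
rewrite /= in e1 e2.
by rewrite /unit_hom -compmA e1 compmA -fhomM e2 fhomM -compmA.
Qed.

Let counit_hom (x : E) : hom (F (G x)) x :=
  compm (ni_hom c2 x) (fhom F2 (ni_hom c1 (G2 x))).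
Let counit_inv (x : E) : hom x (F (G x)) :=
  compm (fhom F2 (ni_inv c1 (G2 x))) (ni_inv c2 x).

Let counit_homK x : compm (counit_inv x) (counit_hom x) = idm (F (G x)).
Proof.
rewrite /counit_inv /counit_hom compmA.
rewrite -(compmA (fhom F2 (ni_inv c1 (G2 x)))) (ni_homK c2) compm1.
apply: etrans (esym (fhomM F2 (ni_inv c1 (G2 x)) (ni_hom c1 (G2 x)))) _.
by rewrite (ni_homK c1) fhom1.
Qed.

Let counit_invK x : compm (counit_hom x) (counit_inv x) = idm x.
Proof.
rewrite /counit_inv /counit_hom compmA -(compmA (ni_hom c2 x)) -fhomM.
by rewrite (ni_invK c1) fhom1 compm1 (ni_invK c2).
Qed.

Let counit_nat x y (f : hom x y) :
  compm (counit_hom y) (fhom F (fhom G f)) = compm f (counit_hom x).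
Proof.
have e1 := ni_nat c1 (fhom G2 f); have e2 := ni_nat c2 f.
rewrite /= in e1 e2.
have e3 : compm (fhom F2 (ni_hom c1 (G2 y))) (fhom F (fhom G f)) =
    compm (fhom F2 (fhom G2 f)) (fhom F2 (ni_hom c1 (G2 x))).
  apply: etrans (esym (fhomM F2 (ni_hom c1 (G2 y)) (fhom F1 (fhom G1 (fhom G2 f))))) _.
  by rewrite e1 fhomM.
by rewrite /counit_hom -compmA e3 compmA e2 -compmA.
Qed.

Definition equivalence_comp : equivalence C E :=
  @Equivalence C E F G
    (@NatIso _ _ (functor_id C) (functor_comp G F)
       unit_hom unit_inv unit_homK unit_invK unit_nat)
    (@NatIso _ _ (functor_comp F G) (functor_id E)
       counit_hom counit_inv counit_homK counit_invK counit_nat).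

End EquivalenceComp.

Section EquivalenceId.
Variable C : category.

Let id_nat x y (f : @hom C x y) : compm (idm y) f = compm f (idm x).
Proof. by rewrite compm1 comp1m. Qed.

Definition equivalence_id : equivalence C C :=
  @Equivalence C C (functor_id C) (functor_id C)
    (@NatIso _ _ (functor_id C) (functor_comp (functor_id C) (functor_id C))
       (fun x => idm x) (fun x => idm x)
       (fun x => compm1 _) (fun x => compm1 _) id_nat)
    (@NatIso _ _ (functor_comp (functor_id C) (functor_id C)) (functor_id C)
       (fun x => idm x) (fun x => idm x)
       (fun x => compm1 _) (fun x => compm1 _) id_nat).

End EquivalenceId.

(** * Finite-dimensional modules *)

Section FinDim.
Variables (K : fieldType) (A : superalgebra K).

Definition fin_dim (M : grmod A) : Prop :=
  exists s : seq M, forall m, exists c : nat -> K,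
    m = \sum_(i < size s) sa_scalar A (c i) *: s`_i.

(** Arbitrary finite index types admit families indexed by sums and products, as they occur for
    blocks, doubled modules and direct sums. *)
Lemma fin_dimP (M : grmod A) : fin_dim M <->
  exists (I : finType) (x : I -> M), forall m, exists c : I -> K,
    m = \sum_i sa_scalar A (c i) *: x i.
Proof.
split=> [[s h]|[I [x h]]].
  exists 'I_(size s), (fun i : 'I_(size s) => s`_i) => m; have [c ->] := h m.
  by exists (fun i : 'I_(size s) => c i).
(* A family on [I] is continued to all of [nat] by 0 beyond [#|I|], since [fin_dim] takes its
   coefficients from functions on [nat]. *)
pose ext (T : zmodType) (y : I -> T) (n : nat) : T :=
  if insub n is Some j then y (enum_val (j : 'I_#|I|)) else 0.
have extE T y (j : 'I_#|I|) : @ext T y j = y (enum_val j).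
  by rewrite /ext valK.
exists (mkseq (ext M x) #|I|) => m; have [c ->] := h m; exists (ext K c).
rewrite size_mkseq (reindex (@enum_val I I)) /=; last first.
  by exists enum_rank => i _; rewrite (enum_valK, enum_rankK).
by apply: eq_bigr => j _; rewrite nth_mkseq // !extE.
Qed.

End FinDim.
Arguments fin_dim {K A} M.

(** * Morita relation *)

Section Tame.
Variable K : fieldType.

(** These three properties suffice to transport irreducibles and Grothendieck groups. They are
    verified concretely for each elementary functor and survive composition. *)
Record tame (A B : superalgebra K) (F : functor (Gr A) (Gr B)) : Prop := Tame {
  tame_irr : forall M, irreducible M -> irreducible (F M : grmod B);
  tame_exact : forall M' M M'' : grmod A, short_exact M' M M'' ->
    short_exact (F M') (F M) (F M'');
  tame_fd : forall M : grmod A, fin_dim M -> fin_dim (F M : grmod B)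
}.

Lemma tame_comp (A B C : superalgebra K) (G : functor (Gr B) (Gr C))
  (F : functor (Gr A) (Gr B)) : tame F -> tame G -> tame (functor_comp G F).
Proof.
move=> [i1 e1 f1] [i2 e2 f2]; split=> /=.
- by move=> M /i1/i2.
- by move=> M' M M'' /e1/e2.
- by move=> M /f1/f2.
Qed.

(** [phi] identifies [B] with the corner [f A f], where [f = phi 1]. *)
Record corner (A B : superalgebra K) (phi : B -> A) : Prop := Corner {
  corner_zmod : zmod_morphism phi;
  cornerM : {morph phi : x y / x * y};
  corner_scalar : forall k, phi (sa_scalar B k) = sa_scalar A k * phi 1;
  corner_gr : forall i b, sa_gr B i b -> sa_gr A i (phi b);
  corner_inj : injective phi;
  corner_surj : forall a, exists b, phi b = phi 1 * a * phi 1
}.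

(** The equivalence and the corner are independent components, so each composes by itself. Finite
    dimension passes from [B] to [A] because it is the final algebra of a chain that is known
    explicitly. *)
Definition super_morita (A B : superalgebra K) : Prop :=
  exists (E : equivalence (Gr A) (Gr B)) (phi : B -> A),
    [/\ tame E, tame (eqv_inv E), corner phi & (sa_fin_dim B -> sa_fin_dim A)].

Lemma super_morita_refl A : super_morita A A.
Proof.
exists (equivalence_id (Gr A)), id; split; [by split|by split| |by []].
split=> //; first by move=> k; rewrite mulr1.
by move=> a; exists a; rewrite mul1r mulr1.
Qed.

Lemma super_morita_trans A B C :
  super_morita A B -> super_morita B C -> super_morita A C.
Proof.
move=> [E1 [phi [t1 t1' c1 d1]]] [E2 [psi [t2 t2' c2 d2]]].
exists (equivalence_comp E1 E2), (phi \o psi); split.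
- exact: tame_comp.
- exact: tame_comp.
- have psi1 : phi (psi 1) = phi 1 * phi (psi 1) * phi 1.
    by rewrite -!(cornerM c1) mul1r mulr1.
  split=> /=.
  + by move=> x y /=; rewrite (corner_zmod c2) (corner_zmod c1).
  + by move=> x y /=; rewrite (cornerM c2) (cornerM c1).
  + move=> k; rewrite (corner_scalar c2) (cornerM c1) (corner_scalar c1).
    by rewrite -mulrA -(cornerM c1) mul1r.
  + by move=> i b /(corner_gr c2)/(corner_gr c1).
  + by move=> x y /(corner_inj c1)/(corner_inj c2).
  (* The element is compressed first to the corner of [phi 1] and then, inside [B], to that of
     [psi 1]. *)
  + move=> a; have [b bE] := corner_surj c1 a.
    have [c cE] := corner_surj c2 b; exists c.
    rewrite cE !(cornerM c1) bE !mulrA -!(cornerM c1) mulr1.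
    by rewrite -mulrA -(cornerM c1) mul1r.
- by move=> h; apply/d1/d2.
Qed.

End Tame.

(** * Graded modules carried by a subgroup *)

Section GSub.
Variables (K : fieldType) (B : superalgebra K).

(** One construction serves for [A f], the zero module, [f M] and the doubled module. Associativity
    and unit of the action are demanded on the subset only: [f] acts as the identity on [f M] but
    not on [M]. *)
Record gsub_data := GSubData {
  gs_V : zmodType;
  gs_gr : bool -> set gs_V;
  gs_grP : Z2grading gs_gr;
  gs_set : gs_V -> Prop;
  gs_act : B -> gs_V -> gs_V;
  gs_0 : gs_set 0;
  gs_B : forall x y, gs_set x -> gs_set y -> gs_set (x - y);
  gs_part : forall i x, gs_set x -> gs_set (part gs_grP i x);
  gs_actS : forall b x, gs_set x -> gs_set (gs_act b x);
  gs_actM : forall a b x, gs_set x -> gs_act a (gs_act b x) = gs_act (a * b) x;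
  gs_act1 : forall x, gs_set x -> gs_act 1 x = x;
  gs_actDr : forall b x y, gs_act b (x + y) = gs_act b x + gs_act b y;
  gs_actDl : forall a b x, gs_act (a + b) x = gs_act a x + gs_act b x;
  gs_actgr : forall i j b x, sa_gr B i b -> gs_gr j x ->
    gs_gr (i (+) j) (gs_act b x)
}.

Variable d : gsub_data.

Definition gsub := {x : gs_V d | gs_set x}.
HB.instance Definition _ := gen_eqMixin gsub.
HB.instance Definition _ := gen_choiceMixin gsub.

Definition gval (x : gsub) : gs_V d := proj1_sig x.

Lemma gvalP (x : gsub) : gs_set (gval x). Proof. exact: proj2_sig. Qed.

Lemma gval_inj : injective gval.
Proof.
by move=> [x xS] [y yS] /= E; subst y; rewrite (Prop_irrelevance xS yS).
Qed.

Lemma gs_N (x : gs_V d) : gs_set x -> gs_set (- x).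
Proof. by move=> h; rewrite -sub0r; apply: gs_B h; exact: gs_0. Qed.

Lemma gs_D (x y : gs_V d) : gs_set x -> gs_set y -> gs_set (x + y).
Proof. by move=> h k; rewrite -[y]opprK; apply: gs_B h (gs_N k). Qed.

Definition gsub_zero : gsub := exist _ 0 (gs_0 d).
Definition gsub_opp (x : gsub) : gsub := exist _ _ (gs_N (gvalP x)).
Definition gsub_add (x y : gsub) : gsub := exist _ _ (gs_D (gvalP x) (gvalP y)).
Definition gsub_scale (b : B) (x : gsub) : gsub :=
  exist _ _ (gs_actS b (gvalP x)).

Lemma gsub_addA : associative gsub_add.
Proof. by move=> x y z; apply: gval_inj; rewrite /= addrA. Qed.
Lemma gsub_addC : commutative gsub_add.
Proof. by move=> x y; apply: gval_inj; rewrite /= addrC. Qed.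
Lemma gsub_add0 : left_id gsub_zero gsub_add.
Proof. by move=> x; apply: gval_inj; rewrite /= add0r. Qed.
Lemma gsub_addN : left_inverse gsub_zero gsub_opp gsub_add.
Proof. by move=> x; apply: gval_inj; rewrite /= addNr. Qed.

HB.instance Definition _ :=
  GRing.isZmodule.Build gsub gsub_addA gsub_addC gsub_add0 gsub_addN.

Lemma gvalD x y : gval (x + y) = gval x + gval y. Proof. by []. Qed.
Lemma gval_sum (I : Type) (r : seq I) (P : pred I) (F : I -> gsub) :
  gval (\sum_(k <- r | P k) F k) = \sum_(k <- r | P k) gval (F k).
Proof. by elim/big_rec2: _ => [|k a b _ <-]. Qed.

Lemma gsub_scaleA a b (x : gsub) :
  gsub_scale a (gsub_scale b x) = gsub_scale (a * b) x.
Proof. by apply: gval_inj; rewrite /= gs_actM //; exact: gvalP. Qed.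
Lemma gsub_scale1 : left_id 1 gsub_scale.
Proof. by move=> x; apply: gval_inj; rewrite /= gs_act1 //; exact: gvalP. Qed.
Lemma gsub_scaleDr : right_distributive gsub_scale +%R.
Proof. by move=> b x y; apply: gval_inj; rewrite /= gs_actDr. Qed.
Lemma gsub_scaleDl x : {morph gsub_scale^~ x : a b / a + b}.
Proof. by move=> a b; apply: gval_inj; rewrite /= gs_actDl. Qed.

HB.instance Definition _ := GRing.Zmodule_isLmodule.Build B gsub
  gsub_scaleA gsub_scale1 gsub_scaleDr gsub_scaleDl.

Definition gsub_gr (i : bool) (x : gsub) : Prop := gs_gr i (gval x).

Lemma gsub_grP : Z2grading gsub_gr.
Proof.
apply: (@Z2grading_of_parts _ _
  (fun i x => exist _ _ (gs_part i (gvalP x)) : gsub)).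
- by move=> i; exact: (Z2gr0 (gs_grP d)).
- by move=> i x y; exact: (Z2grB (gs_grP d)).
- by move=> i x; exact: partP.
- by move=> x; apply: gval_inj; exact: part_sum.
- by move=> x h0 h1; apply: gval_inj; exact: (gr_disj (gs_grP d) h0 h1).
Qed.

Lemma gsub_grM i j b (x : gsub) : sa_gr B i b -> gsub_gr j x ->
  gsub_gr (i (+) j) (b *: x).
Proof. exact: gs_actgr. Qed.

Definition gsub_mod : grmod B := GrMod gsub_grP gsub_grM.

Lemma gvalZ b (x : gsub_mod) : gval (b *: x) = gs_act b (gval x).
Proof. by []. Qed.

End GSub.

(** * The progenerator [A f] *)

Section CornerIdeal.
Variables (K : fieldType) (A B : superalgebra K) (phi : B -> A).
Hypothesis phiP : corner phi.
Let f := phi 1.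

Lemma corner0 : phi 0 = 0.
Proof. by have := corner_zmod phiP 0 0; rewrite !subr0 subrr. Qed.

Lemma cornerN x : phi (- x) = - phi x.
Proof. by rewrite -[- x]add0r (corner_zmod phiP) corner0 add0r. Qed.

Lemma cornerD x y : phi (x + y) = phi x + phi y.
Proof. by rewrite -{1}[y]opprK (corner_zmod phiP) cornerN opprK. Qed.

Lemma corner_fl b : f * phi b = phi b.
Proof. by rewrite -(cornerM phiP) mul1r. Qed.

Lemma corner_fr b : phi b * f = phi b.
Proof. by rewrite -(cornerM phiP) mulr1. Qed.

Lemma corner_f0 : sa_gr A false f.
Proof. exact: (corner_gr phiP (sa_gr1 B)). Qed.

Let apart_f i x : x * f = x -> apart i x * f = apart i x.
Proof.
move=> h; rewrite -{2}h apartM /apart !(part_homog _ _ corner_f0).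
by case: i; rewrite /= ?mulr0 ?addr0 ?add0r.
Qed.

Definition corner_ideal_data : gsub_data A.
Proof.
apply: (@GSubData _ _ (sa_ring A) (sa_gr A) (sa_grP A) (fun x => x * f = x)
  (fun a x => a * x)).
- by rewrite mul0r.
- by move=> x y hx hy; rewrite mulrBl hx hy.
- by move=> i x; exact: apart_f.
- by move=> b x h; rewrite -mulrA h.
- by move=> a b x _; rewrite mulrA.
- by move=> x _; rewrite mul1r.
- by move=> b x y; rewrite mulrDr.
- by move=> a b x; rewrite mulrDl.
- by move=> i j b x; exact: sa_grM.
Defined.

Definition corner_ideal : grmod A := gsub_mod corner_ideal_data.
Local Notation P := corner_ideal.

Definition corner_gen : P := exist _ f (corner_fl 1).

Lemma corner_genE (x : P) : x = gval x *: corner_gen.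
Proof. by apply: gval_inj; rewrite gvalZ /= -[LHS](gvalP x). Qed.

Lemma corner_gen_gr : gm_gr P false corner_gen.
Proof. exact: corner_f0. Qed.

Lemma corner_gen_f : f *: corner_gen = corner_gen.
Proof. by apply: gval_inj; rewrite gvalZ /= corner_fl. Qed.

Lemma corner_ideal_fg : finitely_generated P.
Proof.
exists [:: corner_gen] => m; exists (fun _ => gval m).
by rewrite big_ord1 /= -corner_genE.
Qed.

Section FromGen.
Variables (M : grmod A) (m : M).
Hypothesis (m0 : gm_gr M false m).

Let from_gen_lin : linear (fun x : P => gval x *: m).
Proof. by move=> a x y; rewrite gvalD gvalZ /= scalerDl scalerA. Qed.

Let from_gen_even i (x : P) : gm_gr P i x -> gm_gr M i (gval x *: m).
Proof. by move=> xi; rewrite -(addbF i); apply: gm_grM. Qed.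

Definition from_gen : grhom P M := GrHom from_gen_lin from_gen_even.

End FromGen.

(** A map out of [A f] is given by the image of the generator [f]. A preimage of that image under
    [g], made even by passing to its degree-zero component, defines the lift. *)
Lemma corner_ideal_proj : projective P.
Proof.
move=> M N g h gs; have [x xE] := gs (h corner_gen).
have y0 : gm_gr M false (f *: mpart false x).
  exact: (gm_grM corner_f0 (partP (gm_grP M) false x)).
exists (from_gen y0); apply: gh_eq => z /=; rewrite !ghZ gh_part xE.
rewrite /mpart (part_id _ (gh_even h corner_gen_gr)).
by rewrite -ghZ corner_gen_f -ghZ -corner_genE.
Qed.

(** [endS] stores the even and the odd part of a map separately, so the
    homogeneous components of [b] are treated one by one. *)
Section RightMul.
Variable b : B.

Let rmul_lin j : linear
  (fun x : P => (exist _ (gval x * phi (apart j b)) (etrans (esym (mulrA _ _ _))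
    (congr1 _ (corner_fr (apart j b))))) : P).
Proof. by move=> a x y; apply: gval_inj; rewrite /= mulrDl mulrA. Qed.

Let phi_part j : sa_gr A j (phi (apart j b)).
Proof. exact: (corner_gr phiP (partP (sa_grP B) j b)). Qed.

Definition rmul0 : grhom P P :=
  GrHom (rmul_lin false)
    (fun i (x : P) xi => eq_rect _ (fun k => sa_gr A k _)
       (sa_grM xi (phi_part false)) _ (addbF i)).

Definition rmul1 : grhom (shift P) P :=
  @GrHom _ _ (shift P) P _ (rmul_lin true)
    (fun i (x : P) xi => eq_rect _ (fun k => sa_gr A k _)
       (sa_grM xi (phi_part true)) _ (etrans (addbT _) (negbK i))).

Definition rmul : endS P := EndS rmul0 rmul1.

End RightMul.

Lemma rmul_zmod : zmod_morphism (rmul : B -> EndSigma P).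
Proof.
move=> a b; apply: endS_eq => x; apply: gval_inj;
by rewrite /= -mulrBr -(corner_zmod phiP) /apart /= -?partB.
Qed.

(** Right multiplication respects the order of factors because products in [EndSigma] are read from
    left to right. *)
Lemma rmul_monoid : monoid_morphism (rmul : B -> EndSigma P).
Proof.
split=> [|a b]; apply: endS_eq => x; apply: gval_inj; rewrite /=.
- by rewrite /apart (part_id _ (sa_gr1 B)) [LHS](gvalP x).
- by rewrite /apart (part_homog _ _ (sa_gr1 B)) corner0 mulr0.
- by rewrite apartM cornerD !(cornerM phiP) mulrDr !mulrA.
- by rewrite apartM cornerD !(cornerM phiP) mulrDr !mulrA addrC.
Qed.

HB.instance Definition _ :=
  GRing.isZmodMorphism.Build B (EndSigma P) (rmul : B -> EndSigma P) rmul_zmod.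
HB.instance Definition _ :=
  GRing.isMonoidMorphism.Build B (EndSigma P) (rmul : B -> EndSigma P)
    rmul_monoid.

(** An endomorphism of [A f] is right multiplication by the image of [f], which belongs to [f A f]
    and hence to the image of [phi]. *)
Lemma rmul_iso : superalg_iso B (EndSigma P).
Proof.
exists (rmul : {rmorphism B -> EndSigma P}); split.
- apply: inj_surj_bij => [a b E|g].
    have E0 : phi (apart false a) = phi (apart false b).
      have := congr1 (fun h : endS P => gval (end0 h corner_gen)) E.
      by rewrite /= !corner_fl.
    have E1 : phi (apart true a) = phi (apart true b).
      have := congr1 (fun h : endS P => gval (end1 h corner_gen : P)) E.
      by rewrite /= !corner_fl.
    rewrite -(part_sum (sa_grP B) a) -(part_sum (sa_grP B) b).
    by rewrite -!/(apart _ _) (corner_inj phiP E0) (corner_inj phiP E1).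
  pose g0 := gval (end0 g corner_gen); pose g1 := gval (end1 g corner_gen : P).
  have g00 : sa_gr A false g0 := gh_even (end0 g) corner_gen_gr.
  have g11 : sa_gr A true g1 := @end1_even _ _ _ g _ _ corner_gen_gr.
  have fg (x : P) (h : grhom P P) : gval (h x) = gval x * gval (h corner_gen).
    by rewrite {1}(corner_genE x) ghZ gvalZ.
  have fg' (x : P) (h : grhom (shift P) P) :
      gval (h x) = gval x * gval (h corner_gen).
    by rewrite {1}(corner_genE x) ghZ gvalZ.
  (* Both images are fixed by [f] on the right as members of [A f], and on the left because the
     generator is [f] itself and the maps are linear. *)
  have [b bE] := corner_surj phiP (g0 + g1).
  have bE' : phi b = g0 + g1.
    rewrite bE -mulrA mulrDl [g0 * _](gvalP (end0 g corner_gen)).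
    rewrite [g1 * _](gvalP (end1 g corner_gen : P)) mulrDr /g0 /g1.
    by rewrite -[phi 1]/(gval corner_gen) -fg -fg'.
  have [p0 p1] : phi (apart false b) = g0 /\ phi (apart true b) = g1.
    have pb j : sa_gr A j (phi (apart j b)).
      exact: (corner_gr phiP (partP (sa_grP B) j b)).
    apply: (Z2gr_uniq (sa_grP A)) => //.
    by rewrite -cornerD part_sum.
  exists b; apply: endS_eq => x; apply: gval_inj; rewrite /= ?p0 ?p1.
    by rewrite fg.
  by rewrite fg'.
- move=> k; have k0 := sa_scalar_gr B k.
  apply: endS_eq => x; apply: gval_inj; rewrite /= /apart (part_homog _ _ k0) /=.
    by rewrite (corner_scalar phiP) mulrA -sa_scalarC -mulrA [gval x * _](gvalP x).
  by rewrite corner0 mulr0.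
- by move=> [] b bi /=; apply: gh_eq => x; apply: gval_inj;
    rewrite /= /apart (part_homog _ _ bi) corner0 mulr0.
Qed.

End CornerIdeal.

(** The progenerator is [A f] with [f = phi 1]; its endomorphisms are determined by [phi], whichever
    equivalence [E] is recorded. *)
Lemma graded_morita_of (K : fieldType) (A B : superalgebra K)
    (E : equivalence (Gr A) (Gr B)) (phi : B -> A) (phiP : corner phi) :
  sa_fin_dim A -> sa_fin_dim B ->
  exists M : graded_morita A B, gm_equiv M = E.
Proof.
move=> fA fB.
by exists (@GradedMorita _ A B fA fB E _ (@corner_ideal_fg _ _ _ _ phiP)
  (@corner_ideal_proj _ _ _ _ phiP) (rmul_iso phiP)).
Qed.

(** * Transport of the classification of irreducibles *)

Section Transport.
Variables (K : fieldType) (A B : superalgebra K).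
Variables (E : equivalence (Gr A) (Gr B)) (I : seq (grmod B)).
Hypotheses (tE : tame E) (tG : tame (eqv_inv E)) (II : irredundant_irr_list I).
Local Notation G := (eqv_inv E).

Lemma iso_class_eqP (C : superalgebra K) (M N : grmod C) :
  iso_class M = iso_class N <-> @isomorphic (Gr C) M N.
Proof.
split=> [e|h].
  have : iso_class N N by exact: (@isomorphic_refl (Gr C)).
  by rewrite -e.
apply/funext => P; apply/propext; split=> k.
  exact: (isomorphic_trans (isomorphic_sym h) k).
exact: (isomorphic_trans h k).
Qed.

Lemma irr_list_nth : forall i, (i < size I)%N ->
  irreducible (nth (regular B) I i).
Proof.
case: II => h _ _; elim: h => [|M J hM _ IH] [|i] //=; exact: IH.
Qed.

Lemma irr_list_inj i j : (i < size I)%N -> (j < size I)%N ->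
  @isomorphic (Gr B) (nth (regular B) I i) (nth (regular B) I j) -> i = j.
Proof.
case: II => _ h _; elim: h i j => [|M J hM _ IH] [|i] [|j] //= hi hj e.
- elim: hM j hj e => [|N J' hN _ IH'] [|j] //= hj e; by have := IH' j hj e.
- move: e => /isomorphic_sym.
  elim: hM i hi => [|N J' hN _ IH'] [|i] //= hi e; by have := IH' i hi e.
- by congr _.+1; apply: IH.
Qed.

Lemma irr_list_complete M : irreducible M ->
  exists2 i, (i < size I)%N & @isomorphic (Gr B) (nth (regular B) I i) M.
Proof.
case: II => _ _ h /h; elim=> [N J e|N J _ [i hi e]]; last by exists i.+1.
by exists 0%N => //; exact: isomorphic_sym.
Qed.

Let GF M : @isomorphic (Gr A) (G (E M)) M.
Proof. exact: (isomorphic_sym (natiso_isomorphic (eqv_unit E) M)). Qed.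

Let FG N : @isomorphic (Gr B) (E (G N)) N.
Proof. exact: (natiso_isomorphic (eqv_counit E) N). Qed.

Lemma In_nth (T : Type) (x0 x : T) s : List.In x s <->
  exists2 i, (i < size s)%N & nth x0 s i = x.
Proof.
elim: s => [|y s IH] /=; first by split=> // -[].
split=> [[->|/IH [i hi <-]]|[[|i] hi /= E']].
- by exists 0%N.
- by exists i.+1.
- by left.
- by right; apply/IH; exists i.
Qed.

Lemma transport_irr : irr_corresponds E I.
Proof.
move=> D; split=> [[M [iM ->]]|[N [/(In_nth (regular B)) [i hi <-] ->]]].
  have [i hi h] := irr_list_complete (tame_irr tE iM).
  exists (nth (regular B) I i); split; first by apply/In_nth; exists i.
  by apply/esym/iso_class_eqP.
exists (G (nth (regular B) I i)); split.
  exact: (tame_irr tG (irr_list_nth hi)).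
apply/iso_class_eqP; exact: (isomorphic_sym (FG _)).
Qed.

(** The inverse functor turns the list into representatives for [A]; applying [E] to an isomorphism
    between two of them shows that their indices agree. *)
Lemma transport_card : has_card (Irr A) (size I).
Proof.
exists (fun i => iso_class (G (nth (regular B) I i) : grmod A)); split.
  move=> i j /iso_class_eqP h; apply/val_inj/irr_list_inj; rewrite ?ltn_ord //.
  apply: isomorphic_trans (isomorphic_sym (FG _)) _.
  exact: (isomorphic_trans (functor_isomorphic E h) (FG _)).
move=> C; split=> [[M [iM ->]]|[i <-]].
  have [i hi h] := irr_list_complete (tame_irr tE iM).
  exists (Ordinal hi); apply/iso_class_eqP.
  exact: (isomorphic_trans (functor_isomorphic G h) (GF _)).
by eexists; split; last by []; exact: (tame_irr tG (irr_list_nth _)).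
Qed.

End Transport.

(** * Grothendieck groups *)

Section ZeroModule.
Variables (K : fieldType) (A : superalgebra K).

Definition zero_data : gsub_data A.
Proof.
apply: (@GSubData _ _ (sa_ring A) (sa_gr A) (sa_grP A) (fun x => x = 0)
  (fun a x => a * x)).
- by [].
- by move=> x y -> ->; rewrite subr0.
- by move=> i x ->; exact: part0.
- by move=> b x ->; rewrite mulr0.
- by move=> a b x _; rewrite mulrA.
- by move=> x _; rewrite mul1r.
- by move=> b x y; rewrite mulrDr.
- by move=> a b x; rewrite mulrDl.
- by move=> i j b x; exact: sa_grM.
Defined.

Definition zero_mod : grmod A := gsub_mod zero_data.

Lemma zero_modE (x : zero_mod) : x = 0.
Proof. by apply: gval_inj; exact: (gvalP x). Qed.

Lemma zero_mod_fd : fin_dim zero_mod.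
Proof.
by exists [::] => m; exists (fun _ => 0); rewrite big_ord0; exact: zero_modE.
Qed.

Definition zero_fd : fd_grmod A := FdGrMod zero_mod_fd.

(** Relations between classes come only from exact sequences, so an isomorphism has to be presented
    as one with zero left term; see [k_iso]. *)
Lemma zero_exact (M N : grmod A) (f : grhom M N) : bijective f ->
  short_exact zero_mod M N.
Proof.
move=> fb; exists (zeroh zero_mod M), f; split.
- by move=> x y _; rewrite (zero_modE x) (zero_modE y).
- by case: fb => g fK gK y; exists (g y); rewrite gK.
- move=> y; split=> [fy|[x <-]]; last exact: gh0.
  by exists 0; apply: (bij_inj fb); rewrite /= fy gh0.
Qed.

End ZeroModule.

Section KGroup.
Variables (K : fieldType) (A : superalgebra K).
Local Notation term := (kterm (fd_grmod A)).
Local Infix "~~~" := (@k_eq K A) (at level 70).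
Implicit Types s t u v : term.

#[global] Instance k_eq_equiv : RelationClasses.Equivalence (@k_eq K A).
Proof. by split; [exact: keq_refl | exact: keq_sym | exact: keq_trans]. Qed.

#[global] Instance KAdd_proper :
  Proper (@k_eq K A ==> @k_eq K A ==> @k_eq K A) (@KAdd _).
Proof. by move=> s s' h t t' h'; exact: keq_add. Qed.

#[global] Instance KOpp_proper : Proper (@k_eq K A ==> @k_eq K A) (@KOpp _).
Proof. by move=> s s' h; exact: keq_opp. Qed.

Lemma k_cancel s t u : KAdd u s ~~~ KAdd u t -> s ~~~ t.
Proof.
move=> h; rewrite -(keq_add0 s) -(keq_addN u) -keq_addA h keq_addA keq_addN.
exact: keq_add0.
Qed.

Lemma k_ACA s t u v :
  KAdd (KAdd s t) (KAdd u v) ~~~ KAdd (KAdd s u) (KAdd t v).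
Proof.
rewrite -!keq_addA (keq_addA t u v) (keq_addC t u) -(keq_addA u t v).
reflexivity.
Qed.

Lemma k_oppD s t : KOpp (KAdd s t) ~~~ KAdd (KOpp s) (KOpp t).
Proof.
apply: (@k_cancel _ _ (KAdd s t)).
rewrite k_ACA (keq_addC s (KOpp s)) (keq_addC t (KOpp t)).
rewrite (keq_addC _ (KOpp (KAdd s t))) !keq_addN keq_add0; reflexivity.
Qed.

Lemma k_oppK s : KOpp (KOpp s) ~~~ s.
Proof.
apply: (@k_cancel _ _ (KOpp s)); rewrite (keq_addC (KOpp s)) !keq_addN.
reflexivity.
Qed.

(** The exact sequence of zero modules gives [[0] = [0] + [0]]. *)
Lemma k_zero : KClass (zero_fd A) ~~~ KZero.
Proof.
apply: (@k_cancel _ _ (KClass (zero_fd A))).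
rewrite (keq_addC _ KZero) keq_add0; symmetry; apply: keq_exact.
by apply: (@zero_exact _ _ _ _ (gr_id _)); exists id.
Qed.

Lemma k_iso (M N : fd_grmod A) : @isomorphic (Gr A) M N ->
  KClass M ~~~ KClass N.
Proof.
move=> /isomorphic_bij [f fb].
rewrite (keq_exact (M' := zero_fd A) (zero_exact fb)) k_zero keq_add0.
reflexivity.
Qed.

End KGroup.

Fixpoint kmap (S T : Type) (f : S -> T) (s : kterm S) : kterm T :=
  match s with
  | KClass M => KClass (f M)
  | KZero => KZero
  | KAdd s t => KAdd (kmap f s) (kmap f t)
  | KOpp s => KOpp (kmap f s)
  end.

Section KTransport.
Variable K : fieldType.

Definition fd_map (A B : superalgebra K) (F : functor (Gr A) (Gr B))
  (tF : tame F) (M : fd_grmod A) : fd_grmod B := FdGrMod (tame_fd tF (fd_modP M)).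

Lemma kmap_eq (A B : superalgebra K) (F : functor (Gr A) (Gr B)) (tF : tame F)
  (s t : kterm (fd_grmod A)) :
  k_eq s t -> k_eq (kmap (fd_map tF) s) (kmap (fd_map tF) t).
Proof.
elim=> {s t} /=.
- by move=> s; exact: keq_refl.
- by move=> s t _ h; exact: keq_sym h.
- by move=> s t u _ h _ h'; exact: keq_trans h h'.
- by move=> s s' t t' _ h _ h'; exact: keq_add h h'.
- by move=> s s' _ h; exact: keq_opp h.
- by move=> s t u; exact: keq_addA.
- by move=> s t; exact: keq_addC.
- by move=> s; exact: keq_add0.
- by move=> s; exact: keq_addN.
- by move=> M' M M'' h; apply: keq_exact; exact: (tame_exact tF h).
Qed.

Lemma kmapK (A B : superalgebra K) (F : functor (Gr A) (Gr B))
  (G : functor (Gr B) (Gr A)) (tF : tame F) (tG : tame G) :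
  (forall M, @isomorphic (Gr A) (G (F M)) M) ->
  forall s, k_eq (kmap (fd_map tG) (kmap (fd_map tF) s)) s.
Proof.
move=> h; elim=> [M||s IHs t IHt|s IHs] /=.
- apply: k_iso; exact: h.
- exact: keq_refl.
- exact: (keq_add IHs IHt).
- exact: (keq_opp IHs).
Qed.

Lemma transport_grothendieck (A B : superalgebra K) (V : zmodType)
  (E : equivalence (Gr A) (Gr B)) (tE : tame E) (tG : tame (eqv_inv E)) :
  grothendieck_iso B V -> grothendieck_iso A V.
Proof.
move=> [phi [phiD phi_eq phi_surj]].
exists (fun s => phi (kmap (fd_map tE) s)); split.
- by move=> s t; rewrite /= phiD.
- move=> s t; rewrite phi_eq; split=> [h|h]; last exact: kmap_eq.
  have c := kmapK tE tG
    (fun M => isomorphic_sym (natiso_isomorphic (eqv_unit E) M)).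
  rewrite -(c s) -(c t); exact: kmap_eq.
- move=> v; have [s <-] := phi_surj v.
  exists (kmap (fd_map tG) s); apply/phi_eq; apply: kmapK.
  exact: (natiso_isomorphic (eqv_counit E)).
Qed.

Lemma classified_of_morita (A B : superalgebra K) (I : seq (grmod B))
    (V : zmodType) :
  super_morita A B -> sa_fin_dim B -> irredundant_irr_list I ->
  grothendieck_iso B V -> classified A B I (size I) V.
Proof.
move=> [E [phi [tE tG cphi fd]]] fB II gB; split=> //.
- have [M ME] := graded_morita_of E cphi (fd fB) fB.
  by exists M; rewrite ME; exact: transport_irr.
- exact: (transport_card (E := E)).
- exact: (transport_grothendieck tE tG).
Qed.

End KTransport.

(** * Corners [f A f] such that [1 - f] is conjugate to [f] by an odd involution *)

Section MoritaStep.
Variables (K : fieldType) (A B : superalgebra K) (phi : B -> A).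
Hypothesis phiP : corner phi.
Local Notation f := (phi 1).
Variable e : A.
Hypotheses (e1 : sa_gr A true e) (ee : e * e = 1) (efe : e * f * e = 1 - f).

(** The upper left block of [a]. Together [psi a], [psi (a * e)], [psi (e * a)] and
    [psi (e * a * e)] form a two by two matrix over [B]: the Peirce decomposition for [f] and
    [1 - f], where [e] identifies the two parts. *)
Definition psi (a : A) : B := projT1 (cid (corner_surj phiP a)).

Lemma psiE a : phi (psi a) = f * a * f.
Proof. by rewrite /psi; case: cid. Qed.

Lemma psi_phi b : psi (phi b) = b.
Proof. by apply: (corner_inj phiP); rewrite psiE corner_fl // corner_fr. Qed.

Lemma corner1_swap : e * f = (1 - f) * e.
Proof. by rewrite -efe -(mulrA (e * f)) ee mulr1. Qed.

Lemma corner1_idem : f * f = f. Proof. exact: corner_fl. Qed.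

(** Since [e] exchanges the images of [f] and [1 - f], it has no diagonal block. *)
Lemma corner1_odd0 : f * e * f = 0.
Proof. by rewrite -mulrA corner1_swap mulrA mulrBr mulr1 corner1_idem subrr mul0r. Qed.

Lemma psiD a b : psi (a + b) = psi a + psi b.
Proof.
by apply: (corner_inj phiP); rewrite (cornerD phiP) !psiE mulrDr mulrDl.
Qed.

(** Insert [1 = f + e f e] between the two factors. *)
Lemma psiM a b : psi (a * b) = psi a * psi b + psi (a * e) * psi (e * b).
Proof.
apply: (corner_inj phiP); rewrite (cornerD phiP) !(cornerM phiP) !psiE.
have E : 1 = f * f + e * f * (f * e) by rewrite !mulrA -(mulrA e) corner1_idem efe addrC subrK.
rewrite -[X in _ = X + _]mulrA -[a in LHS]mulr1 E.
by rewrite !(mulrDr, mulrDl) !mulrA.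
Qed.

Lemma psi1 : psi 1 = 1. Proof. by apply: (corner_inj phiP); rewrite psiE mulr1 corner1_idem. Qed.

Lemma psi_e : psi e = 0.
Proof. by apply: (corner_inj phiP); rewrite psiE corner1_odd0 (corner0 phiP). Qed.

Lemma psi_ephi b : psi (e * phi b) = 0.
Proof.
apply: (corner_inj phiP); rewrite psiE (corner0 phiP).
by rewrite -(corner_fl phiP b) !mulrA corner1_odd0 !mul0r.
Qed.

Lemma psi_scalar k : psi (sa_scalar A k) = sa_scalar B k.
Proof.
apply: (corner_inj phiP); rewrite psiE (corner_scalar phiP) -sa_scalarC.
by rewrite -mulrA corner1_idem.
Qed.

Lemma corner_gr_inv i b : sa_gr A i (phi b) -> sa_gr B i b.
Proof.
move=> h; have -> : b = apart i b; last exact: partP.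
have [] := Z2gr_uniq (sa_grP A) (a := phi (apart false b))
  (b := phi (apart true b)) (c := if i then 0 else phi b)
  (d := if i then phi b else 0).
- exact: (corner_gr phiP (partP (sa_grP B) false b)).
- exact: (corner_gr phiP (partP (sa_grP B) true b)).
- by case: i h => // _; exact: (Z2gr0 (sa_grP A)).
- by case: i h => // _; exact: (Z2gr0 (sa_grP A)).
- rewrite -(cornerD phiP) part_sum.
  by case: (i); rewrite ?add0r ?addr0.
by case: i {h} => E0 E1; apply/esym/(corner_inj phiP).
Qed.

Lemma psi_gr i a : sa_gr A i a -> sa_gr B i (psi a).
Proof.
move=> ai; apply: corner_gr_inv; rewrite psiE.
have f0 := corner_f0 phiP.
by apply: (sa_grMl (sa_grM f0 ai) f0); rewrite addbF.
Qed.

(** Multiply [a] on both sides by [1 = f + e * f * e]; the outer factors [e] put each block back in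
    its place. *)
Lemma expandE a :
  a = phi (psi a) + phi (psi (a * e)) * e + e * phi (psi (e * a)) +
      e * phi (psi (e * a * e)) * e.
Proof.
rewrite !psiE -{1}(mul1r a) -{1}(mulr1 (1 * a)).
have E : 1 = f + e * f * e by rewrite efe addrC subrK.
rewrite {1 2}E !(mulrDl, mulrDr) !mulrA -!addrA; congr (_ + _).
by rewrite addrCA !addrA.
Qed.

(** By [expandE], the products [u * phi (x i) * v] with [u] and [v] equal to 1 or [e] span [A] when
    the [x i] span [B]. *)
Lemma morita_step_fd : sa_fin_dim B -> sa_fin_dim A.
Proof.
move=> fB; have /fin_dimP [I [x hx]] : fin_dim (regular B) by exact: fB.
suff : fin_dim (regular A) by [].
apply/fin_dimP; exists (I * (bool * bool))%type.
exists (fun p : I * (bool * bool) => ((if p.2.1 then e else 1) * phi (x p.1) *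
  (if p.2.2 then e else 1) : regular A)) => a.
have [c1 E1] := hx (psi a); have [c2 E2] := hx (psi (a * e)).
have [c3 E3] := hx (psi (e * a)); have [c4 E4] := hx (psi (e * a * e)).
exists (fun p : I * (bool * bool) => if p.2.1 then if p.2.2 then c4 p.1 else c3 p.1
  else if p.2.2 then c2 p.1 else c1 p.1).
have E c u v : u * phi (\sum_i sa_scalar B (c i) *: x i) * v =
    \sum_i sa_scalar A (c i) * (u * phi (x i) * v).
  have -> : phi (\sum_i sa_scalar B (c i) *: x i) =
      \sum_i sa_scalar A (c i) * phi (x i).
    elim/big_rec2: _ => [|i a1 a2 _ <-]; first exact: corner0.
    rewrite (cornerD phiP); congr (_ + _).
    rewrite [LHS](cornerM phiP) (corner_scalar phiP) -mulrA.
    by rewrite corner_fl.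
  rewrite mulr_sumr mulr_suml; apply: eq_bigr => i _.
  by rewrite !mulrA -sa_scalarC.
rewrite {1}(expandE a) E1 E2 E3 E4.
rewrite -[phi (\sum_i sa_scalar B (c1 i) *: x i)]mul1r.
rewrite -[1 * phi (\sum_i sa_scalar B (c1 i) *: x i)]mulr1.
rewrite -[phi (\sum_i sa_scalar B (c2 i) *: x i)]mul1r.
rewrite -[e * phi (\sum_i sa_scalar B (c3 i) *: x i)]mulr1 !E.
pose F i (q : bool * bool) := sa_scalar A (if q.1 then if q.2 then c4 i else c3 i
  else if q.2 then c2 i else c1 i) * ((if q.1 then e else 1) * phi (x i) *
  (if q.2 then e else 1)).
rewrite -[RHS]/(\sum_p F p.1 p.2) -pair_bigA /= -!big_split /=.
apply: eq_bigr => i _; rewrite (eq_bigr (fun q => F i (q.1, q.2))); last by case.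
rewrite -(pair_bigA _ (fun u v => F i (u, v))) !big_bool /F /=.
by rewrite mul1r mulr1 [RHS]addrC [X in _ = X + _]addrC -!addrA;
  congr (_ + (_ + _)); rewrite addrC.
Qed.

(** * The functors between modules over [A] and over [B] *)

Section CornerFunctor.
Variable M : grmod A.

Definition cut_data : gsub_data B.
Proof.
apply: (@GSubData _ B M (gm_gr M) (gm_grP M) (fun x => f *: x = x)
  (fun b x => phi b *: x)).
- by rewrite scaler0.
- by move=> x y hx hy; rewrite scalerBr hx hy.
- move=> i x h; rewrite -[part _ i x]/(mpart i x).
  by rewrite -{2}h (mpartZ _ _ (corner_f0 phiP)) addFb.
- by move=> b x h; rewrite scalerA corner_fl.
- by move=> a b x _; rewrite scalerA (cornerM phiP).
- by [].
- by move=> b x y; rewrite scalerDr.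
- by move=> a b x; rewrite (cornerD phiP) scalerDl.
- by move=> i j b x bi xj; apply: gm_grM => //; exact: (corner_gr phiP).
Defined.

Definition cut : grmod B := gsub_mod cut_data.

Lemma fcut (x : M) : f *: (f *: x) = f *: x.
Proof. by rewrite scalerA corner1_idem. Qed.

Definition to_cut (x : M) : cut := exist _ (f *: x) (fcut x).

End CornerFunctor.

Section CutHom.
Variables (M N : grmod A) (h : grhom M N).

Lemma cut_hom_proof (x : cut M) : f *: h (gval x) = h (gval x).
Proof. by rewrite -ghZ; congr (h _); exact: gvalP x. Qed.

Let cut_fun (x : cut M) : cut N := exist _ (h (gval x)) (cut_hom_proof x).

Let cut_lin : linear cut_fun.
Proof. by move=> b x y; apply: gval_inj; rewrite /= ghD ghZ. Qed.

Definition cut_hom : grhom (cut M) (cut N) :=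
  GrHom cut_lin (fun i (x : cut M) xi => gh_even h xi).

End CutHom.

Definition cut_functor : functor (Gr A) (Gr B).
Proof.
apply: (@Functor (Gr A) (Gr B) cut cut_hom).
- by move=> M; apply: gh_eq => x; apply: gval_inj.
- by move=> M N P g h; apply: gh_eq => x; apply: gval_inj.
Defined.

Section Double.
Variable N : grmod B.

Definition dbl_gr (i : bool) (x : N * N) : Prop :=
  gm_gr N i x.1 /\ gm_gr N (~~ i) x.2.

Lemma dbl_grP : Z2grading dbl_gr.
Proof.
apply: (@Z2grading_of_parts _ _ (fun i x => (mpart i x.1, mpart (~~ i) x.2))).
- by move=> i; split; exact: (Z2gr0 (gm_grP N)).
- by move=> i x y [? ?] [? ?]; split; apply: (Z2grB (gm_grP N)).
- by move=> i x; split; exact: partP.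
- move=> [x y]; congr (_, _); rewrite /=; first exact: part_sum.
  by rewrite addrC; exact: part_sum.
- by move=> [x y] [/= h h'] [/= k k'];
  rewrite (gr_disj (gm_grP N) h k) (gr_disj (gm_grP N) h' k').
Qed.

(** The pair [(x, y)] stands for [x + e y], so [a] acts by the matrix of its four blocks. The
    oddness of [e] is also why the second coordinate is shifted in [dbl_gr]. *)
Definition dbl_act (a : A) (x : N * N) : N * N :=
  (psi a *: x.1 + psi (a * e) *: x.2, psi (e * a) *: x.1 + psi (e * a * e) *: x.2).

Definition dbl_data : gsub_data A.
Proof.
apply: (@GSubData _ A (N * N)%type dbl_gr dbl_grP (fun _ => True) dbl_act) => //.
(* Associativity is the product rule [psiM] for blocks, applied to each entry of the matrix
   product. *)
- move=> a b [x y] _; congr (_, _); rewrite /= !scalerDr !scalerA addrACA -!scalerDl.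
    by rewrite -psiM -!(mulrA e) -psiM mulrA.
  by rewrite !(mulrA e) -psiM -!(mulrA e b) -psiM !mulrA.
- move=> [x y] _; congr (_, _) => /=.
    by rewrite psi1 mul1r psi_e scale1r scale0r addr0.
  by rewrite mulr1 ee psi1 psi_e scale1r scale0r add0r.
- move=> b [x y] [x' y']; congr (_, _); by rewrite /= !scalerDr addrACA.
- move=> a b [x y]; congr (_, _);
  by rewrite /= ?mulrDr ?mulrDl ?mulrDr !psiD !scalerDl addrACA.
- move=> i j a [x y] ai [/= xj yj].
  have ea : sa_gr A (~~ i) (e * a) by apply: (sa_grMl e1 ai).
  have ae : sa_gr A (~~ i) (a * e) by apply: (sa_grMl ai e1); rewrite addbT.
  have eae : sa_gr A i (e * a * e) by apply: (sa_grMl ea e1); rewrite addbT negbK.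
  have E : ~~ i (+) ~~ j = i (+) j by case: (i); case: (j).
  split; apply: (Z2grD (gm_grP N)).
  + exact: (gm_grM (psi_gr ai) xj).
  + by rewrite -E; exact: (gm_grM (psi_gr ae) yj).
  + by rewrite /= -addNb; exact: (gm_grM (psi_gr ea) xj).
  + by rewrite -addbN; exact: (gm_grM (psi_gr eae) yj).
Defined.

Definition dbl : grmod A := gsub_mod dbl_data.
Definition mkdbl (x y : N) : dbl := exist _ (x, y) I.
Definition dbl1 (z : dbl) : N := (gval z).1.
Definition dbl2 (z : dbl) : N := (gval z).2.

Lemma dbl_eq (z w : dbl) : dbl1 z = dbl1 w -> dbl2 z = dbl2 w -> z = w.
Proof.
by move=> h k; apply: gval_inj; apply: injective_projections.
Qed.

Lemma dbl1Z a z : dbl1 (a *: z) = psi a *: dbl1 z + psi (a * e) *: dbl2 z.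
Proof. by []. Qed.

Lemma dbl2Z a z : dbl2 (a *: z) = psi (e * a) *: dbl1 z + psi (e * a * e) *: dbl2 z.
Proof. by []. Qed.

Lemma dbl1D z w : dbl1 (z + w) = dbl1 z + dbl1 w. Proof. by []. Qed.
Lemma dbl2D z w : dbl2 (z + w) = dbl2 z + dbl2 w. Proof. by []. Qed.

Lemma dbl_scalar k z :
  sa_scalar A k *: z = mkdbl (sa_scalar B k *: dbl1 z) (sa_scalar B k *: dbl2 z).
Proof.
have k0 : psi (sa_scalar A k * e) = 0.
  apply: (corner_inj phiP); rewrite psiE (corner0 phiP) mulrA -sa_scalarC.
  by rewrite -!mulrA (mulrA f e) corner1_odd0 mulr0.
apply: dbl_eq.
  by rewrite dbl1Z k0 psi_scalar scale0r addr0.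
rewrite dbl2Z -sa_scalarC k0 -mulrA ee mulr1 psi_scalar scale0r add0r //.
Qed.

(** Because [f * e * f = 0], the matrix of [phi b] has [b] in the upper left corner and zeros
    elsewhere. With the swap [dbl_e] this suffices to compute in the doubled module. *)
Lemma dbl_phi b z : phi b *: z = mkdbl (b *: dbl1 z) 0.
Proof.
have k0 : psi (phi b * e) = 0.
  apply: (corner_inj phiP); rewrite psiE (corner0 phiP).
  by rewrite -(corner_fr phiP b) -!mulrA (mulrA f e) corner1_odd0 !mulr0.
have k1 : psi (e * phi b * e) = 0.
  apply: (corner_inj phiP); rewrite psiE (corner0 phiP).
  by rewrite -(corner_fl phiP b) !mulrA corner1_odd0 !mul0r.
apply: dbl_eq; rewrite ?dbl1Z ?dbl2Z.
  by rewrite psi_phi k0 scale0r addr0.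
by rewrite psi_ephi k1 !scale0r addr0.
Qed.

Lemma dbl_e z : e *: z = mkdbl (dbl2 z) (dbl1 z).
Proof.
by apply: dbl_eq; rewrite ?dbl1Z ?dbl2Z ee ?mul1r psi1 psi_e scale1r scale0r
  ?addr0 ?add0r.
Qed.

End Double.

Section DblHom.
Variables (M N : grmod B) (h : grhom M N).

Let dbl_lin : linear (fun z : dbl M => mkdbl (h (dbl1 z)) (h (dbl2 z))).
Proof.
move=> a x y; apply: dbl_eq.
  by rewrite dbl1D dbl1Z /dbl1 /= !(ghD, ghZ).
by rewrite dbl2D dbl2Z /dbl2 /= !(ghD, ghZ).
Qed.

Let dbl_even i (z : dbl M) : gm_gr (dbl M) i z ->
  gm_gr (dbl N) i (mkdbl (h (dbl1 z)) (h (dbl2 z))).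
Proof. by move=> [? ?]; split; apply: gh_even. Qed.

Definition dbl_hom : grhom (dbl M) (dbl N) := GrHom dbl_lin dbl_even.

End DblHom.

Definition dbl_functor : functor (Gr B) (Gr A).
Proof.
apply: (@Functor (Gr B) (Gr A) dbl dbl_hom).
- by move=> M; apply: gh_eq => x; apply: dbl_eq.
- by move=> M N P g h; apply: gh_eq => x; apply: dbl_eq.
Defined.

End MoritaStep.

Lemma gh_inverse_ex (K : fieldType) (A : superalgebra K) (M N : grmod A)
  (h : grhom M N) : bijective h ->
  exists g : grhom N M, gr_comp g h = gr_id M /\ gr_comp h g = gr_id N.
Proof.
move=> [g hK gK]; have [g' gE] := gh_inv hK gK.
by exists g'; split; apply: gh_eq => x /=; rewrite gE ?hK ?gK.
Qed.

Section NatisoOfBij.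
Variables (K : fieldType) (A B : superalgebra K).
Variables (F G : functor (Gr A) (Gr B)).
Variable eta : forall M, grhom (F M : grmod B) (G M : grmod B).
Hypothesis eta_bij : forall M, bijective (eta M).
Hypothesis eta_nat : forall (M N : grmod A) (h : grhom M N) x,
  eta N ((fhom F h : grhom _ _) x) = (fhom G h : grhom _ _) (eta M x).

Definition natiso_of_bij : natiso F G.
Proof.
pose inv M := cid (gh_inverse_ex (eta_bij M)).
apply: (@NatIso _ _ F G eta (fun M => projT1 (inv M))).
- by move=> M; case: (inv M) => g [].
- by move=> M; case: (inv M) => g [].
- by move=> M N h; apply: gh_eq => x; exact: eta_nat.
Defined.

End NatisoOfBij.

Section MoritaStepEquivalence.
Variables (K : fieldType) (A B : superalgebra K) (phi : B -> A).
Hypothesis phiP : corner phi.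
Local Notation f := (phi 1).
Variable e : A.
Hypotheses (e1 : sa_gr A true e) (ee : e * e = 1) (efe : e * f * e = 1 - f).
Let F := cut_functor phiP.
Let G := dbl_functor phiP e1 ee efe.
Local Notation dbl := (dbl phiP e1 ee efe).
Local Notation mkdbl := (@mkdbl _ _ _ _ phiP _ e1 ee efe _).
Local Notation psi := (psi phiP).

(** As in [psiM], the decomposition [1 = f * f + e * f * (f * e)] is inserted, here between [a] and
    [x]. *)
Let psi_act (M : grmod A) a (x : M) : phi (psi a) *: (f *: x) +
  phi (psi (a * e)) *: (f *: (e *: x)) = f *: (a *: x).
Proof.
rewrite !psiE !scalerA -scalerDl; congr (_ *: _).
have E : 1 = f * f + e * f * (f * e).
  by rewrite !mulrA -(mulrA e) (corner1_idem phiP) efe addrC subrK.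
by rewrite -[a in RHS]mulr1 E !(mulrDr, mulrDl) !mulrA.
Qed.

Section Unit.
Variable M : grmod A.

Let unit_fun (x : M) : G (F M) :=
  mkdbl (to_cut phiP x : cut phiP M) (to_cut phiP (e *: x)).

Let unit_lin : linear unit_fun.
Proof.
move=> a x y; apply: dbl_eq; apply: gval_inj.
  by rewrite /= scalerDr -psi_act.
by rewrite /= !scalerDr (scalerA e a) -psi_act.
Qed.

Let unit_even i (x : M) : gm_gr M i x -> gm_gr (G (F M)) i (unit_fun x).
Proof.
move=> xi; split; first exact: (gm_grM (corner_f0 phiP) xi).
exact: (gm_grM (corner_f0 phiP) (gm_grM e1 xi)).
Qed.

Definition step_unit : grhom M (G (F M)) := GrHom unit_lin unit_even.

(** The inverse sends [(y, z)] to [y + e z]; one composite uses [f + e * f * e = 1], the other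
    [f * e * f = 0]. *)
Lemma step_unit_bij : bijective step_unit.
Proof.
exists (fun z : dbl (cut phiP M) => gval (dbl1 z) + e *: gval (dbl2 z)) => x.
  rewrite /= scalerA scalerA -scalerDl efe.
  by rewrite addrC subrK scale1r.
have h1 : f *: gval (dbl1 x) = gval (dbl1 x) := gvalP (dbl1 x).
have h2 : f *: gval (dbl2 x) = gval (dbl2 x) := gvalP (dbl2 x).
have z (m : M) : f *: m = m -> f *: (e *: m) = 0.
  by move=> <-; rewrite !scalerA (corner1_odd0 phiP ee efe) scale0r.
apply: dbl_eq; apply: gval_inj; rewrite /= ?scalerDr.
  by rewrite h1 z // addr0.
by rewrite z // add0r (scalerA e e) ee scale1r h2.
Qed.

End Unit.

Section Counit.
Variable N : grmod B.

Let counit_fun (z : F (G N)) : N := dbl1 (gval z : dbl N).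

Let counit_lin : linear counit_fun.
Proof.
move=> b x y; rewrite /counit_fun.
by rewrite -[gval _]/(phi b *: (gval x : dbl N) + gval y) dbl1D dbl_phi.
Qed.

Let counit_even i (z : F (G N)) : gm_gr (F (G N)) i z -> gm_gr N i (counit_fun z).
Proof. by case. Qed.

Definition step_counit : grhom (F (G N)) N := GrHom counit_lin counit_even.

Let cut_snd (z : F (G N)) : dbl2 (gval z : dbl N) = 0.
Proof.
have : f *: (gval z : dbl N) = gval z := gvalP z.
by rewrite dbl_phi => <-.
Qed.

Let fixed (x : N) : f *: mkdbl x 0 = mkdbl x 0.
Proof. by rewrite dbl_phi scale1r. Qed.

Lemma step_counit_bij : bijective step_counit.
Proof.
exists (fun x => exist (fun z : dbl N => f *: z = z) (mkdbl x 0) (fixed x)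
  : F (G N)) => [z|x] //.
by apply: gval_inj; apply: dbl_eq; rewrite //= cut_snd.
Qed.

End Counit.

Definition step_equivalence : equivalence (Gr A) (Gr B).
Proof.
apply: (@Equivalence _ _ F G).
  apply: (@natiso_of_bij _ _ _ (functor_id _) (functor_comp G F) step_unit).
    exact: step_unit_bij.
  move=> M N h x; apply: dbl_eq; apply: gval_inj => /=; first by rewrite ghZ.
  by rewrite !ghZ.
apply: (@natiso_of_bij _ _ _ (functor_comp F G) (functor_id _) step_counit).
  exact: step_counit_bij.
by [].
Defined.

Lemma tame_cut : tame F.
Proof.
split=> [M /gr_irreducibleP [[x nx] h]|M' M M'' [g [h [gi hs gh]]]|M].
- apply/gr_irreducibleP; split.
    (* The cut of a nonzero module is nonzero: if [f] killed both [x] and [e *: x], then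
       [x = f x + e f e x] would vanish. *)
    have [E|E] := pselect (f *: x = 0); last first.
      by exists (to_cut phiP x) => /(congr1 (fun z : cut phiP M => gval z)).
    exists (to_cut phiP (e *: x)) => /(congr1 (fun z : cut phiP M => gval z)) /= E'.
    apply: nx; rewrite -[x]scale1r -(subrK f 1) -efe scalerDl E addr0.
    by rewrite -!scalerA E' scaler0.
  move=> i z zi nz y.
  have nz' : gval z <> 0 by move=> E; apply: nz; exact: gval_inj.
  have [a aE] := h i (gval z) zi nz' (gval y).
  (* As [f] fixes both [gval z] and [gval y], compressing [a] to [f * a * f] does not disturb the
     equation. *)
  exists (psi a); apply: gval_inj; rewrite gvalZ /= psiE.
  have hz : f *: gval z = gval z := gvalP z.
  have hy : f *: gval y = gval y := gvalP y.
  by rewrite -!scalerA hz -aE hy.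
- exists (cut_hom phiP g), (cut_hom phiP h); split.
  + move=> x y E; apply: gval_inj; apply: gi.
    exact: (congr1 (fun z : cut phiP M => gval z) E).
  + move=> z; have [y yE] := hs (gval z); exists (to_cut phiP y).
    apply: gval_inj; rewrite /= ghZ yE; exact: (gvalP z).
  + move=> y; split=> [/(congr1 (fun z : cut phiP M'' => gval z)) /= E|[x <-]].
      have [x xE] := (gh (gval y)).1 E; exists (to_cut phiP x).
      apply: gval_inj; rewrite /= ghZ xE; exact: (gvalP y).
    by apply: gval_inj; apply/gh; exists (gval x).
- move=> /fin_dimP [I [x hx]]; apply/fin_dimP.
  exists I, (fun i => to_cut phiP (x i)) => y; have [c cE] := hx (gval y).
  exists c; apply: gval_inj; rewrite gval_sum.
  have hy : f *: gval y = gval y := gvalP y.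
  rewrite -hy cE scaler_sumr; apply: eq_bigr => i _.
  rewrite gvalZ /= !scalerA (corner_scalar phiP) -!sa_scalarC.
  by rewrite -mulrA (corner1_idem phiP).
Qed.

Lemma tame_dbl : tame G.
Proof.
split=> [N /gr_irreducibleP [[x nx] h]|N' N N'' [g [k [gi ks gk]]]|N].
- apply/gr_irreducibleP; split.
    by exists (mkdbl x 0) => /(congr1 (fun z : dbl N => dbl1 z)).
  (* A vector with nonzero first coordinate reaches every pair: [phi b] produces the first
     coordinate, [e * phi c] the second. If the first coordinate is zero, [e] exchanges the two
     beforehand. *)
  have h1 i (z : dbl N) y : gm_gr N i (dbl1 z) -> dbl1 z <> 0 ->
      exists a, y = a *: z.
    move=> zi nz; have [b bE] := h i _ zi nz (dbl1 y).
    have [c cE] := h i _ zi nz (dbl2 y).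
    exists (phi b + e * phi c).
    rewrite scalerDl -scalerA !dbl_phi dbl_e.
    by apply: dbl_eq; rewrite ?dbl1D ?dbl2D /= ?addr0 ?add0r.
  move=> i z [z1 z2] nz y.
  have [E|E] := pselect (dbl1 z = 0); last exact: (h1 i).
  have E2 : dbl2 z <> 0 by move=> E2; apply: nz; apply: dbl_eq.
  have [||a aE] := h1 (~~ i) (e *: z) y; rewrite ?dbl_e //.
  by exists (a * e); rewrite aE -scalerA dbl_e.
- exists (dbl_hom phiP e1 ee efe g), (dbl_hom phiP e1 ee efe k); split.
  + move=> x y E; apply: dbl_eq; apply: gi.
      exact: (congr1 (fun z : dbl N => dbl1 z) E).
    exact: (congr1 (fun z : dbl N => dbl2 z) E).
  + move=> z; have [y1 E1] := ks (dbl1 z); have [y2 E2] := ks (dbl2 z).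
    by exists (mkdbl y1 y2); apply: dbl_eq.
  + move=> y; split=> [E|[x <-]].
      have [x1 E1] := (gk (dbl1 y)).1 (congr1 (fun z : dbl N'' => dbl1 z) E).
      have [x2 E2] := (gk (dbl2 y)).1 (congr1 (fun z : dbl N'' => dbl2 z) E).
      by exists (mkdbl x1 x2); apply: dbl_eq.
    by apply: dbl_eq; apply/gk; [exists (dbl1 x)|exists (dbl2 x)].
- move=> /fin_dimP [I [x hx]]; apply/fin_dimP.
  exists (I * bool)%type, (fun p : I * bool =>
    if p.2 then mkdbl (x p.1) 0 else mkdbl 0 (x p.1)) => z.
  have [c cE] := hx (dbl1 z); have [d dE] := hx (dbl2 z).
  exists (fun p : I * bool => if p.2 then c p.1 else d p.1).
  pose T i (b : bool) : dbl N := sa_scalar A (if b then c i else d i) *: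
    (if b then mkdbl (x i) 0 else mkdbl 0 (x i)).
  rewrite -[RHS]/(\sum_p T p.1 p.2) -pair_bigA /=.
  have E i : \sum_b T i b =
      mkdbl (sa_scalar B (c i) *: x i) (sa_scalar B (d i) *: x i).
    rewrite big_bool /T !dbl_scalar /=; apply: dbl_eq;
    by rewrite ?dbl1D ?dbl2D /= ?scaler0 ?addr0 ?add0r.
  rewrite (eq_bigr _ (fun i _ => E i)); apply: dbl_eq.
    by rewrite cE /dbl1 gval_sum; elim/big_rec2: _ => //= i a b _ ->.
  by rewrite dE /dbl2 gval_sum; elim/big_rec2: _ => //= i a b _ ->.
Qed.

Lemma morita_step : super_morita A B.
Proof.
exists step_equivalence, phi; split.
- exact: tame_cut.
- exact: tame_dbl.
- exact: phiP.
- exact: (morita_step_fd phiP efe).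
Qed.

End MoritaStepEquivalence.

(** * Clifford systems *)

Section IsClifford.
Variable K : fieldType.

(** [g] is a family of Clifford generators of [A] with squares [eps], possibly
    different from the one that defines [A]. *)
Record is_clifford (A : superalgebra K) (I : Type) (eps : I -> K) (g : I -> A)
    : Prop := IsClifford {
  icl_odd : forall i, sa_gr A true (g i);
  icl_sq : forall i, g i * g i = sa_scalar A (eps i);
  icl_anti : forall i j, i <> j -> g i * g j = - (g j * g i);
  icl_ind : forall P : A -> Prop, (forall k, P (sa_scalar A k)) ->
    (forall i, P (g i)) -> (forall x y, P x -> P y -> P (x + y)) ->
    (forall x y, P x -> P y -> P (x * y)) -> forall x, P x;
  icl_univ : forall (T : pzRingType) (s : {rmorphism K -> T}) (t : I -> T),
    (forall k x, s k * x = x * s k) -> (forall i, t i * t i = s (eps i)) ->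
    (forall i j, i <> j -> t i * t j = - (t j * t i)) ->
    exists h : {rmorphism A -> T},
      (forall k, h (sa_scalar A k) = s k) /\ forall i, h (g i) = t i
}.

Section CliffEval.
Variables (n p : nat) (T : pzRingType) (s : {rmorphism K -> T}) (t : 'I_n -> T).
Hypotheses (sC : forall k x, s k * x = x * s k)
  (tsq : forall i : 'I_n, t i * t i = s (if (i < p)%N then 1 else -1))
  (tanti : forall i j, i <> j -> t i * t j = - (t j * t i)).

Fixpoint cliff_eval (x : cterm K n) : T :=
  match x with
  | CGen i => t i
  | CConst k => s k
  | CAdd x y => cliff_eval x + cliff_eval y
  | CMul x y => cliff_eval x * cliff_eval y
  end.

Lemma cliff_eval_eq x y : cliff_eq p x y -> cliff_eval x = cliff_eval y.
Proof.
elim=> {x y} /=; try by [].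
- by move=> x y z _ -> _ ->.
- by move=> x x' y y' _ -> _ ->.
- by move=> x x' y y' _ -> _ ->.
- by move=> x y z; rewrite addrA.
- by move=> x y; rewrite addrC.
- by move=> x; rewrite rmorph0 add0r.
- by move=> x; rewrite rmorphN rmorph1 mulN1r addNr rmorph0.
- by move=> x y z; rewrite mulrA.
- by move=> x; rewrite rmorph1 mul1r.
- by move=> x; rewrite rmorph1 mulr1.
- by move=> x y z; rewrite mulrDl.
- by move=> x y z; rewrite mulrDr.
- by move=> k l; rewrite rmorphD.
- by move=> k l; rewrite rmorphM.
- by move=> i j /eqP ij; rewrite (tanti ij) addNr rmorph0.
Qed.

Definition cliff_hom (x : clifford_n K n p) : T := cliff_eval (generic_quotient.repr x).

Lemma cliff_hom_pi x : cliff_hom (cliff_pi p x) = cliff_eval x.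
Proof. by apply: cliff_eval_eq; exact: cliff_repr. Qed.

Lemma cliff_hom_zmod : zmod_morphism cliff_hom.
Proof.
move=> x y; have D a b : cliff_hom (a + b) = cliff_hom a + cliff_hom b.
  elim/cliff_ind: a => a; elim/cliff_ind: b => b.
  by rewrite -[_ + _]/(cliff_add _ _) cliff_piD !cliff_hom_pi.
by apply/eqP; rewrite eq_sym subr_eq -D subrK.
Qed.

Lemma cliff_hom_monoid : monoid_morphism cliff_hom.
Proof.
split; first by rewrite [cliff_hom 1]cliff_hom_pi /= rmorph1.
elim/cliff_ind=> a; elim/cliff_ind=> b.
by rewrite -[_ * _]/(cliff_mul _ _) cliff_piM !cliff_hom_pi.
Qed.

HB.instance Definition _ :=
  GRing.isZmodMorphism.Build (clifford_n K n p) T cliff_hom cliff_hom_zmod.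
HB.instance Definition _ :=
  GRing.isMonoidMorphism.Build (clifford_n K n p) T cliff_hom cliff_hom_monoid.

Definition cliff_rmorphism : {rmorphism clifford_n K n p -> T} := cliff_hom.

End CliffEval.

(** Structural induction on terms gives the induction principle, and evaluation of terms, compatible
    with [cliff_eq], gives the universal property. *)
Lemma clifford_is_clifford n p : @is_clifford (clifford_n K n p) 'I_n
  (fun i => if (i < p)%N then 1 else -1) (@cliff_gen K n p).
Proof.
split.
- by move=> i; exact: cgr_gen.
- by move=> i; exact: cliff_square.
- by move=> i j /eqP ij; apply/eqP; rewrite -addr_eq0; apply/eqP/cliff_anticomm.
- move=> P Pk Pg PD PM; elim/cliff_ind; elim=> [i|k|x Px y Py|x Px y Py].
  + exact: Pg.
  + exact: Pk.
  + by rewrite cliff_piDr; exact: PD.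
  + by rewrite cliff_piMr; exact: PM.
- move=> T s t sC tsq tanti; exists (cliff_rmorphism sC tsq tanti); split.
    by move=> k; exact: cliff_hom_pi.
  by move=> i; exact: cliff_hom_pi.
Qed.

Lemma ground_is_clifford (I : Type) (eps : I -> K) (g : I -> ground K) :
  (I -> False) -> is_clifford eps g.
Proof.
move=> I0; split=> //; try by move=> i; case: (I0 i).
by move=> T s t _ _ _; exists s; split=> // i; case: (I0 i).
Qed.

Section Change.
Variables (A : superalgebra K) (I : Type) (eps : I -> K) (g : I -> A).
Hypothesis H : is_clifford eps g.

Lemma is_clifford_ext (eps' : I -> K) : eps =1 eps' -> is_clifford eps' g.
Proof. by move/funext <-. Qed.

Lemma is_clifford_reindex (J : Type) (u : J -> I) (v : I -> J) :
  cancel u v -> cancel v u -> is_clifford (eps \o u) (g \o u).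
Proof.
move=> uK vK; split=> /=.
- by move=> j; exact: (icl_odd H).
- by move=> j; exact: (icl_sq H).
- by move=> i j ij; apply: (icl_anti H) => /(can_inj uK).
- move=> P Pk Pg; apply: (icl_ind H) => // i.
  by rewrite -(vK i); exact: Pg.
- move=> T s t sC tsq tanti.
  have [h [hk hg]] := icl_univ H (s := s) (t := t \o v) sC
    (fun i => etrans (tsq (v i)) (congr1 (fun i => s (eps i)) (vK i)))
    (fun i j ij => tanti (v i) (v j) (fun E => ij (can_inj vK E))).
  by exists h; split=> // j; rewrite hg /= uK.
Qed.

(** The universal property is inherited by scaling the targets with the inverse factors. Over the
    complex numbers a factor of square -1 changes the sign of a square. *)
Lemma is_clifford_scale (c : I -> K) : (forall i, c i != 0) ->
  is_clifford (fun i => c i * c i * eps i) (fun i => sa_scalar A (c i) * g i).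
Proof.
move=> c0; have swap (T : pzRingType) (s : {rmorphism K -> T}) k l (x y : T) :
    (forall k x, s k * x = x * s k) ->
    s k * x * (s l * y) = s (k * l) * (x * y).
  move=> sC; rewrite rmorphM -!mulrA; congr (_ * _).
  by rewrite !mulrA -sC.
have sA := @sa_scalarC K A.
split.
- by move=> i; apply: sa_grZ; exact: (icl_odd H).
- by move=> i; rewrite swap // (icl_sq H) -rmorphM.
- by move=> i j ij; rewrite !swap // (icl_anti H ij) mulrN (mulrC (c i)).
- move=> P Pk Pg PD PM; apply: (icl_ind H) => // i.
  rewrite -[g i]mul1r -(rmorph1 (sa_scalar A)) -(mulVf (c0 i)) rmorphM -mulrA.
  exact: PM.
- move=> T s t sC tsq tanti.
  have [] := icl_univ H (s := s) (t := fun i => s (c i)^-1 * t i) sC.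
  + move=> i; rewrite swap // tsq -rmorphM; congr (s _).
    by field; rewrite c0.
  + by move=> i j ij; rewrite !swap // (tanti _ _ ij) mulrN (mulrC (c i)^-1).
  + move=> h [hk hg]; exists h; split=> // i.
    by rewrite rmorphM hk hg mulrA -rmorphM divff // rmorph1 mul1r.
Qed.

End Change.

End IsClifford.

(** * Interchanging four positive and four negative generators *)

Section Quad.
Variables (T : pzRingType) (q : bool * bool -> T) (k : T).
Hypotheses (kC : forall x, k * x = x * k) (kk : k * k = 1)
  (qq : forall i, q i * q i = k)
  (qa : forall i j, i <> j -> q i * q j = - (q j * q i)).

(** The volume element of four generators. Their common square [k] is only assumed central with
    [k * k = 1], so that both signs are treated at once. *)
Definition quadw : T :=
  q (false, false) * q (false, true) * q (true, false) * q (true, true).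

Local Notation a := (q (false, false)).
Local Notation b := (q (false, true)).
Local Notation c := (q (true, false)).
Local Notation d := (q (true, true)).

Let qax i j (z : T) : i <> j -> q i * (q j * z) = - (q j * (q i * z)).
Proof. by move=> ij; rewrite !mulrA qa // mulNr. Qed.

Let qqx i (z : T) : q i * (q i * z) = k * z.
Proof. by rewrite mulrA qq. Qed.

Let qkx i (z : T) : q i * (k * z) = k * (q i * z).
Proof. by rewrite !mulrA kC. Qed.

Let kkx (z : T) : k * (k * z) = z.
Proof. by rewrite mulrA kk mul1r. Qed.

Let ba : b * a = - (a * b). Proof. exact: qa. Qed.
Let ca : c * a = - (a * c). Proof. exact: qa. Qed.
Let da : d * a = - (a * d). Proof. exact: qa. Qed.
Let cb : c * b = - (b * c). Proof. exact: qa. Qed.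
Let db : d * b = - (b * d). Proof. exact: qa. Qed.
Let dc : d * c = - (c * d). Proof. exact: qa. Qed.
Let bax z : b * (a * z) = - (a * (b * z)). Proof. exact: qax. Qed.
Let cax z : c * (a * z) = - (a * (c * z)). Proof. exact: qax. Qed.
Let dax z : d * (a * z) = - (a * (d * z)). Proof. exact: qax. Qed.
Let cbx z : c * (b * z) = - (b * (c * z)). Proof. exact: qax. Qed.
Let dbx z : d * (b * z) = - (b * (d * z)). Proof. exact: qax. Qed.
Let dcx z : d * (c * z) = - (c * (d * z)). Proof. exact: qax. Qed.
Let qk i : q i * k = k * q i. Proof. by rewrite kC. Qed.

(** Rewriting rules that sort words in [a], [b], [c], [d] alphabetically, collect the signs and
    collapse squares; the variants ending in [x] act at the head of a longer word. *)
Let norm := (@mulrN T, @mulNr T, @opprK T, ba, ca, da, cb, db, dc, bax, cax, dax, cbx, dbx,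
  dcx, qq, qqx, qk, qkx, kk, kkx, @mulr1 T).

(** A generator commutes with itself and anticommutes with the other three factors, an odd
    number. *)
Lemma quadw_anti i : q i * quadw = - (quadw * q i).
Proof.
by rewrite /quadw -!mulrA; case: i => [[] []]; rewrite !norm.
Qed.

(** Reversing four anticommuting letters takes six transpositions, an even number, and the four
    squares contribute the fourth power of [k], which is 1. *)
Lemma quadw_sq : quadw * quadw = 1.
Proof. by rewrite /quadw -!mulrA !norm. Qed.

Lemma quadw_comm z : (forall i, z * q i = - (q i * z)) -> z * quadw = quadw * z.
Proof.
move=> h; have hx i y : z * (q i * y) = - (q i * (z * y)).
  by rewrite !mulrA h mulNr.
by rewrite /quadw -!mulrA !(hx, h, mulrN, opprK).
Qed.

Let q' i := q i * quadw.

(** Moving the volume element past [q j] costs one sign, after which its square disappears. So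
    squares change sign while anticommutation persists. *)
Let qM i j : q' i * q' j = - (q i * q j).
Proof.
rewrite /q' -mulrA (mulrA quadw) -[quadw * q j]opprK -quadw_anti.
by rewrite mulNr mulrN -(mulrA (q j)) quadw_sq mulr1.
Qed.

Lemma quad_flip_sq i : q' i * q' i = - k.
Proof. by rewrite qM qq. Qed.

Lemma quad_flip_anti i j : i <> j -> q' i * q' j = - (q' j * q' i).
Proof. by move=> ij; rewrite !qM (qa ij). Qed.

(** So passing from [q] to [q'] is an involution, see [quad_flipK]. *)
Lemma quad_flipw :
  q' (false, false) * q' (false, true) * q' (true, false) * q' (true, true) = quadw.
Proof. by rewrite qM -mulrA qM mulrNN /quadw !mulrA. Qed.

Lemma quad_flipK i : q' i * quadw = q i.
Proof. by rewrite -mulrA quadw_sq mulr1. Qed.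

Lemma quad_flip_other z i : (forall i, z * q i = - (q i * z)) ->
  z * q' i = - (q' i * z).
Proof.
by move=> h; rewrite /q' mulrA h mulNr -(mulrA (q i)) (quadw_comm h) mulrA.
Qed.

End Quad.

Section Flip.
Variables (K : fieldType) (A : superalgebra K) (J : Type) (k : K) (eps : J -> K).
Variable g : bool * bool + J -> A.
Hypothesis kk : k * k = 1.
Hypothesis H : is_clifford
  (fun x : bool * bool + J => if x is inr j then eps j else k) g.

Let q := g \o inl.
Let w := quadw q.

Definition flip_gen (x : bool * bool + J) : A :=
  if x is inl i then q i * w else g x.

Let qqA i : q i * q i = sa_scalar A k. Proof. exact: (icl_sq H (inl i)). Qed.
Let qaA i j : i <> j -> q i * q j = - (q j * q i).
Proof. by move=> ij; apply: (icl_anti H) => -[]. Qed.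
Let kkA : sa_scalar A k * sa_scalar A k = 1.
Proof. by rewrite -rmorphM kk rmorph1. Qed.

Let w0 : sa_gr A false w.
Proof.
have o i : sa_gr A true (q i) by exact: (icl_odd H).
exact: (sa_grM (sa_grM (sa_grM (o _) (o _)) (o _)) (o _)).
Qed.

(** The flip is an involution: the old generators are recovered from the new ones, and the universal
    property is obtained by flipping the prescribed targets as well. *)
Lemma is_clifford_flip : is_clifford
  (fun x : bool * bool + J => if x is inr j then eps j else - k) flip_gen.
Proof.
have kC x : sa_scalar A k * x = x * sa_scalar A k by exact: sa_scalarC.
split.
- move=> [i|j] /=; last exact: (icl_odd H).
  exact: (sa_grM (icl_odd H (inl i)) w0).
- move=> [i|j] /=; last exact: (icl_sq H (inr j)).
  by rewrite (quad_flip_sq kC kkA qqA qaA) rmorphN.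
- have anti j i : g (inr j) * q i = - (q i * g (inr j)) by exact: (icl_anti H).
  move=> [i|i] [j|j] ij /=.
  + by apply: (quad_flip_anti kC kkA qqA qaA) => E; apply: ij; rewrite E.
  + by rewrite (quad_flip_other _ (anti j)) opprK.
  + exact: quad_flip_other.
  + exact: (icl_anti H).
(* The volume element is also the product of the four new generators, hence reachable from them. *)
- move=> P Pk Pg PD PM; have Pw : P w.
    rewrite /w -(quad_flipw kC kkA qqA qaA).
    by apply: (PM); [apply: (PM); [apply: (PM)|]|]; exact: (Pg (inl _)).
  apply: (icl_ind H) => // -[i|j]; last exact: (Pg (inr j)).
  rewrite -[g _](quad_flipK kkA qqA qaA i); apply: (PM) => //.
  exact: (Pg (inl i)).
- move=> T s t sC tsq tanti; pose r := t \o inl.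
  have rk x : s (- k) * x = x * s (- k) by exact: sC.
  have rkk : s (- k) * s (- k) = 1 by rewrite -rmorphM mulrNN kk rmorph1.
  have rr i : r i * r i = s (- k) by exact: (tsq (inl i)).
  have ra i j : i <> j -> r i * r j = - (r j * r i).
    by move=> ij; apply: tanti => -[].
  have anti j i : t (inr j) * r i = - (r i * t (inr j)) by exact: tanti.
  (* The old generators must go to the flipped targets; flipping once more then returns [t]. *)
  pose t' x := if x is inl i then r i * quadw r else t x.
  have [] := icl_univ H (s := s) (t := t') sC.
  + move=> [i|j] /=; last exact: (tsq (inr j)).
    by rewrite (quad_flip_sq rk rkk rr ra) rmorphN opprK.
  + move=> [i|i] [j|j] ij /=.
    * by apply: (quad_flip_anti rk rkk rr ra) => E; apply: ij; rewrite E.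
    * by rewrite (quad_flip_other _ (anti j)) opprK.
    * exact: quad_flip_other.
    * exact: tanti.
  + move=> h [hk hg]; exists h; split=> // -[i|j] /=; last by rewrite hg.
    rewrite rmorphM /w /quadw !rmorphM /q /= !hg /=.
    by rewrite (quad_flipw rk rkk rr ra) (quad_flipK rkk rr ra).
Qed.

End Flip.

(** * Two by two matrices *)

Section M2.
Variable T : pzRingType.

Definition m2 (a b c d : T) : 'M[T]_2 :=
  \matrix_(i, j) if i == 0 then if j == 0 then a else b
                 else if j == 0 then c else d.

Lemma m2M a b c d a' b' c' d' : m2 a b c d * m2 a' b' c' d' =
  m2 (a * a' + b * c') (a * b' + b * d') (c * a' + d * c') (c * b' + d * d').
Proof.
apply/matrixP => i j; rewrite -[_ * _]/(_ *m _) !mxE !big_ord_recl big_ord0 !mxE /= addr0.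
by case: i => [[|[|]]] //; case: j => [[|[|]]].
Qed.

Lemma m2B a b c d a' b' c' d' :
  m2 a b c d - m2 a' b' c' d' = m2 (a - a') (b - b') (c - c') (d - d').
Proof.
by apply/matrixP => i j; rewrite !mxE; case: (i == 0); case: (j == 0).
Qed.

Lemma m2N a b c d : - m2 a b c d = m2 (- a) (- b) (- c) (- d).
Proof.
by apply/matrixP => i j; rewrite !mxE; case: (i == 0); case: (j == 0).
Qed.

Lemma m2D a b c d a' b' c' d' :
  m2 a b c d + m2 a' b' c' d' = m2 (a + a') (b + b') (c + c') (d + d').
Proof.
by apply/matrixP => i j; rewrite !mxE; case: (i == 0); case: (j == 0).
Qed.

Lemma m2_1 : m2 1 0 0 1 = 1.
Proof.
rewrite -[RHS]/(1%:M); apply/matrixP => i j; rewrite !mxE.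
by case: i => [[|[|]]] //; case: j => [[|[|]]].
Qed.

Lemma m2_inj a b c d a' b' c' d' : m2 a b c d = m2 a' b' c' d' ->
  [/\ a = a', b = b', c = c' & d = d'].
Proof.
move=> E; have e i j := congr1 (fun M : 'M[T]_2 => M i j) E.
split; [have := e 0 0|have := e 0 1|have := e 1 0|have := e 1 1]; by rewrite !mxE.
Qed.

Lemma m2_ex (M : 'M[T]_2) : exists a b c d, M = m2 a b c d.
Proof.
exists (M 0 0), (M 0 1), (M 1 0), (M 1 1); apply/matrixP => i j; rewrite !mxE.
by case: i => [[|[|]]] // hi; case: j => [[|[|]]] // hj; congr (M _ _); exact: val_inj.
Qed.

Variables (K : fieldType) (s : {rmorphism K -> T}).

Definition m2s k := m2 (s k) 0 0 (s k).

Lemma m2s_zmod : zmod_morphism m2s.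
Proof. by move=> k l; rewrite /m2s m2B rmorphB subr0. Qed.

Lemma m2s_monoid : monoid_morphism m2s.
Proof.
split; first by rewrite /m2s rmorph1 m2_1.
by move=> k l; rewrite /m2s m2M rmorphM !mulr0 !mul0r !addr0 add0r.
Qed.

HB.instance Definition _ := GRing.isZmodMorphism.Build K 'M[T]_2 m2s m2s_zmod.
HB.instance Definition _ := GRing.isMonoidMorphism.Build K 'M[T]_2 m2s m2s_monoid.

Hypothesis sC : forall k x, s k * x = x * s k.

Lemma m2sC k x : m2s k * x = x * m2s k.
Proof.
have [a [b [c [d ->]]]] := m2_ex x.
by rewrite /m2s !m2M !mulr0 !mul0r !addr0 !add0r !sC.
Qed.

End M2.

(** The opposite signs on the diagonal make the images of the old generators
    anticommute with the two new ones. *)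
Definition double_gen (T : pzRingType) (I : Type) (t : I -> T)
    (x : option (option I)) : 'M[T]_2 :=
  match x with
  | None => m2 0 1 1 0
  | Some None => m2 0 (-1) 1 0
  | Some (Some i) => m2 (t i) 0 0 (- t i)
  end.

Lemma double_gen_sq (K : fieldType) (T : pzRingType) (s : {rmorphism K -> T})
    (I : Type) (eps : option (option I) -> K) (t : I -> T) :
  eps None = 1 -> eps (Some None) = -1 ->
  (forall i, t i * t i = s (eps (Some (Some i)))) ->
  forall x, double_gen t x * double_gen t x = m2s s (eps x).
Proof.
move=> e1 e2 h [[i|]|]; rewrite /= m2M /m2s.
- by rewrite -h mulrNN !mulr0 !mul0r !addr0 add0r.
- by rewrite e2 rmorphN rmorph1 !mulr0 !mul0r !addr0 !add0r mulr1 mul1r.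
- by rewrite e1 rmorph1 !mulr0 !mul0r !addr0 !add0r mulr1.
Qed.

Lemma double_gen_anti (T : pzRingType) (I : Type) (t : I -> T) :
  (forall i j, i <> j -> t i * t j = - (t j * t i)) ->
  forall x y, x <> y ->
  double_gen t x * double_gen t y = - (double_gen t y * double_gen t x).
Proof.
move=> h [[i|]|] [[j|]|] xy //=; rewrite !m2M m2N ?mulr0 ?mul0r ?addr0 ?add0r
  ?mulr1 ?mul1r ?mulrN1 ?mulN1r ?mulrN ?mulNr ?mulr1 ?mul1r ?opprK ?mulr0 ?mul0r ?oppr0 //.
by rewrite h ?opprK // => E; apply: xy; rewrite E.
Qed.

(** * The idempotent [(1 + v) / 2] of an even involution [v] *)

Section HalfIdempotent.
Variables (K : fieldType) (A : superalgebra K).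
Hypothesis two_neq0 : (2 : K) != 0.
Variables v e : A.
Hypotheses (v0 : sa_gr A false v) (vv : v * v = 1).
Hypotheses (e1 : sa_gr A true e) (ee : e * e = 1) (ev : e * v = - (v * e)).

Local Notation half := (sa_scalar A 2^-1).
Definition hidem : A := half * (1 + v).
Local Notation f := hidem.

Let half2 : half + half = 1.
Proof.
by rewrite -rmorphD -(rmorph1 (sa_scalar A)); congr (sa_scalar A _); field.
Qed.

Let halfC x : x * half = half * x. Proof. by rewrite sa_scalarC. Qed.

Lemma hidem_vl : v * f = f.
Proof. by rewrite /hidem mulrA halfC -mulrA mulrDr mulr1 vv addrC. Qed.

Lemma hidem_idem : f * f = f.
Proof.
by rewrite {1}/hidem -mulrA mulrDl mul1r hidem_vl mulrDr -mulrDl half2 mul1r.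
Qed.

Lemma hidem_gr : sa_gr A false f.
Proof. by apply: sa_grZ; apply: (Z2grD (sa_grP A)) v0; exact: sa_gr1. Qed.

Lemma hidem_comm x : x * v = v * x -> x * f = f * x.
Proof. by move=> h; rewrite /hidem mulrA halfC -!mulrA mulrDr mulrDl h mulr1 mul1r. Qed.

Lemma hidem_anti x : x * v = - (v * x) -> x * f = (1 - f) * x.
Proof.
move=> h; have -> : 1 - f = half * (1 - v).
  by rewrite /hidem -{1}half2 mulrDr mulrBr mulr1 opprD addrA addrK.
by rewrite /hidem mulrA halfC -!mulrA mulrDr mulrBl h mulr1 mul1r.
Qed.

Lemma hidem_anti0 x : x * v = - (v * x) -> f * x * f = 0.
Proof.
by move=> h; rewrite -mulrA hidem_anti // mulrA mulrBr mulr1 hidem_idem subrr mul0r.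
Qed.

Lemma hidem_conj : e * f * e = 1 - f.
Proof. by rewrite hidem_anti // -mulrA ee mulr1. Qed.

Section Step.
Variables (J : Type) (eps : J -> K) (g : J -> A) (B : superalgebra K).
Variable h : {rmorphism B -> A}.
Hypotheses (HA : is_clifford eps g)
  (hk : forall k, h (sa_scalar B k) = sa_scalar A k)
  (h_gr : forall i b, sa_gr B i b -> sa_gr A i (h b))
  (hv : forall b, h b * v = v * h b)
  (h_inj : forall b, h b * f = 0 -> b = 0).
Let phi (b : B) : A := h b * f.
Hypothesis phi_gen : forall j, exists b1 b2 b3 b4,
  [/\ phi b1 = f * g j * f, phi b2 = f * (g j * e) * f,
      phi b3 = f * (e * g j) * f & phi b4 = f * (e * g j * e) * f].

Let phi1 : phi 1 = f. Proof. by rewrite /phi rmorph1 mul1r. Qed.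

Let phiM : {morph phi : x y / x * y}.
Proof.
move=> x y; rewrite /phi rmorphM -[RHS]mulrA (mulrA f) -(hidem_comm (hv y)).
by rewrite -(mulrA (h y)) hidem_idem mulrA.
Qed.

Let phiD x y : phi (x + y) = phi x + phi y.
Proof. by rewrite /phi rmorphD mulrDl. Qed.

(** A block of a product involves other blocks of the factors, so the induction on generators must
    carry all four. Surjectivity onto [f A f] is the first component. *)
Let phi_all a : exists b1 b2 b3 b4,
  [/\ phi b1 = f * a * f, phi b2 = f * (a * e) * f,
      phi b3 = f * (e * a) * f & phi b4 = f * (e * a * e) * f].
Proof.
have fef : f * e * f = 0 by exact: hidem_anti0.
elim/(icl_ind HA): a => [k|j|x y [x1 [x2 [x3 [x4 [X1 X2 X3 X4]]]]]
    [y1 [y2 [y3 [y4 [Y1 Y2 Y3 Y4]]]]]|x y [x1 [x2 [x3 [x4 [X1 X2 X3 X4]]]]]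
    [y1 [y2 [y3 [y4 [Y1 Y2 Y3 Y4]]]]]].
- have fkf : phi (sa_scalar B k) = f * sa_scalar A k * f.
    by rewrite -sa_scalarC -mulrA hidem_idem /phi hk.
  have z : phi 0 = 0 by rewrite /phi rmorph0 mul0r.
  have ke : f * (sa_scalar A k * e) * f = 0.
    by rewrite mulrA -sa_scalarC -(mulrA _ f e) -(mulrA _ (f * e) f) fef mulr0.
  exists (sa_scalar B k), 0, 0, (sa_scalar B k); split=> //.
  + by rewrite z ke.
  + by rewrite -sa_scalarC z ke.
  + by rewrite fkf -(sa_scalarC k e) -(mulrA _ e e) ee mulr1.
- exact: phi_gen.
- exists (x1 + y1), (x2 + y2), (x3 + y3), (x4 + y4); split; rewrite phiD.
  + by rewrite X1 Y1 mulrDr mulrDl.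
  + by rewrite X2 Y2 mulrDl mulrDr mulrDl.
  + by rewrite X3 Y3 !mulrDr mulrDl.
  + by rewrite X4 Y4 mulrDr mulrDl mulrDr mulrDl.
have E (a b : A) : f * (a * b) * f =
    f * a * f * (f * b * f) + f * (a * e) * f * (f * (e * b) * f).
  have E1 : 1 = f * f + e * f * (f * e).
    by rewrite -(mulrA e f) (mulrA f f) hidem_idem mulrA hidem_conj addrC subrK.
  by rewrite -[a in LHS]mulr1 E1 !(mulrDr, mulrDl) !mulrA.
exists (x1 * y1 + x2 * y3), (x1 * y2 + x2 * y4), (x3 * y1 + x4 * y3),
  (x3 * y2 + x4 * y4).
split; rewrite phiD !phiM ?X1 ?X2 ?X3 ?X4 ?Y1 ?Y2 ?Y3 ?Y4.
- by rewrite -E.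
- by rewrite -(mulrA e y) -E !mulrA.
- by rewrite -E !mulrA.
- by rewrite -(mulrA e y) -E !mulrA.
Qed.

(** A criterion in terms of generators: it remains to give an even map [h] commuting with [v],
    injective after multiplication by [f], and the blocks of each generator of [A]. *)
Lemma hidem_step : super_morita A B.
Proof.
have phiP : corner phi.
  split.
  - by move=> x y; rewrite /phi rmorphB mulrBl.
  - exact: phiM.
  - by move=> k; rewrite phi1 /phi hk.
  - by move=> i b bi; apply: (sa_grMl (h_gr bi) hidem_gr); rewrite addbF.
  - move=> x y E; apply/eqP; rewrite -subr_eq0; apply/eqP/h_inj.
    by rewrite rmorphB mulrBl -/(phi x) E subrr.
  - by move=> a; rewrite phi1; have [b [_ [_ [_ [E _ _ _]]]]] := phi_all a; exists b.
by apply: (morita_step phiP e1 ee); rewrite phi1 hidem_conj.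
Qed.

End Step.

End HalfIdempotent.

(** A sum or product has no homogeneous factors to rely on, so the induction follows both components
    of an arbitrary element. *)
Lemma clifford_hom_even (K : fieldType) (A B : superalgebra K) (I : Type)
    (eps : I -> K) (b : I -> B) (h : {rmorphism B -> A}) :
  is_clifford eps b -> (forall k, h (sa_scalar B k) = sa_scalar A k) ->
  (forall i, sa_gr A true (h (b i))) ->
  forall i x, sa_gr B i x -> sa_gr A i (h x).
Proof.
move=> H hk hb i x xi.
suff S y : sa_gr A false (h (apart false y)) /\ sa_gr A true (h (apart true y)).
  rewrite -(part_id (sa_grP B) xi) -/(apart _ _).
  by case: (S x) => ? ?; case: (i).
elim/(icl_ind H): y => [k|j|y z [y0 y1] [z0 z1]|y z [y0 y1] [z0 z1]].
- rewrite /apart !(part_homog _ _ (sa_scalar_gr B k)) /= rmorph0 hk.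
  by split; [exact: sa_scalar_gr | exact: (Z2gr0 (sa_grP A))].
- rewrite /apart !(part_homog _ _ (icl_odd H j)) /= rmorph0.
  by split=> //; exact: (Z2gr0 (sa_grP A)).
- by rewrite /apart !partD !rmorphD; split; apply: (Z2grD (sa_grP A)).
- rewrite !apartM !rmorphD !rmorphM; split; apply: (Z2grD (sa_grP A)).
  + exact: (sa_grM y0 z0).
  + exact: (sa_grM y1 z1).
  + exact: (sa_grM y0 z1).
  + exact: (sa_grM y1 z0).
Qed.

(** * Removing a generator of square 1 and one of square -1 *)

Section HyperbolicStep.
Variables (K : fieldType) (A B : superalgebra K) (I : Type).
Hypothesis two_neq0 : (2 : K) != 0.
Variables (eps : option (option I) -> K) (g : option (option I) -> A).
Variables (b : I -> B).
Hypotheses (HA : is_clifford eps g)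
  (HB : is_clifford (fun i => eps (Some (Some i))) b)
  (epsP : eps None = 1) (epsN : eps (Some None) = -1).

Let e := g None.
Let e' := g (Some None).
Let v := e * e'.
Let ee : e * e = 1. Proof. by rewrite (icl_sq HA) epsP rmorph1. Qed.
Let ee' : e' * e' = -1. Proof. by rewrite (icl_sq HA) epsN rmorphN rmorph1. Qed.
Let e'e : e' * e = - v. Proof. exact: (icl_anti HA). Qed.
Let v0 : sa_gr A false v. Proof. exact: (sa_grM (icl_odd HA _) (icl_odd HA _)). Qed.
Let vv : v * v = 1.
Proof.
by rewrite /v -mulrA (mulrA e') e'e mulNr mulrN /v -(mulrA e) ee' mulrN1 mulrN ee opprK.
Qed.
Let ev : e * v = - (v * e).
Proof. by rewrite /v -(mulrA e e') e'e mulrN /v opprK. Qed.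
Let gv i : g (Some (Some i)) * v = v * g (Some (Some i)).
Proof.
have a1 : g (Some (Some i)) * e = - (e * g (Some (Some i))) by exact: (icl_anti HA).
have a2 : g (Some (Some i)) * e' = - (e' * g (Some (Some i))) by exact: (icl_anti HA).
by rewrite /v mulrA a1 mulNr -(mulrA e) a2 mulrN opprK mulrA.
Qed.
Local Notation f := (hidem v).

Lemma hyperbolic_step : super_morita A B.
Proof.
have [h [hk hb]] := icl_univ HB (s := sa_scalar A) (t := fun i => g (Some (Some i)))
  (@sa_scalarC _ A) (fun i => icl_sq HA (Some (Some i)))
  (fun i j ij => icl_anti HA (fun E : Some (Some i) = Some (Some j) =>
     ij (f_equal (fun x => if x is Some (Some y) then y else i) E))).
have hv x : h x * v = v * h x.
  elim/(icl_ind HB): x => [k|i|x y Hx Hy|x y Hx Hy].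
  - by rewrite hk sa_scalarC.
  - by rewrite hb gv.
  - by rewrite rmorphD mulrDl mulrDr Hx Hy.
  - by rewrite rmorphM -mulrA Hy mulrA Hx mulrA.
have fef : f * e * f = 0 by exact: hidem_anti0.
have vf : v * f = f by exact: hidem_vl.
have ff : f * f = f by exact: hidem_idem.
apply: (hidem_step two_neq0 v0 vv (icl_odd HA None) ee ev (h := h) HA) => //.
- by apply: (clifford_hom_even HB hk) => i; rewrite hb; exact: (icl_odd HA).
(* Injectivity: the matrices of [double_gen] over [B] satisfy the relations of [A], so [A] maps to
   them. There [h x] has first row [(x, 0)] and [f] is the first diagonal matrix unit, so
   [h x * f = 0] forces [x = 0]. *)
- move=> x hx.
  have [r [rk rg]] := icl_univ HA (s := m2s (sa_scalar B)) (t := double_gen b)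
    (m2sC (@sa_scalarC _ B)) (double_gen_sq epsP epsN (icl_sq HB))
    (double_gen_anti (icl_anti HB)).
  have rh y : exists c d, r (h y) = m2 y 0 c d.
    elim/(icl_ind HB): y => [k|i|y z [c [d Hy]] [c' [d' Hz]]
        |y z [c [d Hy]] [c' [d' Hz]]].
    + by rewrite hk rk; exists 0, (sa_scalar B k).
    + by rewrite hb rg; exists 0, (- b i).
    + by rewrite rmorphD rmorphD Hy Hz m2D addr0; eexists; eexists.
    + by rewrite rmorphM rmorphM Hy Hz m2M !mulr0 !mul0r !addr0; eexists; eexists.
  have rf : r f = m2 1 0 0 0.
    have rv : r v = m2 1 0 0 (-1).
      by rewrite /v rmorphM !rg /= m2M !mulr0 !mul0r !mul1r !addr0 !add0r.
    rewrite /hidem rmorphM rmorphD rmorph1 rk rv -m2_1 m2D subrr !addr0.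
    rewrite /m2s m2M !mulr0 !mul0r !addr0 mulrDr mulr1 -rmorphD.
    have -> : (2^-1 + 2^-1 : K) = 1 by field.
    by rewrite rmorph1.
  have [c [d E]] := rh x; have := congr1 r hx.
  rewrite rmorphM E rf m2M rmorph0 -(subrr (m2 0 0 0 0)) m2B => /m2_inj [].
  by rewrite mulr1 mul0r addr0 subr0.
- move=> [[i|]|].
  (* An old generator commutes with [v] and anticommutes with [e]: its matrix is diagonal, and
     conjugation by [e] gives the minus sign. *)
  + exists (b i), 0, 0, (- b i); rewrite rmorphN rmorph0 hb mul0r.
    have gf : g (Some (Some i)) * f = f * g (Some (Some i)) by exact: hidem_comm.
    have ge : g (Some (Some i)) * e = - (e * g (Some (Some i))).
      exact: (icl_anti HA).
    have z : f * (e * g (Some (Some i))) * f = 0.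
      by rewrite -(mulrA f) -(mulrA e) gf (mulrA e f) (mulrA f (e * f)) (mulrA f e)
        fef mul0r.
    split; rewrite -/e.
    * by rewrite -gf -mulrA ff.
    * by rewrite ge mulrN mulNr z oppr0.
    * by rewrite z.
    * rewrite -(mulrA e) ge mulrN (mulrA e e) ee mul1r mulrN !mulNr -gf.
      by rewrite -(mulrA _ f) ff.
  (* Since [v * f = f], the products [e' * e = - v] and [e * e' = v] act on the corner as -1 and
     1. *)
  + exists 0, (-1), 1, 0; rewrite rmorph0 rmorphN rmorph1 !mul0r mulNr mul1r.
    have e'v : e' * v = - (v * e').
      by rewrite /v mulrA e'e mulNr /v -mulrA.
    have z : f * e' * f = 0 by exact: hidem_anti0.
    split; rewrite -/e -/e'.
    * by rewrite z.
    * by rewrite e'e mulrN mulNr -mulrA vf ff.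
    * by rewrite -/v -mulrA vf ff.
    * rewrite -(mulrA e e') e'e mulrN ev opprK.
      by rewrite (mulrA f) -(hidem_comm (erefl (v * v))) vf fef.
  + exists 0, 1, 1, 0; rewrite rmorph0 rmorph1 !mul0r mul1r.
    by rewrite -/e ee mul1r mulr1 fef ff.
Qed.

End HyperbolicStep.

(** * Reduction of the signature *)

Section HasSign.
Variable K : fieldType.

Definition sign_of (p i : nat) : K := if (i < p)%N then 1 else -1.

Lemma sign_of_sq p i : sign_of p i * sign_of p i = 1.
Proof. by rewrite /sign_of; case: ifP; rewrite ?mulr1 // mulrNN mulr1. Qed.

(** A concrete witness that the relations do not collapse. Each new generator doubles the matrix
    size: the old ones go to the diagonal with opposite signs, the new one is off-diagonal. *)
Lemma clifford_model (n p : nat) : exists (T : pzRingType) (s : {rmorphism K -> T})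
    (t : nat -> T), [/\ (1 : T) <> 0, forall k x, s k * x = x * s k,
    forall i, (i < n)%N -> t i * t i = s (sign_of p i) &
    forall i j, (i < n)%N -> (j < n)%N -> i <> j -> t i * t j = - (t j * t i)].
Proof.
elim: n => [|n [T [s [t [T1 sC tsq tanti]]]]].
  exists K, idfun, (fun _ => 0); split=> //; first by apply/eqP; exact: oner_neq0.
  by move=> k x; rewrite /= mulrC.
pose u i := if (i < n)%N then m2 (t i) 0 0 (- t i)
            else m2 0 (s (sign_of p n)) 1 0.
exists 'M[T]_2, (m2s s), u; split.
- rewrite -m2_1 -(subrr (m2 0 0 0 0)) m2B => /m2_inj [E _ _ _]; apply: T1.
  by rewrite E subrr.
- exact: m2sC.
- move=> i; rewrite ltnS leq_eqVlt => /orP [/eqP ->|h]; rewrite /u /m2s ?ltnn ?h m2M.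
    by rewrite !mulr0 !mul0r !addr0 !add0r mulr1 mul1r.
  by rewrite mulrNN tsq // !mulr0 !mul0r !addr0 add0r.
move=> i j; rewrite !ltnS (leq_eqVlt i n) (leq_eqVlt j n) => /orP [/eqP ->|hi] /orP [/eqP ->|hj] ij //;
  rewrite /u ?ltnn ?hi ?hj !m2M m2N.
- by rewrite !mulr0 !mul0r !addr0 !add0r mulrN mul1r !mulr1 oppr0 sC opprK.
- by rewrite !mulr0 !mul0r !addr0 !add0r mulrN mul1r !mulr1 oppr0 sC opprK.
- by rewrite !mulr0 !mul0r !addr0 !add0r !mulrNN tanti // oppr0.
Qed.

(** The generators need not be the defining ones, so one algebra may have several signatures; a
    change of signature then requires no isomorphism of algebras. *)
Definition has_sign (A : superalgebra K) (n p : nat) : Prop :=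
  exists g : 'I_n -> A, is_clifford (fun i : 'I_n => sign_of p i) g.

Lemma has_sign_clifford p q : has_sign (clifford K p q) (p + q) p.
Proof. by exists (@cliff_gen K _ _); exact: clifford_is_clifford. Qed.

Lemma has_sign_ground p : has_sign (ground K) 0 p.
Proof. by exists (fun _ => 0); apply: ground_is_clifford => -[]. Qed.

Lemma has_sign_nontrivial A n p : has_sign A n p -> (1 : A) <> 0.
Proof.
move=> [g H]; have [T [s [t [T1 sC tsq tanti]]]] := clifford_model n p.
have [h _] := icl_univ H (t := t \o val) sC (fun i => tsq _ (ltn_ord i))
  (fun i j ij => tanti _ _ (ltn_ord i) (ltn_ord j) (fun E => ij (val_inj E))).
by move=> /(congr1 h); rewrite rmorph1 rmorph0.
Qed.

Lemma has_sign_reindex (A : superalgebra K) (J : finType) n (eps : J -> K) (g : J -> A)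
    (u : J -> 'I_n) (p : nat) : injective u -> #|J| = n ->
  eps =1 (fun x => sign_of p (u x)) -> is_clifford eps g -> has_sign A n p.
Proof.
move=> ui cJ epsE H.
have [|v uK vK] := inj_card_bij ui; first by rewrite cJ card_ord.
exists (g \o v); apply: (is_clifford_ext (is_clifford_reindex H vK uK)) => i.
by rewrite /= epsE vK.
Qed.

Lemma has_sign_pullback (A : superalgebra K) (J : finType) n (p : nat) (u : J -> 'I_n) :
  injective u -> #|J| = n -> has_sign A n p ->
  exists g : J -> A, is_clifford (fun x => sign_of p (u x)) g.
Proof.
move=> ui cJ [g H]; have [|v uK vK] := inj_card_bij ui; first by rewrite cJ card_ord.
by exists (g \o u); exact: (is_clifford_reindex H uK vK).
Qed.

(** The four flipped generators occupy the places from [p] to [p + 3], at the border between the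
    signs; later ones move up by 4. Thus positive squares come first both before and after a
    flip. *)
Lemma quad_index_lt m p (x : bool * bool + 'I_m) : (p <= m)%N ->
  (match x with inl (b, b') => p + (2 * b + b')
              | inr i => if i < p then nat_of_ord i else i + 4 end < m + 4)%N.
Proof. case: x => [[[] []]|i]; [lia..|case: ifP; have := ltn_ord i; lia]. Qed.

Definition quad_index m p (pm : (p <= m)%N) (x : bool * bool + 'I_m) : 'I_(m + 4) :=
  Ordinal (quad_index_lt x pm).

Lemma quad_index_inj m p (pm : (p <= m)%N) : injective (quad_index pm).
Proof.
move=> [[b1 b2]|i] [[b3 b4]|j] /(congr1 val) /=.
- by case: b1; case: b2; case: b3; case: b4 => //; lia.
- by case: b1; case: b2; case: ifP; lia.
- by case: b3; case: b4; case: ifP; lia.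
- by move=> E; congr inr; apply: val_inj; move: E; do 2 case: ifP => /=; lia.
Qed.

Lemma has_sign_flip A m p : (p <= m)%N ->
  has_sign A (m + 4) (p + 4) <-> has_sign A (m + 4) p.
Proof.
move=> pm; have cJ : #|{: bool * bool + 'I_m}| = (m + 4)%N.
  by rewrite card_sum card_prod card_bool card_ord addnC.
have E1 x : sign_of (p + 4) (quad_index pm x) =
    if x is inr j then sign_of p j else 1.
  rewrite /sign_of; case: x => [[b1 b2]|i] /=.
    by case: b1; case: b2; rewrite ifT //; lia.
  by case: (ltnP i p) => h /=; [rewrite ifT | rewrite ifF] => //; lia.
have E2 x : sign_of p (quad_index pm x) = if x is inr j then sign_of p j else -1.
  rewrite /sign_of; case: x => [[b1 b2]|i] /=.
    by case: b1; case: b2; rewrite ifF //; lia.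
  by case: (ltnP i p) => h /=; [rewrite h | rewrite ifF //; lia].
split=> /(has_sign_pullback (@quad_index_inj _ _ pm) cJ) [g H].
  apply: (has_sign_reindex (@quad_index_inj _ _ pm) cJ _
    (is_clifford_flip (mulr1 1) (is_clifford_ext H E1))).
  by move=> x; rewrite E2.
apply: (has_sign_reindex (@quad_index_inj _ _ pm) cJ _
  (is_clifford_flip _ (is_clifford_ext H E2))); last by rewrite mulrNN mulr1.
by move=> x; rewrite E1 opprK.
Qed.

(** The removed pair consists of the first generator, of square 1, and the last one, of square -1;
    the others move up by one. *)
Lemma hyp_index_lt n (x : option (option 'I_n)) :
  (match x with None => 0 | Some None => n.+1 | Some (Some i) => i.+1 end < n.+2)%N.
Proof. by case: x => [[i|]|] //; have := ltn_ord i; lia. Qed.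

Definition hyp_index n (x : option (option 'I_n)) : 'I_n.+2 :=
  Ordinal (hyp_index_lt x).

Lemma hyp_index_inj n : injective (@hyp_index n).
Proof.
move=> [[i|]|] [[j|]|] /(congr1 val) //= [E].
- by congr (Some (Some _)); exact: val_inj.
- by have := ltn_ord i; lia.
- by have := ltn_ord j; lia.
Qed.

Lemma has_sign_step (A B : superalgebra K) n p : (2 : K) != 0 -> (p <= n)%N ->
  has_sign A n.+2 p.+1 -> has_sign B n p -> super_morita A B.
Proof.
move=> two pn HA [b HB].
have [|g HA'] := has_sign_pullback (@hyp_index_inj n) _ HA.
  by rewrite !card_option card_ord.
apply: (hyperbolic_step two HA' (b := b)).
- exact: HB.
- by [].
- by rewrite /sign_of /= ltnS ltnNge pn.
Qed.

End HasSign.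

(** * Quaternions *)

Section QuatHom.
Variables (K : fieldType) (T : pzRingType) (s : {rmorphism K -> T}) (I J : T).
Hypotheses (sC : forall k x, s k * x = x * s k).
Hypotheses (II : I * I = -1) (JJ : J * J = -1) (JI : J * I = - (I * J)).
Let L := I * J.

Let LJ : L * J = - I. Proof. by rewrite /L -mulrA JJ mulrN1. Qed.
Let LI : L * I = J. Proof. by rewrite /L -mulrA JI mulrN mulrA II mulN1r opprK. Qed.

Definition quat_hom (x : quaternions K) : T :=
  s (qr x) + s (qi x) * I + s (qj x) * J + s (qk x) * L.
Local Notation h := quat_hom.

Lemma quat_hom_zmod : zmod_morphism h.
Proof.
move=> x y; rewrite /quat_hom /= !rmorphB !mulrBl !opprD.
rewrite [RHS]addrACA; congr (_ + _); rewrite [RHS]addrACA; congr (_ + _).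
by rewrite [RHS]addrACA.
Qed.

Let hD x y : h (x + y) = h x + h y.
Proof.
rewrite /quat_hom /= !rmorphD !mulrDl.
rewrite [RHS]addrACA; congr (_ + _); rewrite [RHS]addrACA; congr (_ + _).
by rewrite [RHS]addrACA.
Qed.

Let qsc (k : K) : quaternions K := quat_scalar k.
Let iq : quaternions K := Quat 0 1 0 0.
Let jq : quaternions K := Quat 0 0 1 0.

Let hZ k (x : quaternions K) : h (x * qsc k) = h x * s k.
Proof.
have e z (U : T) : s z * U * s k = s z * s k * U by rewrite -mulrA -[U * s k]sC mulrA.
by rewrite /quat_hom /= !mulr0 !subr0 !addr0 !add0r !mulrDl !e !rmorphM.
Qed.

Let hMr (x : quaternions K) (U : T) :
  h x * U = s (qr x) * U + s (qi x) * (I * U) + s (qj x) * (J * U) + s (qk x) * (L * U).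
Proof. by rewrite /quat_hom !mulrDl -!(mulrA (s _)). Qed.

Let hI (x : quaternions K) : h (x * iq) = h x * I.
Proof.
rewrite hMr II JI LI /quat_hom /= !mulr0 !mulr1 !(sub0r, subr0, addr0, add0r, oppr0).
rewrite !mulrN !mulr1 !rmorphN !mulNr.
by rewrite addrAC; congr (_ + _ + _); exact: addrC.
Qed.

Let hJ (x : quaternions K) : h (x * jq) = h x * J.
Proof.
rewrite hMr JJ LJ /quat_hom /= !mulr0 !mulr1 !(sub0r, subr0, addr0, add0r, oppr0).
rewrite !mulrN !mulr1 !rmorphN !mulNr.
by rewrite -[LHS]addrA addrC addrA.
Qed.

Let quat_gen (x : quaternions K) : x =
  qsc (qr x) + iq * qsc (qi x) + jq * qsc (qj x) + iq * jq * qsc (qk x).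
Proof. by case: x => x y z t; congr Quat; rewrite /=; ring. Qed.

(** It is enough to know right multiplication by scalars, [i] and [j], from which every second
    factor is assembled. *)
Lemma quat_hom_monoid : monoid_morphism h.
Proof.
have h1 : h 1 = 1 by rewrite /quat_hom /= rmorph1 rmorph0 !mul0r !addr0.
split=> // x y.
have -> : h (x * y) = h x * s (qr y) + h x * I * s (qi y) + h x * J * s (qj y) +
    h x * L * s (qk y).
  rewrite {1}(quat_gen y) !(mulrDr x) !hD !(mulrA x) !(hZ, hI, hJ).
  by rewrite -(mulrA (h x) I J).
have -> : h y = s (qr y) + s (qi y) * I + s (qj y) * J + s (qk y) * L by [].
rewrite !(mulrDr (h x)).
by rewrite !(sC _ I) !(sC _ J) !(sC _ L) !mulrA.
Qed.

HB.instance Definition _ :=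
  GRing.isZmodMorphism.Build (quaternions K) T quat_hom quat_hom_zmod.
HB.instance Definition _ :=
  GRing.isMonoidMorphism.Build (quaternions K) T quat_hom quat_hom_monoid.

Definition quat_rmorphism : {rmorphism quaternions K -> T} := quat_hom.

Lemma quat_homE (x : quaternions K) : quat_rmorphism x =
  s (qr x) + s (qi x) * I + s (qj x) * J + s (qk x) * (I * J).
Proof. by []. Qed.

Lemma quat_hom_scalar k : quat_rmorphism (quat_scalar k) = s k.
Proof. by rewrite quat_homE /= rmorph0 !mul0r !addr0. Qed.

Lemma quat_hom_i : quat_rmorphism (Quat 0 1 0 0) = I.
Proof. by rewrite quat_homE /= rmorph0 rmorph1 !mul0r mul1r add0r !addr0. Qed.

Lemma quat_hom_j : quat_rmorphism (Quat 0 0 1 0) = J.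
Proof. by rewrite quat_homE /= rmorph0 rmorph1 !mul0r mul1r !add0r addr0. Qed.

End QuatHom.

(** The inverse is the conjugate divided by the norm [N], which is a sum of four squares. *)
Lemma quat_inverse (K : fieldType) :
  (forall a b c d : K, a * a + b * b + c * c + d * d = 0 ->
    [/\ a = 0, b = 0, c = 0 & d = 0]) ->
  forall x : quaternions K, x <> 0 -> exists y : quaternions K, y * x = 1.
Proof.
move=> sum4 x nx.
pose N := qr x * qr x + qi x * qi x + qj x * qj x + qk x * qk x.
have N0 : N != 0.
  apply/eqP => /sum4 E; apply: nx.
  by case: (x) E => /= ? ? ? ? [-> -> -> ->].
exists (Quat (qr x / N) (- qi x / N) (- qj x / N) (- qk x / N)).
by case: (x) @N N0 => a b c d N N0; congr Quat; rewrite /N /=; field.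
Qed.

(** * The step from [R_{4,0}] to the quaternions *)

Section QuaternionStep.
Variables (K : fieldType) (A : superalgebra K) (q : bool * bool -> A).
Hypothesis two_neq0 : (2 : K) != 0.
Hypothesis sum4 : forall a b c d : K, a * a + b * b + c * c + d * d = 0 ->
  [/\ a = 0, b = 0, c = 0 & d = 0].
Hypothesis H : is_clifford (fun _ => 1 : K) q.
Hypothesis A1 : (1 : A) <> 0.

Let a := q (false, false).
Let b := q (false, true).
Let c := q (true, false).
Let d := q (true, true).
Let v := quadw q.

Let qq i : q i * q i = 1. Proof. by rewrite (icl_sq H) rmorph1. Qed.
Let qa i j : i <> j -> q i * q j = - (q j * q i). Proof. exact: (icl_anti H). Qed.
Let C1 (x : A) : 1 * x = x * 1. Proof. by rewrite mul1r mulr1. Qed.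
Let s := sa_scalar A.

Let vv : v * v = 1. Proof. exact: (quadw_sq (mulr1 1) qq qa). Qed.
Let qv i : q i * v = - (v * q i).
Proof. exact: (quadw_anti C1 qq qa). Qed.

Let I := a * b.
Let J := b * c.
Let L := a * c.
Let ba : b * a = - (a * b). Proof. exact: qa. Qed.
Let ca : c * a = - (a * c). Proof. exact: qa. Qed.
Let cb : c * b = - (b * c). Proof. exact: qa. Qed.
Let aa : a * a = 1. Proof. exact: qq. Qed.
Let bb : b * b = 1. Proof. exact: qq. Qed.
Let cc : c * c = 1. Proof. exact: qq. Qed.
Let aax x : a * (a * x) = x. Proof. by rewrite mulrA aa mul1r. Qed.
Let bbx x : b * (b * x) = x. Proof. by rewrite mulrA bb mul1r. Qed.
Let ccx x : c * (c * x) = x. Proof. by rewrite mulrA cc mul1r. Qed.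
Let bax x : b * (a * x) = - (a * (b * x)). Proof. by rewrite mulrA ba mulNr mulrA. Qed.
Let cax x : c * (a * x) = - (a * (c * x)). Proof. by rewrite mulrA ca mulNr mulrA. Qed.
Let cbx x : c * (b * x) = - (b * (c * x)). Proof. by rewrite mulrA cb mulNr mulrA. Qed.
Let norm := (@mulrN A, @mulNr A, @opprK A, ba, ca, cb, bax, cax, cbx,
  aa, bb, cc, aax, bbx, ccx, @mulr1 A).

Let II : I * I = -1. Proof. by rewrite /I -!mulrA !norm. Qed.
Let JJ : J * J = -1. Proof. by rewrite /J -!mulrA !norm. Qed.
Let IJ : I * J = L. Proof. by rewrite /I /J /L -!mulrA !norm. Qed.
Let JI : J * I = - (I * J). Proof. by rewrite IJ /I /J /L -!mulrA !norm. Qed.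

Let iq : quaternions K := Quat 0 1 0 0.
Let jq : quaternions K := Quat 0 0 1 0.
Let h := quat_rmorphism (@sa_scalarC K A) II JJ JI.
Let hE x : h x = s (qr x) + s (qi x) * I + s (qj x) * J + s (qk x) * L.
Proof. by rewrite /h quat_homE IJ. Qed.
Let hi : h iq = I. Proof. exact: quat_hom_i. Qed.
Let hj : h jq = J. Proof. exact: quat_hom_j. Qed.

Let hv (x : quaternions K) : h x * v = v * h x.
Proof.
have e i j : q i * q j * v = v * (q i * q j).
  by rewrite -mulrA qv mulrN mulrA qv mulNr opprK mulrA.
have e' k i j : s k * (q i * q j) * v = v * (s k * (q i * q j)).
  by rewrite -(mulrA (s k)) e (mulrA (s k) v) [s k * v]sa_scalarC -(mulrA v).
by rewrite hE !mulrDl !mulrDr /I /J /L !e' /s (sa_scalarC _ v).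
Qed.

Local Notation f := (hidem v).

(** The products [a b] and [b c] are even, commute with [v] and satisfy the quaternion relations,
    which yields the map [h]. The fourth generator adds nothing new to the corner, because [v] acts
    there as 1. *)
Lemma quaternion_step : super_morita A (quaternions K).
Proof.
have o i : sa_gr A true (q i) by exact: (icl_odd H).
have v0 : sa_gr A false v by exact: (sa_grM (sa_grM (sa_grM (o _) (o _)) (o _)) (o _)).
have f0 : f <> 0.
  move=> f0; apply: A1; have := hidem_conj two_neq0 (qq (false, false)) (qv _).
  by rewrite f0 mulr0 mul0r subr0 => ->.
have hk k : h (quat_scalar k) = s k by exact: quat_hom_scalar.
apply: (hidem_step two_neq0 v0 vv (o (false, false)) (qq _) (qv _)
  (h := h) H) => //.
- move=> [] x /=; first by move=> ->; rewrite (rmorph0 h); exact: (Z2gr0 (sa_grP A) true).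
  move=> _; rewrite hE; do !apply: (Z2grD (sa_grP A)).
  + exact: sa_scalar_gr.
  + by apply: sa_grZ; exact: (sa_grM (o _) (o _)).
  + by apply: sa_grZ; exact: (sa_grM (o _) (o _)).
  + by apply: sa_grZ; exact: (sa_grM (o _) (o _)).
(* A nonzero quaternion has a left inverse, so [h x * f = 0] would give [f = 0]. *)
- move=> x hx; apply: contrapT => /(quat_inverse sum4) [y yx]; apply: f0.
  by rewrite -[f]mul1r -(rmorph1 h) -yx rmorphM -mulrA hx mulr0.
have fi i : f * q i * f = 0 by exact: (hidem_anti0 two_neq0 vv).
have aia i : f * (a * q i * a) * f = 0.
  apply: (hidem_anti0 two_neq0 vv).
  have av : a * v = - (v * a) by exact: qv.
  rewrite -(mulrA (a * q i) a v) av mulrN (mulrA _ v a) -(mulrA a (q i) v) (qv i).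
  by rewrite mulrN mulNr opprK (mulrA a v) av !mulNr -(mulrA v a) -(mulrA v).
(* As [d * a = J * v] and [v * f = f], the product with the fourth generator is again a quaternion
   on the corner. *)
have dE : d * a * f = h jq * f.
  have E : J * v = d * a.
    have da : d * a = - (a * d) by exact: qa.
    by rewrite da /J /v /quadw -/a -/b -/c -/d -!mulrA !norm.
  by rewrite -E -mulrA (hidem_vl vv) hj.
have gen i (y : quaternions K) : q i * a * f = h y * f ->
    i <> (false, false) ->
    exists b1 b2 b3 b4 : quaternions K, [/\ h b1 * f = f * q i * f,
      h b2 * f = f * (q i * a) * f, h b3 * f = f * (a * q i) * f &
      h b4 * f = f * (a * q i * a) * f].
  move=> yE ia; have qaf : f * (q i * a) * f = h y * f.
    rewrite -(hidem_comm (x := q i * a)).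
      by rewrite -(mulrA _ f f) (hidem_idem two_neq0 vv) yE.
    by rewrite -mulrA qv mulrN mulrA qv mulNr opprK mulrA.
  exists 0, y, (- y), 0; rewrite rmorph0 rmorphN !mul0r; split.
  - by rewrite fi.
  - by rewrite qaf.
  - by rewrite -[a * q i]opprK -(qa ia) mulrN !mulNr qaf.
  - by rewrite aia.
move=> [[] []].
- exact: (gen (true, true) jq dE).
- apply: (gen (true, false) (- (iq * jq))) => //.
  by rewrite ca rmorphN rmorphM hi hj IJ.
- apply: (gen (false, true) (- iq)) => //.
  by rewrite ba rmorphN hi.
- exists 0, 1, 1, 0; rewrite rmorph0 rmorph1 !mul0r mul1r -/a aa mulr1 mul1r fi.
  by rewrite (hidem_idem two_neq0 vv).
Qed.

End QuaternionStep.

(** * Induction on the signature, real and complex *)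

Section Reduction.
Variable K : fieldType.
Hypothesis two_neq0 : (2 : K) != 0.

Lemma clifford_step (A : superalgebra K) n p q :
  has_sign A n p.+1 -> n = (p + q).+2 -> super_morita A (clifford K p q).
Proof.
move=> HA nE; rewrite nE in HA.
by apply: (has_sign_step two_neq0 (leq_addr q p) HA); exact: has_sign_clifford.
Qed.

(** The last hyperbolic pair leaves no generators; the target is then the field itself, taken as a
    Clifford system on the empty index set. *)
Lemma ground_step (A : superalgebra K) : has_sign A 2 1 -> super_morita A (ground K).
Proof.
by move=> HA; apply: (has_sign_step two_neq0 (leqnn 0) HA); exact: has_sign_ground.
Qed.

Section Real.
Hypothesis sum4 : forall a b c d : K, a * a + b * b + c * c + d * d = 0 ->
  [/\ a = 0, b = 0, c = 0 & d = 0].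

Lemma quaternions_of_sign (A : superalgebra K) : has_sign A 4 4 ->
  super_morita A (quaternions K).
Proof.
move=> HA; have A1 := has_sign_nontrivial HA.
have [||g H] := has_sign_pullback (A := A) (n := 4) (p := 4)
  (u := fun b => quad_index (leqnn 0) (inl b)) _ _ HA.
- by move=> x y E; case: (@quad_index_inj 0 0 (leqnn 0) (inl x) (inl y) E).
- by rewrite card_prod card_bool.
apply: (quaternion_step two_neq0 sum4 (q := g)) => //.
by apply: (is_clifford_ext H) => x; rewrite /sign_of ltn_ord.
Qed.

(** The index is [p - q] modulo 8. Since [0 - 3], [0 - 2] and [0 - 1] are 5, 6 and 7, the negative
    definite algebras appear in decreasing order. *)
Definition real_target (r : nat) : superalgebra K :=
  match r with
  | 0 => ground K
  | 1 => clifford K 1 0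
  | 2 => clifford K 2 0
  | 3 => clifford K 3 0
  | 4 => quaternions K
  | 5 => clifford K 0 3
  | 6 => clifford K 0 2
  | _ => clifford K 0 1
  end.

(** The residue of [p - q] is written with [7] for [-1] to remain within [nat]; it is unchanged by
    removing a pair and by exchanging four signs. *)
Lemma real_reduction p q : (0 < p + q)%N ->
  super_morita (clifford K p q) (real_target ((p + 7 * q) %% 8)).
Proof.
have [N] := ubnP (p + q); elim: N p q => // N IH p q pqN pq0.
have step A p' q' : super_morita A (clifford K p' q') -> (0 < p' + q' < N)%N ->
    (p + 7 * q = p' + 7 * q' %[mod 8])%N ->
    super_morita A (real_target ((p + 7 * q) %% 8)).
  move=> h /andP [h0 hN] ->; apply: (super_morita_trans h); apply: IH => //.
have S := has_sign_clifford K p q.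
case: p pqN pq0 step S => [|p] pqN pq0 step S.
  case: q pqN pq0 step S => [|[|[|[|[|q]]]]] pqN // pq0 step S; try exact: super_morita_refl.
    by apply: quaternions_of_sign; apply/(@has_sign_flip _ _ 0 0 (leqnn 0)).
  (* Here the algebra is R_{0,q+5}, which also has signature (4, q+1); removing a pair leaves
     R_{3,q}. *)
  apply: (step _ 3 q); [|lia|lia].
  apply: (@clifford_step _ (q.+1 + 4)); last by lia.
  by apply/(@has_sign_flip _ _ q.+1 0 (leq0n _)); rewrite addn4.
case: q pqN pq0 step S => [|q] pqN pq0 step S.
  case: p pqN pq0 step S => [|[|[|[|p]]]] pqN pq0 step S; try exact: super_morita_refl.
    exact: quaternions_of_sign.
  (* Here the algebra is R_{p+5,0}, which also has signature (p+1, 4); removing a pair leaves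
     R_{p,3}. *)
  apply: (step _ p 3); [|lia|lia].
  apply: (@clifford_step _ (p.+1 + 4)); last by lia.
  apply/(@has_sign_flip _ _ p.+1 p.+1 (leqnn _)).
  by rewrite !addn0 -addn4 in S *.
have [pq|pq] := posnP (p + q).
  have [p0 q0] : p = 0%N /\ q = 0%N by lia.
  by subst p q; exact: ground_step.
apply: (step _ p q); [|lia|lia].
by apply: (clifford_step S); lia.
Qed.

End Real.

Section Complex.
Variable i : K.
Hypothesis ii : i * i = -1.

(** The last generator is multiplied by [i], which provides the generator of square -1 for a
    hyperbolic pair. *)
Lemma has_sign_complex (A : superalgebra K) n :
  has_sign A n.+1 n.+1 -> has_sign A n.+1 n.
Proof.
move=> [g H]; pose c (j : 'I_n.+1) := if (j < n)%N then 1 else i.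
have i0 : i != 0.
  by apply/eqP => i0; move: ii; rewrite i0 mulr0 => /esym/eqP; rewrite oppr_eq0 oner_eq0.
have c0 j : c j != 0 by rewrite /c; case: ifP; rewrite ?oner_neq0.
exists (fun j => sa_scalar A (c j) * g j).
apply: (is_clifford_ext (is_clifford_scale H c0)) => j.
by rewrite /sign_of /c ltn_ord mulr1; case: ifP; rewrite ?mulr1.
Qed.

Lemma complex_reduction p : (0 < p)%N ->
  super_morita (clifford K p 0) (if odd p then clifford K 1 0 else ground K).
Proof.
have [N] := ubnP p; elim: N p => // N IH [|[|[|p]]] // pN _.
- exact: super_morita_refl.
- by apply/ground_step/has_sign_complex; exact: has_sign_clifford.
apply: super_morita_trans (_ : super_morita _ (clifford K p.+1 0)) _.
  apply: (@clifford_step _ (p.+3)); last by rewrite addn0.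
  have := has_sign_clifford K p.+3 0; rewrite addn0; exact: has_sign_complex.
have -> : odd p.+3 = odd p.+1 by rewrite /= negbK.
by apply: IH => //; lia.
Qed.

End Complex.

End Reduction.

(** * Graded division algebras *)

Section GradedDivision.
Variables (K : fieldType) (B : superalgebra K).

Record graded_division : Prop := GradedDivision {
  gdiv_neq0 : (1 : B) <> 0;
  gdiv_inv : forall i (b : B), sa_gr B i b -> b <> 0 ->
    exists2 c, sa_gr B i c & c * b = 1
}.

Hypothesis Bdiv : graded_division.

Definition shift_by (i : bool) (M : grmod B) : grmod B := if i then shift M else M.

Section Orbit.
Variables (M : grmod B) (i : bool) (m : M).
Hypothesis mi : gm_gr M i m.

Let orbit_fun (b : regular B) : M := (b : B) *: m.

Let orbit_lin : linear orbit_fun.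
Proof. by move=> a x y; rewrite /orbit_fun scalerDl scalerA. Qed.

Let orbit_gr j b : sa_gr B j b -> gm_gr M (j (+) i) (orbit_fun b).
Proof. by move=> bj; exact: gm_grM. Qed.

(** The components of [b] send the homogeneous [m] to different degrees, so each of them kills [m];
    a nonzero component could be inverted. *)
Lemma orbit_inj : m <> 0 -> forall b : B, b *: m = 0 -> b = 0.
Proof.
move=> nm b bm; rewrite -(part_sum (sa_grP B) b).
have h j : apart j b = 0.
  apply: contrapT => /(gdiv_inv Bdiv (partP (sa_grP B) j b)) [c _ cb]; apply: nm.
  have : apart j b *: m = 0.
    have := congr1 (mpart (j (+) i)) bm; rewrite /mpart part0 => <-.
    rewrite -{2}(part_sumb (sa_grP B) j b) scalerDl partD.
    have P k : gm_gr M (k (+) i) (apart k b *: m).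
      exact: (gm_grM (partP (sa_grP B) k b) mi).
    rewrite (part_id _ (P j)) (part_homog _ _ (P (~~ j))).
    by case: (j); case: (i); rewrite addr0.
  by move=> E; rewrite -[m]scale1r -cb -scalerA E scaler0.
by rewrite -!/(apart _ _) !h addr0.
Qed.

(** The map [b |-> b m] is injective over a graded division algebra and onto by irreducibility; it
    becomes even once the source is shifted by the degree of [m]. *)
Lemma orbit_iso : irreducible M -> m <> 0 ->
  @isomorphic (Gr B) (shift_by i (regular B)) M.
Proof.
move=> /gr_irreducibleP [_ irr] nm.
have fb : bijective orbit_fun.
  apply: inj_surj_bij => [x y E|y]; last by have [a ->] := irr i m mi nm y; exists a.
  apply/eqP; rewrite -subr_eq0; apply/eqP/(orbit_inj nm).
  by rewrite scalerBl -!/(orbit_fun _) E subrr.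
move: orbit_gr; case: (i) => ogr.
  have ev j (b : regular B) : sa_gr B (~~ j) b -> gm_gr M j (orbit_fun b).
    by move/ogr; rewrite addbT negbK.
  exact: (@bij_isomorphic _ _ _ _ (@GrHom _ _ (shift (regular B)) M _ orbit_lin ev)).
have ev j (b : regular B) : sa_gr B j b -> gm_gr M j (orbit_fun b).
  by move/ogr; rewrite addbF.
exact: (@bij_isomorphic _ _ _ _ (GrHom orbit_lin ev)).
Qed.

End Orbit.

Lemma regular_irreducible : irreducible (regular B).
Proof.
apply/gr_irreducibleP; split; first by exists 1; exact: gdiv_neq0.
move=> i x xi nx y; have [c _ cx] := gdiv_inv Bdiv xi nx.
by exists (y * c); rewrite -[(y * c) *: x]/(y * c * x) -mulrA cx mulr1.
Qed.

Lemma shift_irreducible (M : grmod B) : irreducible M -> irreducible (shift M).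
Proof.
move=> /gr_irreducibleP [nz h]; apply/gr_irreducibleP; split; first exact: nz.
by move=> i x xi nx y; exact: (h _ x xi nx y).
Qed.

Lemma irr_list_odd_unit (u : B) : sa_gr B true u -> u <> 0 ->
  irredundant_irr_list [:: regular B].
Proof.
move=> u1 nu; split.
- by constructor; [exact: regular_irreducible|constructor].
- by constructor; constructor.
move=> M iM; have /gr_irreducibleP [[x nx] _] := iM.
constructor; apply: isomorphic_sym.
have [i ni] := nonzero_part (gm_grP M) nx.
have mi : gm_gr M i (mpart i x) by exact: partP.
case: i ni mi => ni mi; last exact: (orbit_iso mi iM ni).
(* The odd [u] turns an odd vector into an even one, nonzero by [orbit_inj]. *)
apply: (@orbit_iso M false (u *: mpart true x) _ iM).
  exact: (gm_grM u1 mi).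
by move/(orbit_inj mi ni).
Qed.

Lemma irr_list_even : (forall b, sa_gr B true b -> b = 0) ->
  irredundant_irr_list [:: regular B; shift (regular B)].
Proof.
move=> B1; split.
- do 2 (constructor; first by [exact: regular_irreducible
    | apply: shift_irreducible; exact: regular_irreducible]).
  by constructor.
- constructor; last by constructor; constructor.
  constructor; last by constructor.
  (* An isomorphism from [B] to its shift would send 1 to an odd element of [B], which is 0. *)
  move=> /isomorphic_bij [f /bij_inj fi]; apply: (gdiv_neq0 Bdiv).
  apply: fi; rewrite gh0; apply: B1; exact: (gh_even f (sa_gr1 B)).
move=> M iM; have /gr_irreducibleP [[x nx] _] := iM.
have [i ni] := nonzero_part (gm_grP M) nx.
have := isomorphic_sym (orbit_iso (partP (gm_grP M) i x) iM ni).
by case: (i) => h; [right; left|left].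
Qed.

End GradedDivision.

(** [B = D + D e] with [D] the even part of [B]. *)
Section EvenPart.
Variables (K : fieldType) (B : superalgebra K) (I : Type) (eps : I -> K).
Variables (g : I -> B) (e : B) (k : K) (D : B -> Prop).
Hypotheses (H : is_clifford eps g) (B1 : (1 : B) <> 0)
  (e1 : sa_gr B true e) (ee : e * e = sa_scalar B k) (kk : k * k = 1).
Hypotheses (Dgr : forall y, D y -> sa_gr B false y)
  (Dk : forall l, D (sa_scalar B l))
  (DD : forall x y, D x -> D y -> D (x + y))
  (DM : forall x y, D x -> D y -> D (x * y))
  (De : forall y, D y -> exists2 y', D y' & e * y = y' * e)
  (Dg : forall i, exists2 z, D z & g i = z * e)
  (Dinv : forall y, D y -> y <> 0 -> exists2 z, D z & z * y = 1).

(** The sums [y + z * e] are closed under products because [e] can be moved past [D] at the price of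
    a twist and its square is a scalar. *)
Lemma even_decomp x : exists y z, [/\ D y, D z & x = y + z * e].
Proof.
elim/(icl_ind H): x => [l|i|x x' [y [z [Dy Dz ->]]] [y' [z' [Dy' Dz' ->]]]
    |x x' [y [z [Dy Dz ->]]] [y' [z' [Dy' Dz' ->]]]].
- exists (sa_scalar B l), (sa_scalar B 0); split=> //.
  by rewrite rmorph0 mul0r addr0.
- have [z Dz zE] := Dg i; exists (sa_scalar B 0), z; split=> //.
  by rewrite rmorph0 add0r.
- exists (y + y'), (z + z'); split; [exact: DD|exact: DD|].
  by rewrite mulrDl addrACA.
have [w Dw wE] := De Dy'; have [w' Dw' wE'] := De Dz'.
exists (y * y' + z * w' * sa_scalar B k), (y * z' + z * w); split.
- by apply: DD; [exact: DM|apply: (DM) => //; exact: DM].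
- by apply: DD; exact: DM.
rewrite mulrDl !mulrDr -ee -!mulrA (mulrA e z') wE' wE -!mulrA mulrDl -!mulrA.
by rewrite (addrC (z * (w * e))) addrACA.
Qed.

(** Even elements lie in [D], odd ones are [z * e]; the latter have inverse [k * e * w] with
    [w * z = 1], because [e * e] and the factor [k] cancel. *)
Lemma even_part_division : graded_division B.
Proof.
split=> // -[] x xi nx; have [y [z [Dy Dz xE]]] := even_decomp x.
  have ze : sa_gr B true (z * e) by exact: (sa_grM (Dgr Dz) e1).
  have y0 : y = 0.
    apply: (gr_disj (sa_grP B) (Dgr Dy)); have -> : y = x - z * e by rewrite xE addrK.
    exact: (Z2grB (sa_grP B)).
  have xE' : x = z * e by rewrite xE y0 add0r.
  have [w Dw wz] : exists2 w, D w & w * z = 1.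
    by apply: Dinv => // z0; apply: nx; rewrite xE' z0 mul0r.
  exists (sa_scalar B k * (e * w)).
    by apply: sa_grZ; exact: (sa_grM e1 (Dgr Dw)).
  rewrite xE' -!mulrA (mulrA w) wz mul1r ee -rmorphM kk rmorph1 //.
have ze : sa_gr B true (z * e) by exact: (sa_grM (Dgr Dz) e1).
have ze0 : z * e = 0.
  apply: (gr_disj (sa_grP B) ze); have -> : z * e = x - y by rewrite xE addrAC subrr add0r.
  exact: (Z2grB (sa_grP B) xi (Dgr Dy)).
have xE' : x = y by rewrite xE ze0 addr0.
have [||w Dw wy] := Dinv (y := x); rewrite ?xE' // -?xE' //.
by exists w => //; exact: Dgr.
Qed.

Lemma even_part_fd (J : finType) (d : J -> B) :
  (forall y, D y -> exists c : J -> K, y = \sum_j sa_scalar B (c j) * d j) ->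
  sa_fin_dim B.
Proof.
move=> hd; suff : fin_dim (regular B) by [].
apply/fin_dimP; exists (J + J)%type.
exists (fun j => if j is inr j then d j * e else if j is inl j then d j else 0).
move=> x; have [y [z [/hd [c ->] /hd [c' ->] ->]]] := even_decomp x.
exists (fun j => match j with inr j => c' j | inl j => c j end).
rewrite big_sumType /=; congr (_ + _); rewrite mulr_suml; apply: eq_bigr => j _.
by rewrite -mulrA.
Qed.

End EvenPart.

Definition odd_graded_division (K : fieldType) (B : superalgebra K) : Prop :=
  [/\ graded_division B, sa_fin_dim B & exists2 u, sa_gr B true u & u <> 0].

Section SmallClifford.
Variables (K : fieldType) (B : superalgebra K) (k : K) (n : nat) (g : 'I_n -> B).
Hypotheses (kk : k * k = 1) (B1 : (1 : B) <> 0).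
Hypothesis H : is_clifford (fun _ : 'I_n => k) g.
Let s := sa_scalar B.
Let sC (l : K) x : s l * x = x * s l. Proof. exact: sa_scalarC. Qed.
Let ssk : s k * s k = 1. Proof. by rewrite -rmorphM kk rmorph1. Qed.

Let gen_neq0 i : g i <> 0.
Proof.
move=> g0; apply: B1; rewrite -ssk -{2}(icl_sq H i) g0.
by rewrite mulr0 mulr0.
Qed.

(** Here [D] consists of the scalars. *)
Lemma clifford1_division : n = 1 -> odd_graded_division B.
Proof.
case: n g H gen_neq0 => [|[|]] // h hP hn _.
pose D y := exists l, y = s l.
have e1 : sa_gr B true (h 0) by exact: (icl_odd hP).
have ee := icl_sq hP 0.
have Dk l : D (s l) by exists l.
have DD x y : D x -> D y -> D (x + y).
  by move=> [l ->] [l' ->]; exists (l + l'); rewrite /s rmorphD.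
have DM x y : D x -> D y -> D (x * y).
  by move=> [l ->] [l' ->]; exists (l * l'); rewrite /s rmorphM.
have De y : D y -> exists2 y', D y' & h 0 * y = y' * h 0.
  by move=> [l ->]; exists (s l) => //; rewrite sC.
have Dg i : exists2 z, D z & h i = z * h 0.
  by exists (s 1) => //; rewrite /s rmorph1 mul1r ord1.
split; last by exists (h 0).
  apply: (even_part_division hP B1 e1 ee kk _ Dk DD DM De Dg).
    by move=> y [l ->]; exact: sa_scalar_gr.
  move=> y [l ->] nl; exists (s l^-1) => //.
  have l0 : l != 0 by apply/eqP => l0; apply: nl; rewrite l0 /s rmorph0.
  by rewrite /s -rmorphM mulVf // rmorph1.
apply: (even_part_fd hP ee Dk DD DM De Dg (d := fun _ : unit => 1)).
by move=> y [l ->]; exists (fun _ => l); rewrite big_const card_unit /= addr0 mulr1.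
Qed.

Hypothesis sum4 : forall a b c d : K, a * a + b * b + c * c + d * d = 0 ->
  [/\ a = 0, b = 0, c = 0 & d = 0].

(** Here [D] is spanned by 1 and [I = a b]. Its square is -1 for either sign [k], so [D] behaves
    like complex numbers with norm [l * l + m * m]. *)
Lemma clifford2_division : n = 2 -> odd_graded_division B.
Proof.
case: n g H gen_neq0 => [|[|[|]]] // h hP hn _.
set a := h 0; set b := h 1.
have aa : a * a = s k := icl_sq hP 0.
have bb : b * b = s k := icl_sq hP 1.
have ba : b * a = - (a * b) by exact: (icl_anti hP).
pose I := a * b.
have II : I * I = -1.
  by rewrite /I -mulrA (mulrA b a b) ba mulNr -mulrA bb mulrN mulrA aa ssk.
have aI : a * I = - (I * a).
  by rewrite /I -(mulrA a b a) ba mulrN opprK.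
pose D y := exists l m, y = s l + s m * I.
have e1 : sa_gr B true a by exact: (icl_odd hP).
have Dk l : D (s l) by exists l, 0; rewrite /s rmorph0 mul0r addr0.
have DD x y : D x -> D y -> D (x + y).
  move=> [l [m ->]] [l' [m' ->]]; exists (l + l'), (m + m').
  by rewrite /s !rmorphD mulrDl addrACA.
have mulI l m l' m' : (s l + s m * I) * (s l' + s m' * I) =
    s (l * l' - m * m') + s (l * m' + m * l') * I.
  rewrite mulrDl !mulrDr /s rmorphB rmorphD !rmorphM -/s.
  rewrite (mulrA (s l) (s m')) -(mulrA (s m)) -[I * s l']sC (mulrA (s m)).
  rewrite -(mulrA (s m)) -(mulrA (s m) I) (mulrA I (s m')) -[I * s m']sC.
  rewrite -(mulrA (s m') I) II mulrN1 mulrN mulrDl (addrC (s m * (s l' * I))) addrACA.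
  by rewrite (mulrA (s m) (s l')).
have DM x y : D x -> D y -> D (x * y).
  move=> [l [m ->]] [l' [m' ->]]; exists (l * l' - m * m'), (l * m' + m * l').
  exact: mulI.
have De y : D y -> exists2 y', D y' & a * y = y' * a.
  move=> [l [m ->]]; exists (s l + s (- m) * I); first by exists l, (- m).
  rewrite mulrDr mulrDl -[a * s l]sC; congr (_ + _).
  by rewrite (mulrA a) -[a * s m]sC -mulrA aI /s rmorphN mulrN !mulNr mulrA.
have Dg i : exists2 z, D z & h i = z * a.
  case: i => [[|[|]]] // hi.
    by exists (s 1) => //; rewrite /s rmorph1 mul1r; congr h; exact: val_inj.
  (* From [k * k = 1]: [b = k a a b = k a I = - k I a]. *)
  exists (s (- k) * I); first by exists 0, (- k); rewrite /s rmorph0 add0r.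
  have -> : h (Ordinal hi) = b by congr h; exact: val_inj.
  have -> : s (- k) * I * a = s k * (a * I) by rewrite aI mulrN -mulrA /s rmorphN mulNr.
  by rewrite /I (mulrA a) aa mulrA ssk mul1r.
split; last by exists a => //; exact: hn.
  apply: (even_part_division hP B1 e1 aa kk _ Dk DD DM De Dg).
    move=> y [l [m ->]]; apply: (Z2grD (sa_grP B)); first exact: sa_scalar_gr.
    by apply: sa_grZ; exact: (sa_grM (icl_odd hP 0) (icl_odd hP 1)).
  move=> y [l [m ->]] nl; pose N := l * l + m * m.
  have N0 : N != 0.
    apply/eqP => N0; apply: nl; have [|-> -> _ _] := sum4 (a := l) (b := m) (c := 0) (d := 0).
      by rewrite mulr0 !addr0.
    by rewrite /s rmorph0 mul0r addr0.
  exists (s (l / N) + s (- m / N) * I); first by exists (l / N), (- m / N).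
  rewrite mulI.
  have -> : l / N * m + - m / N * l = 0 by field.
  have -> : l / N * l - - m / N * m = 1 by rewrite /N; field.
  by rewrite rmorph0 mul0r rmorph1 addr0.
apply: (even_part_fd hP aa Dk DD DM De Dg (d := fun j : bool => if j then I else 1)).
move=> y [l [m ->]]; exists (fun j : bool => if j then m else l).
by rewrite big_bool /= addrC mulr1.
Qed.

(** Here [D] is the image of the quaternions under [I = a b], [J = b c]; for either [k] both squares
    are -1. *)
Lemma clifford3_division : n = 3 -> odd_graded_division B.
Proof.
case: n g H gen_neq0 => [|[|[|[|]]]] // h hP hn _.
set a := h 0; set b := h 1; set c := h 2.
have aa : a * a = s k := icl_sq hP 0.
have bb : b * b = s k := icl_sq hP 1.
have cc : c * c = s k := icl_sq hP 2.
have ba : b * a = - (a * b) by exact: (icl_anti hP).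
have ca : c * a = - (a * c) by exact: (icl_anti hP).
have cb : c * b = - (b * c) by exact: (icl_anti hP).
pose I := a * b; pose J := b * c.
have II : I * I = -1.
  by rewrite /I -mulrA (mulrA b a b) ba mulNr -mulrA bb mulrN mulrA aa ssk.
have JJ : J * J = -1.
  by rewrite /J -mulrA (mulrA c b c) cb mulNr -mulrA cc mulrN mulrA bb ssk.
have aI : a * I = - (I * a).
  by rewrite /I -(mulrA a b a) ba mulrN opprK.
have aJ : a * J = J * a.
  by rewrite /J -mulrA ca mulrN (mulrA b a c) ba mulNr opprK mulrA.
have IJ : I * J = s k * (a * c).
  by rewrite /I /J -mulrA (mulrA b b c) bb mulrA -[a * s k]sC mulrA.
have JI : J * I = - (I * J).
  rewrite IJ /I mulrA -aJ /J -!mulrA cb mulrN (mulrA b b) bb.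
  by rewrite mulrN (mulrA a) -[a * s k]sC -mulrA.
pose hq := quat_rmorphism sC II JJ JI.
pose D y := exists q, y = hq q.
have e1 : sa_gr B true a by exact: (icl_odd hP).
have Dk l : D (s l) by exists (quat_scalar l); rewrite /hq quat_hom_scalar.
have DD x y : D x -> D y -> D (x + y).
  by move=> [q ->] [q' ->]; exists (q + q'); rewrite rmorphD.
have DM x y : D x -> D y -> D (x * y).
  by move=> [q ->] [q' ->]; exists (q * q'); rewrite rmorphM.
have De y : D y -> exists2 y', D y' & a * y = y' * a.
  (* Conjugation by [a] fixes [J] and changes the sign of [I], hence also that of [I * J]. *)
  move=> [q ->]; pose q' : quaternions K := Quat (qr q) (- qi q) (qj q) (- qk q).
  exists (hq q'); first by exists q'.
  have as' l x : a * (s l * x) = s l * (a * x) by rewrite mulrA -sC -mulrA.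
  rewrite /hq !quat_homE /q' /= !mulrDr !mulrDl !as' -[a * s _]sC aI aJ.
  rewrite (mulrA a I J) aI !mulNr -(mulrA I a) aJ /s !rmorphN !mulNr !mulrN.
  by rewrite !mulrA.
have Dg i : exists2 z, D z & h i = z * a.
  case: i => [[|[|[|]]]] // hi.
  - by exists (s 1) => //; rewrite /s rmorph1 mul1r; congr h; exact: val_inj.
  - exists (s (- k) * I).
      by apply: DM => //; exists (Quat 0 1 0 0); rewrite /hq quat_hom_i.
    have -> : h (Ordinal hi) = b by congr h; exact: val_inj.
    have -> : s (- k) * I * a = s k * (a * I).
      by rewrite aI mulrN -mulrA /s rmorphN mulNr.
    by rewrite /I (mulrA a) aa mulrA ssk mul1r.
  (* Since [I J = k a c], one gets [- I J a = k a a c = c]. *)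
  exists (s (-1) * (I * J)).
    apply: (DM) => //; apply: DM.
      by exists (Quat 0 1 0 0); rewrite /hq quat_hom_i.
    by exists (Quat 0 0 1 0); rewrite /hq quat_hom_j.
  have -> : h (Ordinal hi) = c by congr h; exact: val_inj.
  rewrite /s rmorphN rmorph1 mulN1r IJ mulNr -!mulrA ca mulrN mulrN opprK.
  by rewrite (mulrA a a) aa (mulrA (s k)) ssk mul1r.
have J0 : sa_gr B false J by exact: (sa_grM (icl_odd hP 1) (icl_odd hP 2)).
have I0 : sa_gr B false I by exact: (sa_grM (icl_odd hP 0) (icl_odd hP 1)).
split; last by exists a => //; exact: hn.
  apply: (even_part_division hP B1 e1 aa kk _ Dk DD DM De Dg).
    move=> y [q ->]; rewrite /hq quat_homE; do !apply: (Z2grD (sa_grP B)).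
    - exact: sa_scalar_gr.
    - exact: sa_grZ.
    - exact: sa_grZ.
    - by apply: sa_grZ; exact: (sa_grM I0 J0).
  move=> y [q ->] nq.
  have [|q' q'q] := @quat_inverse K sum4 q.
    by move=> q0; apply: nq; rewrite q0 rmorph0.
  by exists (hq q'); [exists q' | rewrite -rmorphM q'q rmorph1].
apply: (even_part_fd hP aa Dk DD DM De Dg (d := fun j : bool * bool =>
  if j.1 then if j.2 then I * J else J else if j.2 then I else 1)).
move=> y [q ->]; exists (fun j : bool * bool =>
  if j.1 then if j.2 then qk q else qj q else if j.2 then qi q else qr q).
pose F (u v : bool) := s (if u then if v then qk q else qj q
  else if v then qi q else qr q) *
  (if u then if v then I * J else J else if v then I else 1).
rewrite -[RHS]/(\sum_p F p.1 p.2) -pair_bigA !big_bool /F /= mulr1.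
rewrite /hq quat_homE //.
have E (u v w x : B) : u + v + w + x = x + w + (v + u).
  by rewrite [RHS]addrC (addrC v) (addrC x) addrA.
exact: E.
Qed.

End SmallClifford.

Lemma ground_division (K : fieldType) : graded_division (ground K) /\
  sa_fin_dim (ground K).
Proof.
split; last first.
  exists [:: 1] => a; exists (fun _ => a).
  by rewrite big_ord1 /= mulr1.
split; first by apply/eqP; exact: oner_neq0.
move=> [] b /= bi nb; first by [].
by exists (b^-1 : K) => //; apply: mulVf; apply/eqP.
Qed.

Lemma quaternions_division (K : fieldType) :
  (forall a b c d : K, a * a + b * b + c * c + d * d = 0 ->
    [/\ a = 0, b = 0, c = 0 & d = 0]) ->
  graded_division (quaternions K) /\ sa_fin_dim (quaternions K).
Proof.
move=> sum4; split.
  split; first by move=> /(congr1 (@qr K)) /eqP; rewrite oner_eq0.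
  move=> [] b /= bi nb; first by [].
  by have [c cb] := quat_inverse sum4 nb; exists c.
exists [:: Quat 1 0 0 0; Quat 0 1 0 0; Quat 0 0 1 0; Quat 0 0 0 1] => q.
exists (fun i => nth 0 [:: qr q; qi q; qj q; qk q] i).
rewrite !big_ord_recl big_ord0 /=.
by case: q => w x y z; congr Quat; rewrite /=; ring.
Qed.

(** * Grothendieck groups of graded division algebras *)

Section DirectSum.
Variables (K : fieldType) (B : superalgebra K) (M N : grmod B).

Definition dsum_gr (i : bool) (x : M * N) : Prop := gm_gr M i x.1 /\ gm_gr N i x.2.

Lemma dsum_grP : Z2grading dsum_gr.
Proof.
apply: (@Z2grading_of_parts _ _ (fun i x => (mpart i x.1, mpart i x.2))).
- by move=> i; split; exact: (Z2gr0 (gm_grP _)).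
- by move=> i x y [? ?] [? ?]; split; apply: (Z2grB (gm_grP _)).
- by move=> i x; split; exact: partP.
- by move=> [x y]; congr (_, _); exact: part_sum.
- by move=> [x y] [/= h h'] [/= k k'];
  rewrite (gr_disj (gm_grP M) h k) (gr_disj (gm_grP N) h' k').
Qed.

Lemma dsum_grM i j b (x : M * N) : sa_gr B i b -> dsum_gr j x ->
  dsum_gr (i (+) j) (b *: x).
Proof. by move=> bi [? ?]; split; exact: gm_grM. Qed.

Definition dsum : grmod B := GrMod dsum_grP dsum_grM.

Let inl_lin : linear (fun x : M => (x, 0) : dsum).
Proof. by move=> a x y; congr (_, _); rewrite /= scaler0 addr0. Qed.
Let snd_lin : linear (fun x : dsum => x.2 : N).
Proof. by []. Qed.

Lemma dsum_exact : short_exact M dsum N.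
Proof.
exists (@GrHom _ _ M dsum _ inl_lin (fun i x xi => conj xi (Z2gr0 (gm_grP N) i))).
exists (@GrHom _ _ dsum N _ snd_lin (fun i x xi => proj2 xi)); split.
- by move=> x y /= [].
- by move=> y; exists (0, y).
- move=> [x y] /=; split=> [->|[z [_ <-]]] //; by exists x.
Qed.

Lemma dsum_fd : fin_dim M -> fin_dim N -> fin_dim dsum.
Proof.
move=> /fin_dimP [I [x hx]] /fin_dimP [J [y hy]]; apply/fin_dimP.
exists (I + J)%type, (fun k => match k with inl i => (x i, 0) | inr j => (0, y j) end).
move=> [m n]; have [c cE] := hx m; have [c' cE'] := hy n.
exists (fun k => match k with inl i => c i | inr j => c' j end).
rewrite big_sumType /= cE cE'; congr (_, _); rewrite /=.
  rewrite (big_morph (fun z : M * N => z.1) (id1 := 0) (op1 := +%R)) //.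
  rewrite (big_morph (fun z : M * N => z.1) (id1 := 0) (op1 := +%R)) //=.
  by rewrite [X in _ = _ + X]big1 ?addr0 // => i _; rewrite scaler0.
rewrite (big_morph (fun z : M * N => z.2) (id1 := 0) (op1 := +%R)) //.
rewrite (big_morph (fun z : M * N => z.2) (id1 := 0) (op1 := +%R)) //=.
by rewrite [X in _ = X + _]big1 ?add0r // => i _; rewrite scaler0.
Qed.

End DirectSum.

Section RankIso.
Variables (K : fieldType) (B : superalgebra K) (V : zmodType).
Variable r : fd_grmod B -> V.
Hypotheses (rD : forall M' M M'' : fd_grmod B, short_exact M' M M'' ->
    r M = r M' + r M'')
  (r_iso : forall M N : fd_grmod B, r M = r N -> @isomorphic (Gr B) M N)
  (r_gen : forall v, exists M N : fd_grmod B, v = r M - r N).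

Fixpoint krank (s : kterm (fd_grmod B)) : V :=
  match s with
  | KClass M => r M
  | KZero => 0
  | KAdd s t => krank s + krank t
  | KOpp s => - krank s
  end.

Let kdiff (M N : fd_grmod B) := KAdd (KClass M) (KOpp (KClass N)).

Definition fd_dsum (M N : fd_grmod B) : fd_grmod B :=
  FdGrMod (dsum_fd (fd_modP M) (fd_modP N)).

Let kdsum (M N : fd_grmod B) :
  k_eq (KClass (fd_dsum M N)) (KAdd (KClass M) (KClass N)).
Proof. by apply: keq_exact; exact: dsum_exact. Qed.

Lemma kterm_diff s : exists M N, k_eq s (kdiff M N).
Proof.
elim: s => [M||s [M [N h]] t [M' [N' h']]|s [M [N h]]].
- exists M, (zero_fd B); rewrite /kdiff k_zero.
  rewrite -[X in KAdd _ X](keq_add0 (KOpp KZero)) (keq_addC KZero) keq_addN.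
  by rewrite keq_addC keq_add0; reflexivity.
- exists (zero_fd B), (zero_fd B).
  by rewrite /kdiff (keq_addC (KClass _)) keq_addN; reflexivity.
- exists (fd_dsum M M'), (fd_dsum N N'); rewrite /kdiff !kdsum k_oppD.
  by rewrite h h' k_ACA; reflexivity.
- by exists N, M; rewrite h /kdiff k_oppD k_oppK keq_addC; reflexivity.
Qed.

Lemma krank_eq s t : k_eq s t -> krank s = krank t.
Proof.
elim=> {s t} /=.
- by [].
- by [].
- by move=> s t u _ -> _ ->.
- by move=> s s' t t' _ -> _ ->.
- by move=> s s' _ ->.
- by move=> s t u; rewrite addrA.
- by move=> s t; rewrite addrC.
- by move=> s; rewrite add0r.
- by move=> s; rewrite addNr.
- by move=> M' M M'' /rD.
Qed.

(** Every expression is a difference [[M] - [N]]. Equal ranks of [[M] - [N]] and [[M'] - [N']] mean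
    equal ranks of two direct sums, which are then isomorphic and have the same class. *)
Lemma rank_grothendieck : grothendieck_iso B V.
Proof.
exists krank; split=> // [s t|v]; last first.
  by have [M [N ->]] := r_gen v; exists (kdiff M N).
split=> [E|]; last exact: krank_eq.
have [M [N h]] := kterm_diff s; have [M' [N' h']] := kterm_diff t.
have E' : r (fd_dsum M N') = r (fd_dsum M' N).
  rewrite (rD (M := fd_dsum M N') (dsum_exact M N')).
  rewrite (rD (M := fd_dsum M' N) (dsum_exact M' N)).
  move: E; rewrite (krank_eq h) (krank_eq h') /= => /eqP.
  by rewrite subr_eq addrAC eq_sym subr_eq eq_sym => /eqP.
have e : k_eq (KAdd (KClass M) (KClass N')) (KAdd (KClass M') (KClass N)).
  by rewrite -!kdsum; apply: k_iso; exact: r_iso.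
have c P Q P' : k_eq (KAdd (KAdd (KClass Q) (KClass P')) (kdiff P Q))
    (KAdd (KClass P) (KClass P')).
  rewrite /kdiff (keq_addC (KClass P) (KOpp _)) k_ACA (keq_addC (KClass Q)) keq_addN.
  by rewrite keq_add0 keq_addC; reflexivity.
rewrite h h'; apply: (@k_cancel _ _ _ _ (KAdd (KClass N) (KClass N'))).
by rewrite c (keq_addC (KClass N)) c; exact: e.
Qed.

End RankIso.

(** * Bases of homogeneous components *)

Section Basis.
Variables (K : fieldType) (B : superalgebra K).
Hypothesis Bdiv : graded_division B.

(** Gaussian elimination over the division ring of even elements, with coefficients acting from the
    left. *)
Lemma left_dependence m n (a : 'I_n -> 'I_m -> B) : (m < n)%N ->
  (forall i j, sa_gr B false (a i j)) ->
  exists2 c : 'I_n -> B, exists i, c i <> 0 & forall j, \sum_i c i * a i j = 0.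
Proof.
elim: m n a => [|m IH] [|n] a // mn ha.
  exists (fun _ => 1); last by case.
  by exists 0; exact: gdiv_neq0.
have [[k nk]|z] := pselect (exists k, a k ord_max <> 0); last first.
  have [|c nc cE] := IH n.+1 (fun i j => a i (lift ord_max j)) _ (fun i j => ha _ _).
    by apply: leq_trans mn; rewrite ltnS.
  exists c => // j; case: (unliftP ord_max j) => [j' ->|->]; first exact: cE.
  rewrite big1 // => i _; have -> : a i ord_max = 0.
    by apply: contrapT => h; apply: z; exists i.
  by rewrite mulr0.
have [u u0 ua] := gdiv_inv Bdiv (ha k ord_max) nk.
(* The last column is cleared with pivot row [k]; the new entries are still even. In [c'] the
   coefficient of that row is chosen to cancel the last column. *)
pose a' (i : 'I_n) (j : 'I_m) : B := a (lift k i) (lift ord_max j) -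
  a (lift k i) ord_max * u * a k (lift ord_max j).
have [i j|c [i0 ni0] cE] := IH n a' mn.
  apply: (Z2grB (sa_grP B)); first exact: ha.
  exact: (sa_grM (sa_grM (ha _ _) u0) (ha _ _)).
pose c' i := if unlift k i is Some i' then c i'
  else - \sum_i c i * a (lift k i) ord_max * u.
exists c'; first by exists (lift k i0); rewrite /c' liftK.
move=> j; rewrite (bigD1_ord k) //= /c' unlift_none.
rewrite [X in _ + X = _](eq_bigr (fun i => c i * a (lift k i) j)); last first.
  by move=> i _; rewrite liftK.
rewrite mulNr mulr_suml addrC -sumrB.
case: (unliftP ord_max j) => [j' ->|->].
  rewrite -[RHS](cE j'); apply: eq_bigr => i _.
  by rewrite /a' mulrBr !mulrA.
by rewrite big1 // => i _; rewrite -(mulrA _ u) ua mulr1 subrr.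
Qed.

(** Spanning concerns the component of degree [b] and even coefficients, whereas independence is
    over all of [B], so that such families can serve as bases of modules. *)
Definition dbasis (b : bool) (M : grmod B) (n : nat) (x : 'I_n -> M) : Prop :=
  [/\ forall i, gm_gr M b (x i),
      forall c : 'I_n -> B, \sum_i c i *: x i = 0 -> forall i, c i = 0 &
      forall m, gm_gr M b m -> exists2 c : 'I_n -> B,
        forall i, sa_gr B false (c i) & m = \sum_i c i *: x i].

Lemma mpart_comb (M : grmod B) b n (x : 'I_n -> M) (c : 'I_n -> B) j :
  (forall i, gm_gr M b (x i)) ->
  mpart (j (+) b) (\sum_i c i *: x i) = \sum_i apart j (c i) *: x i.
Proof.
move=> hx; rewrite /mpart part_bigsum; apply: eq_bigr => i _.
rewrite -{1}(part_sumb (sa_grP B) j (c i)) scalerDl partD.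
have P k : gm_gr M (k (+) b) (part (sa_grP B) k (c i) *: x i).
  exact: (gm_grM (partP (sa_grP B) k (c i)) (hx i)).
rewrite (part_id _ (P j)) (part_homog _ _ (P (~~ j))).
by case: (j); case: (b); rewrite addr0.
Qed.

Lemma dbasis_le b (M : grmod B) n m (x : 'I_n -> M) (y : 'I_m -> M) :
  dbasis b x -> dbasis b y -> (n <= m)%N.
Proof.
move=> [xb xi _] [yb yi ys]; rewrite leqNgt; apply/negP => mn.
pose a i := projT1 (cid2 (ys _ (xb i))).
have a0 i j : sa_gr B false (a i j) by rewrite /a; case: cid2.
have aE i : x i = \sum_j a i j *: y j by rewrite /a; case: cid2.
have [c [i0 ni0] cE] := left_dependence mn a0; apply: ni0.
apply: xi; rewrite (eq_bigr (fun i => \sum_j (c i * a i j) *: y j)); last first.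
  by move=> i _; rewrite aE scaler_sumr; apply: eq_bigr => j _; rewrite scalerA.
rewrite exchange_big big1 // => j _.
by rewrite -scaler_suml cE scale0r.
Qed.

Lemma dbasis_ex b (M : grmod B) n (x : 'I_n -> M) : (forall i, gm_gr M b (x i)) ->
  (forall m, gm_gr M b m -> exists c : 'I_n -> B, m = \sum_i c i *: x i) ->
  exists k (y : 'I_k -> M), dbasis b y.
Proof.
elim: n x => [|n IH] x xb xs.
  exists 0%N, x; split=> // [c _ []//|m mb].
  by have [c ->] := xs m mb; exists c => // -[].
have [ind|] := pselect (forall c : 'I_n.+1 -> B, \sum_i c i *: x i = 0 ->
    forall i, c i = 0).
  exists n.+1, x; split=> // m mb; have [c cE] := xs m mb.
  exists (fun i => apart false (c i)); first by move=> i; exact: partP.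
  by rewrite -(mpart_comb _ _ xb) -cE addFb /mpart part_id.
move=> nind; have [c [k [cE nk]]] : exists c : 'I_n.+1 -> B, exists k,
    \sum_i c i *: x i = 0 /\ c k <> 0.
  apply: contrapT => h; apply: nind => c cE i; apply: contrapT => ni.
  by apply: h; exists c, i.
(* The relation may be inhomogeneous; in one of its homogeneous parts the coefficient at [k] is
   nonzero, hence invertible, and [x k] can be discarded. *)
have [j nj] := nonzero_part (sa_grP B) nk.
have cE' : \sum_i apart j (c i) *: x i = 0.
  by rewrite -(mpart_comb _ _ xb) cE /mpart part0.
have [u _ uc] := gdiv_inv Bdiv (partP (sa_grP B) j (c k)) nj.
have xk : x k = - \sum_i (u * apart j (c (lift k i))) *: x (lift k i).
  move: cE'; rewrite (bigD1_ord k) //= => /(congr1 (fun z => u *: z)).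
  rewrite scaler0 scalerDr scalerA uc scale1r scaler_sumr => /eqP.
  rewrite addr_eq0 => /eqP ->; congr (- _); apply: eq_bigr => i _.
  by rewrite scalerA.
apply: (IH (fun i => x (lift k i))) => [i|m mb]; first exact: xb.
have [d ->] := xs m mb.
exists (fun i => d (lift k i) - d k * (u * apart j (c (lift k i)))).
rewrite (bigD1_ord k) //= xk scalerN scaler_sumr addrC -sumrB.
by apply: eq_bigr => i _; rewrite scalerBl scalerA.
Qed.

Lemma fd_dbasis b (M : grmod B) : fin_dim M -> exists k (y : 'I_k -> M), dbasis b y.
Proof.
move=> [s hs]; apply: (@dbasis_ex b M (size s) (fun i => mpart b s`_i)).
  by move=> i; exact: partP.
move=> m mb; have [c cE] := hs m; exists (fun i => sa_scalar B (c i)).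
rewrite -[LHS](part_id (gm_grP M) mb) cE part_bigsum; apply: eq_bigr => i _.
by rewrite -/(mpart _ _) (mpartZ _ _ (sa_scalar_gr B _)).
Qed.

Definition dimb b (M : fd_grmod B) : nat := projT1 (cid (fd_dbasis b (fd_modP M))).

Lemma dimbP b (M : fd_grmod B) : exists y : 'I_(dimb b M) -> M, dbasis b y.
Proof. by rewrite /dimb; case: cid. Qed.

Lemma dimb_eq b (M : fd_grmod B) n (x : 'I_n -> M) : dbasis b x -> dimb b M = n.
Proof.
move=> hx; have [y hy] := dimbP b M; apply/eqP; rewrite eqn_leq.
by rewrite (dbasis_le hx hy) (dbasis_le hy hx).
Qed.

(** The image of a basis of [M'] followed by homogeneous lifts of a basis of [M''] is a basis of the
    same degree in [M]. *)
Lemma dimb_exact b (M' M M'' : fd_grmod B) : short_exact M' M M'' ->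
  dimb b M = (dimb b M' + dimb b M'')%N.
Proof.
move=> [f [g [fi gs fg]]].
have [x [xb xi xs]] := dimbP b M'; have [z [zb zi zs]] := dimbP b M''.
pose y j := mpart b (projT1 (cid (gs (z j)))).
have yb j : gm_gr M b (y j) by exact: partP.
have gy j : g (y j) = z j.
  by rewrite /y gh_part; case: cid => /= w ->; rewrite /mpart part_id.
have gf w : g (f w) = 0 by apply/fg; exists w.
pose t i := match split i with inl i => f (x i) | inr j => y j end.
have tE (c : 'I_(dimb b M' + dimb b M'') -> B) : \sum_i c i *: t i =
    f (\sum_i c (lshift _ i) *: x i) + \sum_j c (rshift _ j) *: y j.
  rewrite big_split_ord /=; congr (_ + _).
    by rewrite gh_sum; apply: eq_bigr => i _; rewrite ghZ /t (unsplitK (inl i)).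
  by apply: eq_bigr => j _; rewrite /t (unsplitK (inr j)).
apply: (@dimb_eq b M _ t); split.
- by move=> i; rewrite /t; case: split => j; [exact: gh_even|].
- move=> c; rewrite tE => E.
  have c2 : forall j, c (rshift _ j) = 0.
    apply: (zi (fun j => c (rshift _ j))).
    have := congr1 g E; rewrite ghD gf add0r gh0 gh_sum => E'.
    by rewrite -[RHS]E'; apply: eq_bigr => j _; rewrite ghZ gy.
  have c1 : forall j, c (lshift _ j) = 0.
    apply: (xi (fun j => c (lshift _ j))); apply: fi; rewrite gh0.
    move: E; rewrite [X in _ + X]big1 ?addr0 // => j _.
    by rewrite c2 scale0r.
  by move=> i; rewrite -(splitK i); case: split => j /=.
move=> m mb; have [c'' c''0 c''E] := zs (g m) (gh_even g mb).
have [m' m'E] : exists m', f m' = m - \sum_j c'' j *: y j.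
  apply/fg; rewrite ghD ghN c''E gh_sum; apply/eqP; rewrite subr_eq0; apply/eqP.
  by apply: eq_bigr => j _; rewrite ghZ gy.
have m'b : gm_gr M' b m'.
  apply: (gh_inj_gr fi); rewrite m'E; apply: (Z2grB (gm_grP M)) => //.
  apply: (Z2gr_sum (gm_grP M)) => j _; rewrite -(addFb b); exact: gm_grM.
have [c' c'0 c'E] := xs m' m'b.
exists (fun i => match split i with inl i => c' i | inr j => c'' j end).
  by move=> i; case: split.
rewrite tE (eq_bigr (fun i => c' i *: x i)); last first.
  by move=> i _; rewrite (unsplitK (inl i)).
rewrite -c'E m'E [X in _ + X](eq_bigr (fun j => c'' j *: y j)) ?subrK // => j _.
by rewrite (unsplitK (inr j)).
Qed.

(** A basis of the whole module with prescribed degrees; it covers both all-even bases and bases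
    with even and odd members. *)
Definition hbasis (I : finType) (d : I -> bool) (M : grmod B) (x : I -> M) : Prop :=
  [/\ forall i, gm_gr M (d i) (x i),
      forall c : I -> B, \sum_i c i *: x i = 0 -> forall i, c i = 0 &
      forall m, exists c : I -> B, m = \sum_i c i *: x i].

Section HbasisIso.
Variables (I : finType) (d : I -> bool) (M N : grmod B) (x : I -> M) (y : I -> N).
Hypotheses (hx : hbasis d x) (hy : hbasis d y).

Let coef_ex m : exists c : I -> B, m = \sum_i c i *: x i. Proof. by case: hx. Qed.
Let coef m := projT1 (cid (coef_ex m)).
Let coefE m : m = \sum_i coef m i *: x i. Proof. by rewrite /coef; case: cid. Qed.

Let coef_uniq m c : m = \sum_i c i *: x i -> forall i, coef m i = c i.
Proof.
move=> mE i; case: hx => _ xi _.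
apply/eqP; rewrite -subr_eq0; apply/eqP; apply: (xi (fun i => coef m i - c i)).
rewrite (eq_bigr (fun i => coef m i *: x i - c i *: x i)); last first.
  by move=> k _; rewrite scalerBl.
by rewrite sumrB -coefE -mE subrr.
Qed.

Let hom_fun m : N := \sum_i coef m i *: y i.

Let hom_lin : linear hom_fun.
Proof.
move=> b u v; rewrite /hom_fun scaler_sumr -big_split /=; apply: eq_bigr => i _.
rewrite (@coef_uniq _ (fun i => b * coef u i + coef v i)) ?scalerDl ?scalerA //.
rewrite {1}(coefE u) {1}(coefE v) scaler_sumr -big_split /=.
by apply: eq_bigr => k _; rewrite scalerDl scalerA.
Qed.

Let hom_even j m : gm_gr M j m -> gm_gr N j (hom_fun m).
Proof.
move=> mj; case: (hx) => xd _ _; case: (hy) => yd _ _.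
apply: (Z2gr_sum (gm_grP N)) => i _.
(* In a homogeneous [m] of degree [j], the coefficient at [i] is homogeneous of degree [j + d i],
   because its other component contributes to the other degree. *)
rewrite (@coef_uniq m (fun i => apart (j (+) d i) (coef m i))).
  by have := gm_grM (partP (sa_grP B) (j (+) d i) (coef m i)) (yd i);
    rewrite -addbA addbb addbF.
rewrite -[LHS](part_id (gm_grP M) mj) {1}(coefE m) part_bigsum.
apply: eq_bigr => k _.
rewrite -{1}(part_sumb (sa_grP B) (j (+) d k) (coef m k)) scalerDl partD.
have P l : gm_gr M (l (+) d k) (part (sa_grP B) l (coef m k) *: x k).
  exact: (gm_grM (partP (sa_grP B) l (coef m k)) (xd k)).
rewrite !(part_homog _ _ (P _)).
by case: (j); case: (d k); rewrite addr0.
Qed.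

Lemma hbasis_iso : @isomorphic (Gr B) M N.
Proof.
case: (hx) => _ xi _; case: (hy) => _ yi ys.
apply: (@bij_isomorphic _ _ _ _ (GrHom hom_lin hom_even)).
apply: inj_surj_bij.
  apply: gh_inj0 => m /= /yi c0; rewrite (coefE m) big1 // => i _.
  by rewrite c0 scale0r.
move=> n; have [c cE] := ys n; exists (\sum_i c i *: x i).
rewrite /= /hom_fun cE; apply: eq_bigr => i _.
by rewrite (@coef_uniq _ c).
Qed.

End HbasisIso.

Lemma regular_dbasis : dbasis false (fun _ : 'I_1 => 1 : regular B).
Proof.
split.
- by move=> i; exact: sa_gr1.
- move=> c; rewrite big_ord1 => c0 i; rewrite ord1 -[RHS]c0.
  by rewrite -[c 0 *: _]/(c 0 * 1) mulr1.
- move=> m m0; exists (fun _ => m : B) => //.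
  by rewrite big_ord1 -[_ *: _]/((m : B) * 1) mulr1.
Qed.

Lemma shift_dbasis b (M : grmod B) n (x : 'I_n -> M) : dbasis b x ->
  @dbasis (~~ b) (shift M) n x.
Proof.
move=> [xb xi xs]; split=> [i|//|m mb]; first by rewrite /= negbK.
by apply: xs; rewrite /= negbK in mb.
Qed.

Lemma zero_dbasis b (M : grmod B) : (forall m, gm_gr M b m -> m = 0) ->
  dbasis b (fun _ : 'I_0 => 0 : M).
Proof.
move=> h; split=> [i|c _ []//|m /h ->]; first exact: (Z2gr0 (gm_grP M)).
by exists (fun _ => 0); [case | rewrite big_ord0].
Qed.

Hypothesis Bfd : sa_fin_dim B.

Definition fd_regular : fd_grmod B := @FdGrMod K B (regular B) Bfd.
Definition fd_shift_regular : fd_grmod B := @FdGrMod K B (shift (regular B)) Bfd.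

Lemma dimb_dsum b (M N : fd_grmod B) :
  dimb b (fd_dsum M N) = (dimb b M + dimb b N)%N.
Proof. exact: (dimb_exact b (M := fd_dsum M N) (dsum_exact M N)). Qed.

Lemma dimb_zero b : dimb b (zero_fd B) = 0%N.
Proof.
by apply: dimb_eq; apply: zero_dbasis => m _; exact: (zero_modE m).
Qed.

Definition fd_copies (M : fd_grmod B) (n : nat) : fd_grmod B :=
  iter n (fd_dsum M) (zero_fd B).

Lemma dimb_copies b M n : dimb b (fd_copies M n) = (n * dimb b M)%N.
Proof.
elim: n => [|n IH]; first exact: dimb_zero.
by rewrite [LHS](dimb_dsum b M (fd_copies M n)) IH mulSn.
Qed.

Lemma odd_unit_grothendieck (u : B) : sa_gr B true u -> u <> 0 ->
  grothendieck_iso B int.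
Proof.
move=> u1 nu; pose r (M : fd_grmod B) := (dimb false M)%:Z.
have rreg : r fd_regular = 1.
  by congr Posz; exact: (dimb_eq (M := fd_regular) regular_dbasis).
apply: (@rank_grothendieck _ _ _ r).
- by move=> M' M M'' /(dimb_exact false) h; rewrite /r h PoszD.
- move=> M N [E]; have [x hx] := dimbP false M; have [y hy] := dimbP false N.
  (* An odd vector [m] equals [v (u m)] with [v u = 1], and [u m] is even; so an even basis already
     spans everything. *)
  have full n (P : grmod B) (z : 'I_n -> P) : dbasis false z -> hbasis (fun _ => false) z.
    move=> [z0 zi zs]; split=> // m.
    have [v v1 vu] := gdiv_inv Bdiv u1 nu.
    have [c _ cE] := zs _ (partP (gm_grP P) false m).
    have um : gm_gr P false (u *: mpart true m).
      exact: (gm_grM u1 (partP (gm_grP P) true m)).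
    have [c' _ c'E] := zs _ um.
    exists (fun i => c i + v * c' i); rewrite -{1}(part_sum (gm_grP P) m) cE.
    rewrite -[part _ true m]scale1r -vu -scalerA c'E scaler_sumr -big_split /=.
    by apply: eq_bigr => i _; rewrite scalerDl scalerA.
  by move: x hx; rewrite E => x hx; exact: (hbasis_iso (full _ _ _ hx) (full _ _ _ hy)).
- have rz : r (zero_fd B) = 0 by rewrite /r dimb_zero.
  have rc n : r (fd_copies fd_regular n) = n%:Z.
    by rewrite /r dimb_copies; have [->] := rreg; rewrite muln1.
  case=> n; [exists (fd_copies fd_regular n), (zero_fd B)
            |exists (zero_fd B), (fd_copies fd_regular n.+1)]; rewrite rc rz.
    by rewrite subr0.
  by rewrite sub0r NegzE.
Qed.

Lemma even_grothendieck : (forall b, sa_gr B true b -> b = 0) ->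
  grothendieck_iso B (int * int)%type.
Proof.
move=> B1; pose r (M : fd_grmod B) := ((dimb false M)%:Z, (dimb true M)%:Z).
apply: (@rank_grothendieck _ _ _ r).
- by move=> M' M M'' h; rewrite /r !(dimb_exact _ h) !PoszD.
- move=> M N [E0 E1].
  have [x0 hx0] := dimbP false M; have [x1 hx1] := dimbP true M.
  have [y0 hy0] := dimbP false N; have [y1 hy1] := dimbP true N.
  have full n m (P : grmod B) (z : 'I_n -> P) (w : 'I_m -> P) :
      dbasis false z -> dbasis true w ->
      hbasis (fun k : 'I_n + 'I_m => if k is inl _ then false else true)
        (fun k => match k with inl i => z i | inr j => w j end).
    move=> [z0 zi zs] [w1 wi ws]; split.
    - by case.
    - move=> c; rewrite big_sumType /= => E.
      (* All of [B] is even, so a relation splits into one among even and one among odd basis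
         elements. *)
      have cB k : sa_gr B false (c k).
        rewrite -(part_sum (sa_grP B) (c k)) [X in _ + X]B1 ?addr0; exact: partP.
      have h0 : gm_gr P false (\sum_i c (inl i) *: z i).
        by apply: (Z2gr_sum (gm_grP P)) => i _; exact: (gm_grM (cB _) (z0 i)).
      have h1 : gm_gr P true (\sum_i c (inr i) *: w i).
        by apply: (Z2gr_sum (gm_grP P)) => i _; exact: (gm_grM (cB _) (w1 i)).
      have [] := Z2gr_uniq (gm_grP P) h0 h1 (Z2gr0 (gm_grP P) _) (Z2gr0 (gm_grP P) _).
        by rewrite addr0.
      move=> /(zi (fun i => c (inl i))) c0 /(wi (fun i => c (inr i))) c1.
      by case.
    - move=> m'; have [c _ cE] := zs _ (partP (gm_grP P) false m').
      have [c' _ c'E] := ws _ (partP (gm_grP P) true m').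
      exists (fun k => match k with inl i => c i | inr j => c' j end).
      by rewrite big_sumType /= -cE -c'E part_sum.
  move: x0 hx0 x1 hx1; rewrite E0 E1 => x0 hx0 x1 hx1.
  exact: (hbasis_iso (full _ _ _ _ _ hx0 hx1) (full _ _ _ _ _ hy0 hy1)).
have d00 : dimb false fd_regular = 1%N.
  exact: (dimb_eq (M := fd_regular) regular_dbasis).
have d01 : dimb true fd_regular = 0%N.
  exact: (dimb_eq (M := fd_regular) (@zero_dbasis true (regular B) B1)).
have d10 : dimb false fd_shift_regular = 0%N.
  exact: (dimb_eq (M := fd_shift_regular) (@zero_dbasis false (shift (regular B)) B1)).
have d11 : dimb true fd_shift_regular = 1%N.
  exact: (dimb_eq (M := fd_shift_regular) (shift_dbasis regular_dbasis)).
have rc n m : r (fd_dsum (fd_copies fd_regular n) (fd_copies fd_shift_regular m)) =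
    (n%:Z, m%:Z).
  by rewrite /r !dimb_dsum !dimb_copies d00 d01 d10 d11 !muln0 !muln1 addn0.
have int_diff (k : int) : exists n m : nat, k = n%:Z - m%:Z.
  case: k => n; [exists n, 0%N | exists 0%N, n.+1]; first by rewrite subr0.
  by rewrite sub0r NegzE.
move=> [k l]; have [n [m ->]] := int_diff k; have [n' [m' ->]] := int_diff l.
exists (fd_dsum (fd_copies fd_regular n) (fd_copies fd_shift_regular n')).
exists (fd_dsum (fd_copies fd_regular m) (fd_copies fd_shift_regular m')).
by rewrite !rc.
Qed.

End Basis.

(** * The entries of the list and the theorem *)

Section Assembly.
Variable K : fieldType.

Lemma classified_even (A B : superalgebra K) : super_morita A B ->
  graded_division B -> sa_fin_dim B -> (forall b, sa_gr B true b -> b = 0) ->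
  classified A B [:: regular B; shift (regular B)] 2 (int * int)%type.
Proof.
move=> AB Bdiv Bfd B1.
exact: (classified_of_morita AB Bfd (irr_list_even Bdiv B1)
  (even_grothendieck Bdiv Bfd B1)).
Qed.

Lemma classified_odd (A B : superalgebra K) : super_morita A B ->
  odd_graded_division B -> classified A B [:: regular B] 1 int.
Proof.
move=> AB [Bdiv Bfd [u u1 nu]].
exact: (classified_of_morita AB Bfd (irr_list_odd_unit Bdiv u1 nu)
  (odd_unit_grothendieck Bdiv Bfd u1 nu)).
Qed.

Lemma has_sign_const (A : superalgebra K) n p k : has_sign A n p ->
  (forall i, (i < n)%N -> sign_of K p i = k) ->
  exists g : 'I_n -> A, is_clifford (fun _ => k) g.
Proof. by move=> [g H] h; exists g; apply: (is_clifford_ext H) => i; exact: h. Qed.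

Lemma clifford1_0_division : odd_graded_division (clifford K 1 0).
Proof.
have S := has_sign_clifford K 1 0.
have [|g H] := has_sign_const (k := 1) S; first by case.
by apply: (clifford1_division (mulr1 1) (has_sign_nontrivial S) H).
Qed.

Lemma clifford_definite_division p q :
  (forall a b c d : K, a * a + b * b + c * c + d * d = 0 ->
    [/\ a = 0, b = 0, c = 0 & d = 0]) ->
  (0 < p + q <= 3)%N -> (p == 0%N) || (q == 0%N) ->
  odd_graded_division (clifford K p q).
Proof.
move=> sum4 n3 pq; have S := has_sign_clifford K p q.
(* In a definite signature all squares agree with that of the first generator. *)
pose k := sign_of K p 0.
have [|g H] := has_sign_const (k := k) S.
  move=> i hi; rewrite /k /sign_of; case/orP: pq => /eqP E; subst.
    by [].
  by rewrite addn0 in hi; rewrite hi (leq_trans _ hi).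
have kk : k * k = 1 := sign_of_sq K p 0.
have N1 := has_sign_nontrivial S.
have [n1|[n2|n3']] : (p + q = 1 \/ p + q = 2 \/ p + q = 3)%N by lia.
- exact: (clifford1_division kk N1 H n1).
- exact: (clifford2_division kk N1 H sum4 n2).
- exact: (clifford3_division kk N1 H sum4 n3').
Qed.

End Assembly.

Lemma sum_sq4_eq0 (R : realDomainType) (a b c d : R) :
  a * a + b * b + c * c + d * d = 0 -> [/\ a = 0, b = 0, c = 0 & d = 0].
Proof.
move=> /eqP; rewrite -!expr2 !Num.Theory.paddr_eq0 ?Num.Theory.addr_ge0
  ?Num.Theory.sqr_ge0 // !sqrf_eq0.
by move=> /andP [/andP [/andP [/eqP -> /eqP ->] /eqP ->] /eqP ->].
Qed.

(* The source lists B = R_{0,1} for p - q = 5 and B = R_{0,3} for p - q = 7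
   (mod 8).  Those two entries are interchanged there: as printed both are
   false, since degree-zero endomorphism rings of irreducible modules (H for
   p - q = 5 and for R_{0,3}; R for p - q = 7 and for R_{0,1}) are invariant
   under equivalence.  The entries are stated here in the corrected order. *)
Theorem theorem5p4 (R : realType) :
  (forall p q : nat, (0 < p)%N -> (0 < q)%N ->
    ((p%:Z - q%:Z = 0 %[mod 8])%Z ->
       classified (clifford R p q) (ground R)
         [:: regular (ground R); shift (regular (ground R))]
         2 (int * int)%type) /\
    ((p%:Z - q%:Z = 1 %[mod 8])%Z ->
       classified (clifford R p q) (clifford R 1 0)
         [:: regular (clifford R 1 0)] 1 int) /\
    ((p%:Z - q%:Z = 2 %[mod 8])%Z ->
       classified (clifford R p q) (clifford R 2 0)
         [:: regular (clifford R 2 0)] 1 int) /\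
    ((p%:Z - q%:Z = 3 %[mod 8])%Z ->
       classified (clifford R p q) (clifford R 3 0)
         [:: regular (clifford R 3 0)] 1 int) /\
    ((p%:Z - q%:Z = 4 %[mod 8])%Z ->
       classified (clifford R p q) (quaternions R)
         [:: regular (quaternions R); shift (regular (quaternions R))]
         2 (int * int)%type) /\
    ((p%:Z - q%:Z = 5 %[mod 8])%Z ->
       classified (clifford R p q) (clifford R 0 3)
         [:: regular (clifford R 0 3)] 1 int) /\
    ((p%:Z - q%:Z = 6 %[mod 8])%Z ->
       classified (clifford R p q) (clifford R 0 2)
         [:: regular (clifford R 0 2)] 1 int) /\
    ((p%:Z - q%:Z = 7 %[mod 8])%Z ->
       classified (clifford R p q) (clifford R 0 1)
         [:: regular (clifford R 0 1)] 1 int)) /\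
  (forall p : nat, (0 < p)%N ->
    (~~ odd p ->
       classified (clifford R[i] p 0) (ground R[i])
         [:: regular (ground R[i]); shift (regular (ground R[i]))]
         2 (int * int)%type) /\
    (odd p ->
       classified (clifford R[i] p 0) (clifford R[i] 1 0)
         [:: regular (clifford R[i] 1 0)] 1 int)).
Proof.
have two : (2 : R) != 0 by rewrite Num.Theory.pnatr_eq0.
have twoC : (2 : R[i]) != 0 by rewrite Num.Theory.pnatr_eq0.
have sum4 := @sum_sq4_eq0 R.
split=> [p q p0 q0|p p0].
  have red r : (p%:Z - q%:Z = r%:Z %[mod 8])%Z -> (r < 8)%N ->
      super_morita (clifford R p q) (real_target R r).
    (* The integer congruence is translated to natural numbers, with [7] representing [-1] modulo
       8. *)
    move=> pq r8; have -> : r = ((p + 7 * q) %% 8)%N by lia.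
    by apply: (real_reduction two sum4); rewrite addn_gt0 p0.
  have [gd gf] := ground_division R.
  have [hd hf] := quaternions_division sum4.
  have even r : (p%:Z - q%:Z = r%:Z %[mod 8])%Z -> (r < 8)%N ->
      graded_division (real_target R r) -> sa_fin_dim (real_target R r) ->
      (forall b, sa_gr (real_target R r) true b -> b = 0) ->
      classified (clifford R p q) (real_target R r)
        [:: regular (real_target R r); shift (regular (real_target R r))]
        2 (int * int)%type.
    by move=> pq r8; exact: classified_even (red r pq r8).
  have odd r : (p%:Z - q%:Z = r%:Z %[mod 8])%Z -> (r < 8)%N ->
      odd_graded_division (real_target R r) ->
      classified (clifford R p q) (real_target R r) [:: regular (real_target R r)] 1 int.
    by move=> pq r8; exact: classified_odd (red r pq r8).
  split; first by move=> /(even 0%N); exact.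
  split; first by move=> /(odd 1%N); apply=> //; exact: clifford1_0_division.
  split; first by move=> /(odd 2%N); apply=> //; exact: clifford_definite_division.
  split; first by move=> /(odd 3%N); apply=> //; exact: clifford_definite_division.
  split; first by move=> /(even 4%N); exact.
  split; first by move=> /(odd 5%N); apply=> //; exact: clifford_definite_division.
  split; first by move=> /(odd 6%N); apply=> //; exact: clifford_definite_division.
  by move=> /(odd 7%N); apply=> //; exact: clifford_definite_division.
have ii : 'i * 'i = -1 :> R[i] by rewrite -expr2 Num.Theory.sqrCi.
have red := complex_reduction twoC ii p0.
have [gd gf] := ground_division R[i].
split=> [/negbTE|] pE; rewrite pE in red.
  exact: classified_even.
by apply: (classified_odd red); exact: clifford1_0_division.
Qed.
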